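(* Let $k$ be an algebraically closed field, $d\geqslant 1$ an integer, and let $\mathcal{T}$ be a $k$-linear $\operatorname{Hom}$-finite $(d+2)$-angulated category with split idempotents, with $d$-suspension functor $\Sigma^d$ and with a Serre functor $S$. Let $T\in\mathcal{T}$ be an object, let $\Gamma=\operatorname{End}_{\mathcal{T}}T$, and let $\mathcal{D}$ be the essential image of the functor $\mathcal{T}(T,-):\mathcal{T}\to\operatorname{mod}\Gamma$. Then the following conditions (i), (ii), (iii) are equivalent, where conditions (a), (a'), (b), (strong a), (strong a') on $T$ are those spelled out in the context. (i) $\mathcal{D}$ is a $d$-cluster tilting subcategory of $\operatorname{mod}\Gamma$ and the functor $\mathcal{T}(T,-):\mathcal{T}\to\operatorname{mod}\Gamma$ is full. (ii) $T$ satisfies conditions (a), (a'), and (b). (iii) $T$ satisfies conditions (strong a), (strong a'), and (b).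
   Context: **$(d+2)$-angulated categories** (Geiss–Keller–Oppermann). Let $\mathcal{T}$ be an additive category with an automorphism $\Sigma^d$ (the $d$-suspension; the symbol is a single functor), and put $n=d+2$. An $n$-$\Sigma^d$-sequence is a sequence of morphisms $X_1\xrightarrow{\alpha_1}X_2\xrightarrow{\alpha_2}\cdots\xrightarrow{\alpha_{n-1}}X_n\xrightarrow{\alpha_n}\Sigma^dX_1$. Its left rotation is $X_2\xrightarrow{\alpha_2}\cdots\xrightarrow{\alpha_n}\Sigma^dX_1\xrightarrow{(-1)^n\Sigma^d\alpha_1}\Sigma^dX_2$. A morphism to another such sequence $(Y_i,\beta_i)$ is a tuple $\varphi_i:X_i\to Y_i$, $1\leqslant i\leqslant n$, commuting with the structure maps (using $\Sigma^d\varphi_1$ at the last place). $\mathcal{T}$ is $(d+2)$-angulated if it is equipped with a class of $n$-$\Sigma^d$-sequences, called $(d+2)$-angles, closed under isomorphism, such that: (F1) (a) the class is closed under direct sums and direct summands; (b) for each $X$ the trivial sequence $X\xrightarrow{1_X}X\to 0\to\cdots\to 0\to\Sigma^dX$ is a $(d+2)$-angle; (c) each morphism $\alpha_1:X_1\to X_2$ is the first morphism of a $(d+2)$-angle. (F2) A sequence is a $(d+2)$-angle if and only if its left rotation is. (F3) Given two $(d+2)$-angles $(X_i,\alpha_i)$, $(Y_i,\beta_i)$ and $\varphi_1,\varphi_2$ with $\varphi_2\alpha_1=\beta_1\varphi_1$, there are $\varphi_3,\ldots,\varphi_n$ completing them to a morphism of sequences. (F4) In (F3) the $\varphi_3,\ldots,\varphi_n$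 can be chosen so that the cone $X_2\oplus Y_1\to X_3\oplus Y_2\to\cdots\to\Sigma^dX_1\oplus Y_n\to\Sigma^dX_2\oplus\Sigma^dY_1$, with maps $\begin{pmatrix}-\alpha_i&0\\ \varphi_i&\beta_{i-1}\end{pmatrix}$ for $2\leqslant i\leqslant n$ and last map $\begin{pmatrix}-\Sigma^d\alpha_1&0\\ \Sigma^d\varphi_1&\beta_n\end{pmatrix}$, is a $(d+2)$-angle. By rotation, $(d+2)$-angles may be written starting at any term; $\Sigma^{-d}$ is the inverse of $\Sigma^d$. **Conventions.** $\mathcal{T}(X,Y)$ denotes the morphism space. A Serre functor is an autoequivalence $S$ of $\mathcal{T}$ with natural isomorphisms $D\mathcal{T}(X,Y)\cong\mathcal{T}(Y,SX)$, where $D=\operatorname{Hom}_k(-,k)$. $\operatorname{mod}\Gamma$ is the category of finite dimensional right $\Gamma$-modules; $\mathcal{T}(T,X)$ is a right $\Gamma$-module by precomposition. The essential image $\mathcal{D}$ is the full subcategory of modules isomorphic to some $\mathcal{T}(T,X)$, $X\in\mathcal{T}$. $\operatorname{add}T$ is the full subcategory of direct summands of finite direct sums of copies of $T$. $\operatorname{Ext}^j_\Gamma(\mathcal{D},M)=0$ means $\operatorname{Ext}^j_\Gamma(D',M)=0$ for all $D'\in\mathcal{D}$, and similarly in the other variable. **$d$-cluster tilting subcategory.** A full subcategory $\mathcal{X}\subseteq\operatorname{mod}\Gamma$ is $d$-cluster tilting if it is functorially finite in $\operatorname{mod}\Gamma$ and $\mathcal{X}=\{X\in\operatorname{mod}\Gamma\mid\operatorname{Ext}^i_\Gamma(X,\mathcal{X})=0\text{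 for }1\leqslant i\leqslant d-1\}=\{X\in\operatorname{mod}\Gamma\mid\operatorname{Ext}^i_\Gamma(\mathcal{X},X)=0\text{ for }1\leqslant i\leqslant d-1\}$. **Conditions on $T$.** (a) Suppose that $M\in\operatorname{mod}\Gamma$ satisfies $\operatorname{Ext}^j_\Gamma(\mathcal{D},M)=0$ for $1\leqslant j\leqslant d-1$, and that $T_1\xrightarrow{f}T_0$ is a morphism in $\operatorname{add}T$ for which $\mathcal{T}(T,T_1)\xrightarrow{\mathcal{T}(T,f)}\mathcal{T}(T,T_0)\to M\to 0$ is a minimal projective presentation in $\operatorname{mod}\Gamma$. Then there exists a completion of $f$ to a $(d+2)$-angle in $\mathcal{T}$, $T_1\xrightarrow{f}T_0\xrightarrow{h_{d+1}}X_d\xrightarrow{h_d}\cdots\xrightarrow{h_2}X_1\xrightarrow{h_1}\Sigma^dT_1$, which satisfies $\mathcal{T}(T,h_i)=0$ for some $1\leqslant i\leqslant d+1$. (a') Suppose that $N\in\operatorname{mod}\Gamma$ satisfies $\operatorname{Ext}^j_\Gamma(N,\mathcal{D})=0$ for $1\leqslant j\leqslant d-1$, and that $ST_1\xrightarrow{g}ST_0$ is a morphism in $\operatorname{add}ST$ for which $0\to N\to\mathcal{T}(T,ST_1)\xrightarrow{\mathcal{T}(T,g)}\mathcal{T}(T,ST_0)$ is a minimal injective copresentation in $\operatorname{mod}\Gamma$. Then there exists a completion of $g$ to a $(d+2)$-angle in $\mathcal{T}$, $\Sigma^{-d}ST_0\xrightarrow{h_{d+1}}X_d\xrightarrow{h_d}\cdots\xrightarrow{h_2}X_1\xrightarrow{h_1}ST_1\xrightarrow{g}ST_0$,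 which satisfies $\mathcal{T}(T,h_i)=0$ for some $1\leqslant i\leqslant d+1$. (b) Suppose that $X\in\mathcal{T}$ is indecomposable and satisfies $\mathcal{T}(T,X)\neq 0$. Then there exists a $(d+2)$-angle in $\mathcal{T}$, $T_d\to\cdots\to T_0\to X\xrightarrow{h}\Sigma^dT_d$, with $T_i\in\operatorname{add}T$ for $0\leqslant i\leqslant d$, which satisfies $\mathcal{T}(T,h)=0$. (strong a) The same as (a), except that the requirement on the $(d+2)$-angle in the last line is replaced by $\mathcal{T}(T,h_d)=0$. (strong a') The same as (a'), except that the requirement on the $(d+2)$-angle in the last line is replaced by $\mathcal{T}(T,h_2)=0$. *)

(* Defs.v *)
From HB Require Import structures.
From mathcomp Require Import all_boot all_algebra.

Set Implicit Arguments.
Unset Strict Implicit.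
Unset Printing Implicit Defensive.

Import GRing.Theory.
Local Open Scope ring_scope.

Reserved Notation "g \oc f" (at level 40, left associativity).

(** * Hom-finite k-linear categories *)

(* Hom-finiteness is built in: morphism spaces are [vectType]s. *)
Record lincat (k : fieldType) := LinCat {
  ob :> Type;
  mor : ob -> ob -> vectType k;
  idm : forall X, mor X X;
  comp : forall X Y Z, mor Y Z -> mor X Y -> mor X Z;
  compA : forall X Y Z W (h : mor Z W) (g : mor Y Z) (f : mor X Y),
    comp h (comp g f) = comp (comp h g) f;
  comp1m : forall X Y (f : mor X Y), comp (idm Y) f = f;
  compm1 : forall X Y (f : mor X Y), comp f (idm X) = f;
  comp_linearl : forall X Y Z (f : mor X Y),
    linear (fun g : mor Y Z => comp g f);
  comp_linearr : forall X Y Z (g : mor Y Z),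
    linear (fun f : mor X Y => comp g f) }.

Arguments mor {k C} X Y : rename.
Arguments idm {k C} X : rename.
Arguments comp {k C X Y Z} g f : rename.
Notation "g \oc f" := (comp g f) : ring_scope.

Record addcat (k : fieldType) := AddCat {
  acat :> lincat k;
  ozero : acat;
  ozeroP : idm ozero = 0;
  osum : acat -> acat -> acat;
  oin1 : forall X Y, mor X (osum X Y);
  oin2 : forall X Y, mor Y (osum X Y);
  opr1 : forall X Y, mor (osum X Y) X;
  opr2 : forall X Y, mor (osum X Y) Y;
  opr1_in1 : forall X Y, opr1 X Y \oc oin1 X Y = idm X;
  opr2_in2 : forall X Y, opr2 X Y \oc oin2 X Y = idm Y;
  opr1_in2 : forall X Y, opr1 X Y \oc oin2 X Y = 0;
  opr2_in1 : forall X Y, opr2 X Y \oc oin1 X Y = 0;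
  osum_id : forall X Y,
    oin1 X Y \oc opr1 X Y + oin2 X Y \oc opr2 X Y = idm (osum X Y) }.

Arguments ozero {k C} : rename.
Arguments osum {k C} X Y : rename.
Arguments oin1 {k C} X Y : rename.
Arguments oin2 {k C} X Y : rename.
Arguments opr1 {k C} X Y : rename.
Arguments opr2 {k C} X Y : rename.

Definition is_iso (k : fieldType) (C : lincat k) (X Y : C) (f : mor X Y) :=
  exists g : mor Y X, g \oc f = idm X /\ f \oc g = idm Y.

Definition isomorphic (k : fieldType) (C : lincat k) (X Y : C) :=
  exists f : mor X Y, is_iso f.

Definition eqmor (k : fieldType) (C : lincat k) (X Y : C) (e : X = Y) :
  mor X Y := match e in _ = Z return mor X Z with erefl => idm X end.

Definition split_idempotents (k : fieldType) (C : lincat k) :=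
  forall (X : C) (e : mor X X), e \oc e = e ->
    exists (Y : C) (p : mor X Y) (i : mor Y X), p \oc i = idm Y /\ i \oc p = e.

Definition indecomposable (k : fieldType) (C : addcat k) (X : C) :=
  idm X <> 0 /\
  forall A B : C, isomorphic X (osum A B) -> idm A = 0 \/ idm B = 0.

(* [add T] *)
Definition in_add (k : fieldType) (C : addcat k) (T X : C) :=
  exists (Y : C) (m : nat), isomorphic (osum X Y) (iter m (osum T) ozero).

(* The map (a b ; c e) : X + Y -> X' + Y' *)
Definition mor_mx (k : fieldType) (C : addcat k) (X Y X' Y' : C)
    (a : mor X X') (b : mor Y X') (c : mor X Y') (e : mor Y Y') :
    mor (osum X Y) (osum X' Y') :=
  oin1 X' Y' \oc (a \oc opr1 X Y + b \oc opr2 X Y)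
  + oin2 X' Y' \oc (c \oc opr1 X Y + e \oc opr2 X Y).

(** * Functors *)

Record linfunctor (k : fieldType) (C C' : lincat k) := LinFunctor {
  fob :> C -> C';
  fmor : forall X Y, mor X Y -> mor (fob X) (fob Y);
  fmor_linear : forall X Y, linear (@fmor X Y);
  fmor1 : forall X, fmor (idm X) = idm (fob X);
  fmorM : forall X Y Z (g : mor Y Z) (f : mor X Y),
    fmor (g \oc f) = fmor g \oc fmor f }.

Arguments fmor {k C C'} F {X Y} f : rename.

(* Isomorphism of categories: the composites with [aut_inv] are equal to the
   identity functors on objects and, modulo the identification [eqmor], on
   morphisms. *)
Record automorphism (k : fieldType) (C : lincat k) := Automorphism {
  aut_fun :> linfunctor C C;
  aut_inv : linfunctor C C;
  autK : forall X, aut_inv (aut_fun X) = X;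
  autVK : forall X, aut_fun (aut_inv X) = X;
  autK_mor : forall X Y (f : mor X Y),
    eqmor (autK Y) \oc fmor aut_inv (fmor aut_fun f) = f \oc eqmor (autK X);
  autVK_mor : forall X Y (f : mor X Y),
    eqmor (autVK Y) \oc fmor aut_fun (fmor aut_inv f) = f \oc eqmor (autVK X) }.

Definition autoequivalence (k : fieldType) (C : lincat k)
    (F : linfunctor C C) :=
  exists G : linfunctor C C,
    (exists eta : forall X, mor X (G (F X)),
       (forall X, is_iso (eta X)) /\
       (forall X Y (f : mor X Y),
          eta Y \oc f = fmor G (fmor F f) \oc eta X)) /\
    (exists eps : forall X, mor (F (G X)) X,
       (forall X, is_iso (eps X)) /\
       (forall X Y (f : mor X Y),
          eps Y \oc fmor F (fmor G f) = f \oc eps X)).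

(* [serre_natural]: both sides are covariant in X and contravariant in Y. *)
Record serre_functor (k : fieldType) (C : lincat k) := SerreFunctor {
  serre_fun :> linfunctor C C;
  serre_equiv : autoequivalence serre_fun;
  serre_iso : forall X Y : C,
    'Hom(mor X Y, k^o) -> mor Y (serre_fun X);
  serre_linear : forall X Y, linear (@serre_iso X Y);
  serre_bij : forall X Y, bijective (@serre_iso X Y);
  serre_natural : forall (X X' Y Y' : C) (a : mor X X') (b : mor Y Y')
      (phi : 'Hom(mor X Y', k^o)),
    serre_iso (linfun (fun u : mor X' Y => phi (b \oc u \oc a)))
    = fmor serre_fun a \oc serre_iso phi \oc b }.

(** * (d+2)-angulated categories *)

(* A [chain m X Z] is a sequence of m+1 composable morphisms
   X -> Y_1 -> ... -> Y_m -> Z with m intermediate objects. *)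
Fixpoint chain (k : fieldType) (C : lincat k) (m : nat) (X Z : C) : Type :=
  if m is m'.+1 then {Y : C & (mor X Y * chain m' Y Z)%type} else mor X Z.

Definition ccons (k : fieldType) (C : lincat k) (m : nat) (X Y Z : C)
    (f : mor X Y) (c : chain m Y Z) : chain m.+1 X Z :=
  existT _ Y (f, c).

Fixpoint crcons (k : fieldType) (C : lincat k) (m : nat) (Z W : C)
    (g : mor Z W) : forall X : C, chain m X Z -> chain m.+1 X W :=
  match m return forall X : C, chain m X Z -> chain m.+1 X W with
  | 0 => fun X f => ccons (m := 0) f g
  | m'.+1 => fun X c => ccons (projT2 c).1 (crcons g (projT2 c).2)
  end.

(* Replaces the last morphism f of a chain by g f. *)
Fixpoint cpost (k : fieldType) (C : lincat k) (m : nat) (Z W : C)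
    (g : mor Z W) : forall X : C, chain m X Z -> chain m X W :=
  match m return forall X : C, chain m X Z -> chain m X W with
  | 0 => fun X f => g \oc f
  | m'.+1 => fun X c => ccons (projT2 c).1 (cpost g (projT2 c).2)
  end.

Fixpoint zero_chain (k : fieldType) (C : addcat k) (m : nat) (X Z : C) :
    chain m X Z :=
  match m return chain m X Z with
  | 0 => 0
  | m'.+1 => ccons (0 : mor X ozero) (zero_chain m' ozero Z)
  end.

Fixpoint chain_sum (k : fieldType) (C : addcat k) (m : nat) (Z W : C) :
    forall X Y : C,
      chain m X Z -> chain m Y W -> chain m (osum X Y) (osum Z W) :=
  match m return forall X Y : C,
      chain m X Z -> chain m Y W -> chain m (osum X Y) (osum Z W) with
  | 0 => fun X Y f g => mor_mx f 0 0 g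
  | m'.+1 => fun X Y c e =>
      ccons (mor_mx (projT2 c).1 0 0 (projT2 e).1)
            (chain_sum (projT2 c).2 (projT2 e).2)
  end.

Fixpoint all_inter (k : fieldType) (C : lincat k) (P : C -> Prop) (m : nat)
    (Z : C) : forall X : C, chain m X Z -> Prop :=
  match m return forall X : C, chain m X Z -> Prop with
  | 0 => fun X c => True
  | m'.+1 => fun X c => P (projT1 c) /\ all_inter P (projT2 c).2
  end.

(* The vertical components, at the intermediate objects, of a morphism of
   chains with prescribed components f and g at the two ends; all squares
   are required to commute. *)
Fixpoint chain_mor (k : fieldType) (C : lincat k) (m : nat) (Z W : C)
    (g : mor Z W) :
    forall X Y : C, mor X Y -> chain m X Z -> chain m Y W -> Type :=
  match m return
      forall X Y : C, mor X Y -> chain m X Z -> chain m Y W -> Type with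
  | 0 => fun X Y f c e => e \oc f = g \oc c
  | m'.+1 => fun X Y f c e =>
      {p : mor (projT1 c) (projT1 e) &
        (((projT2 e).1 \oc f = p \oc (projT2 c).1) *
         chain_mor g p (projT2 c).2 (projT2 e).2)%type}
  end.

Fixpoint chain_mor_iso (k : fieldType) (C : lincat k) (m : nat) (Z W : C)
    (g : mor Z W) : forall (X Y : C) (f : mor X Y)
      (c : chain m X Z) (e : chain m Y W), chain_mor g f c e -> Prop :=
  match m return forall (X Y : C) (f : mor X Y)
      (c : chain m X Z) (e : chain m Y W), chain_mor g f c e -> Prop with
  | 0 => fun X Y f c e h => True
  | m'.+1 => fun X Y f c e h =>
      is_iso (projT1 h) /\ chain_mor_iso (projT2 h).2
  end.

(* The part X + Y0 -> ... -> Z + Y_last -> Z' + W of the mapping cone, for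
     X -> ... -> Z          (c)
     |           |
     f           g          (h)
     v           v
     Y -> ... -> W          (e)
   and b : Y0 -> Y.  Its maps are (- alpha 0 ; phi beta), where alpha is a
   map of c, phi the vertical map at the source of alpha and beta the map of
   [ccons b e] one place before the map under alpha.  The last one is
   (- a 0 ; g beta_last), where a : Z -> Z'. *)
Fixpoint cone_chain (k : fieldType) (C : addcat k) (m : nat) (Z W Z' : C)
    (a : mor Z Z') (g : mor Z W) :
    forall (Y0 X Y : C) (b : mor Y0 Y) (f : mor X Y)
      (c : chain m X Z) (e : chain m Y W), chain_mor g f c e ->
      chain m.+1 (osum X Y0) (osum Z' W) :=
  match m return forall (Y0 X Y : C) (b : mor Y0 Y) (f : mor X Y)
      (c : chain m X Z) (e : chain m Y W), chain_mor g f c e ->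
      chain m.+1 (osum X Y0) (osum Z' W) with
  | 0 => fun Y0 X Y b f c e h =>
      ccons (m := 0) (mor_mx (- (c : mor X Z)) 0 f b) (mor_mx (- a) 0 g e)
  | m'.+1 => fun Y0 X Y b f c e h =>
      ccons (mor_mx (- (projT2 c).1) 0 f b)
            (cone_chain a (projT2 e).1 (projT2 h).2)
  end.

Section Angulated.
Variables (k : fieldType) (C : addcat k) (d : nat) (Sg : automorphism C).

(* An n-Sigma-sequence X_1 -> X_2 -> ... -> X_n -> Sigma X_1 with n = d + 2. *)
Record sseq := SSeq {
  ss1 : C;
  ss2 : C;
  ssmor : mor ss1 ss2;
  sstail : chain d ss2 (Sg ss1) }.

Definition rotation (x : sseq) : sseq :=
  let c := crcons ((-1) ^+ (d + 2) *: fmor Sg (ssmor x)) (sstail x) in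
  SSeq (projT2 c).1 (projT2 c).2.

(* The canonical isomorphism Sigma X + Sigma Y -> Sigma (X + Y) *)
Definition susp_sum (X Y : C) : mor (osum (Sg X) (Sg Y)) (Sg (osum X Y)) :=
  fmor Sg (oin1 X Y) \oc opr1 (Sg X) (Sg Y)
  + fmor Sg (oin2 X Y) \oc opr2 (Sg X) (Sg Y).

Definition sseq_sum (x y : sseq) : sseq :=
  SSeq (mor_mx (ssmor x) 0 0 (ssmor y))
       (cpost (susp_sum (ss1 x) (ss1 y)) (chain_sum (sstail x) (sstail y))).

Definition trivial_sseq (X : C) : sseq := SSeq (idm X) (zero_chain d X (Sg X)).

Definition sseq_iso (x y : sseq) : Prop :=
  exists (f1 : mor (ss1 x) (ss1 y)) (f2 : mor (ss2 x) (ss2 y))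
         (h : chain_mor (fmor Sg f1) f2 (sstail x) (sstail y)),
    [/\ is_iso f1, is_iso f2, f2 \oc ssmor x = ssmor y \oc f1
      & chain_mor_iso h].

(* The cone X_2 + Y_1 -> X_3 + Y_2 -> ... -> Sigma X_1 + Y_n ->
   Sigma (X_2 + Y_1). *)
Definition cone (x y : sseq)
    (f1 : mor (ss1 x) (ss1 y)) (f2 : mor (ss2 x) (ss2 y))
    (h : chain_mor (fmor Sg f1) f2 (sstail x) (sstail y)) : sseq :=
  let c := cone_chain (fmor Sg (ssmor x)) (ssmor y) h in
  SSeq (projT2 c).1 (cpost (susp_sum (ss2 x) (ss1 y)) (projT2 c).2).

End Angulated.

Record angulated (k : fieldType) (d : nat) := Angulated {
  ang_cat :> addcat k;
  susp : automorphism ang_cat;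
  angle : sseq d susp -> Prop;
  angle_iso : forall x y, sseq_iso x y -> angle x -> angle y;
  angle_sum : forall x y, angle x -> angle y -> angle (sseq_sum x y);
  angle_summand : forall x y, angle (sseq_sum x y) -> angle x /\ angle y;
  angle_trivial : forall X : ang_cat, angle (trivial_sseq d susp X);
  angle_ex : forall (X Y : ang_cat) (f : mor X Y),
    exists c : chain d Y (susp X), angle (SSeq f c);
  angle_rot : forall x, angle x <-> angle (rotation x);
  angle_mor : forall (x y : sseq d susp)
      (f1 : mor (ss1 x) (ss1 y)) (f2 : mor (ss2 x) (ss2 y)),
    angle x -> angle y -> f2 \oc ssmor x = ssmor y \oc f1 ->
    inhabited (chain_mor (fmor susp f1) f2 (sstail x) (sstail y));
  angle_cone : forall (x y : sseq d susp)
      (f1 : mor (ss1 x) (ss1 y)) (f2 : mor (ss2 x) (ss2 y)),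
    angle x -> angle y -> f2 \oc ssmor x = ssmor y \oc f1 ->
    exists h : chain_mor (fmor susp f1) f2 (sstail x) (sstail y),
      angle (cone h) }.

Arguments susp {k d} a : rename.
Arguments angle {k d a} x : rename.

(** * Finite dimensional right modules over the endomorphism algebra of T *)

Section Modules.
Variables (k : fieldType) (C : lincat k) (T : C).

(* The algebra is [mor T T], with product [comp]; it is the zero algebra when
   T is a zero object. *)
Record rmod := RMod {
  rcar :> vectType k;
  ract : rcar -> mor T T -> rcar;
  ract_linearl : forall a, linear (fun m => ract m a);
  ract_linearr : forall m, linear (ract m);
  ract1 : forall m, ract m (idm T) = m;
  ractM : forall m a b, ract m (a \oc b) = ract (ract m a) b }.

Definition mod_hom (M N : rmod) (f : 'Hom(M, N)) :=
  forall m a, f (ract m a) = ract (f m) a.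

Definition mod_iso (M N : rmod) :=
  exists f : 'Hom(M, N), [/\ mod_hom f, lker f = 0%VS & limg f = fullv].

(* The functor [mor T -] *)
Definition homT (X : C) : rmod :=
  @RMod (mor T X) (fun u a => u \oc a)
    (fun a => comp_linearl a) (fun u => comp_linearr u)
    (fun u => compm1 u) (fun u a b => compA u a b).

Definition homT_mor (X Y : C) (f : mor X Y) : 'Hom(homT X, homT Y) :=
  linfun (fun u : mor T X => f \oc u).

Definition homT_full :=
  forall (X Y : C) (p : 'Hom(homT X, homT Y)),
    mod_hom p -> exists f : mor X Y, p = homT_mor f.

Definition ess_image (M : rmod) := exists X : C, mod_iso M (homT X).

Definition projective (P : rmod) :=
  forall (M N : rmod) (s : 'Hom(M, N)) (f : 'Hom(P, N)),
    mod_hom s -> limg s = fullv -> mod_hom f ->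
    exists g : 'Hom(P, M), mod_hom g /\ f = (s \o g)%VF.

Definition injective_mod (I : rmod) :=
  forall (M N : rmod) (i : 'Hom(M, N)) (f : 'Hom(M, I)),
    mod_hom i -> lker i = 0%VS -> mod_hom f ->
    exists g : 'Hom(N, I), mod_hom g /\ f = (g \o i)%VF.

Record proj_resolution (M : rmod) := ProjResolution {
  pr_mod :> nat -> rmod;
  pr_d : forall i, 'Hom(pr_mod i.+1, pr_mod i);
  pr_aug : 'Hom(pr_mod 0, M);
  pr_proj : forall i, projective (pr_mod i);
  pr_d_hom : forall i, mod_hom (pr_d i);
  pr_aug_hom : mod_hom pr_aug;
  pr_exact : forall i, limg (pr_d i.+1) = lker (pr_d i);
  pr_exact0 : limg (pr_d 0) = lker pr_aug;
  pr_aug_surj : limg pr_aug = fullv }.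

(* Ext^j(M, N) = 0, i.e. H^j(Hom(P, N)) = 0 for projective resolutions P of
   M.  These exist because the algebra is finite dimensional, and the
   condition does not depend on the choice of P. *)
Definition ext_zero (j : nat) (M N : rmod) : Prop :=
  forall P : proj_resolution M,
    match j with
    | 0 => forall f : 'Hom(P 0, N), mod_hom f ->
             (f \o pr_d P 0)%VF = 0 -> f = 0
    | i.+1 => forall f : 'Hom(P i.+1, N), mod_hom f ->
             (f \o pr_d P i.+1)%VF = 0 ->
             exists g : 'Hom(P i, N), mod_hom g /\ f = (g \o pr_d P i)%VF
    end.

Definition functorially_finite (X : rmod -> Prop) :=
  forall M : rmod,
    (exists (A : rmod) (f : 'Hom(A, M)), [/\ X A, mod_hom f
       & forall (B : rmod) (g : 'Hom(B, M)), X B -> mod_hom g ->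
           exists h : 'Hom(B, A), mod_hom h /\ g = (f \o h)%VF]) /\
    (exists (A : rmod) (f : 'Hom(M, A)), [/\ X A, mod_hom f
       & forall (B : rmod) (g : 'Hom(M, B)), X B -> mod_hom g ->
           exists h : 'Hom(A, B), mod_hom h /\ g = (h \o f)%VF]).

Definition cluster_tilting (d : nat) (X : rmod -> Prop) :=
  [/\ functorially_finite X,
      forall M, X M <->
        (forall i A, (0 < i < d)%N -> X A -> ext_zero i M A)
    & forall M, X M <->
        (forall i A, (0 < i < d)%N -> X A -> ext_zero i A M)].

(* f is an essential epimorphism onto its image. *)
Definition essential_onto (M N : rmod) (f : 'Hom(M, N)) :=
  forall (L : rmod) (h : 'Hom(L, M)), mod_hom h ->
    limg (f \o h)%VF = limg f -> limg h = fullv.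

(* The inclusion of the image of f into N is an essential monomorphism. *)
Definition essential_in (M N : rmod) (f : 'Hom(M, N)) :=
  forall (L : rmod) (h : 'Hom(N, L)), mod_hom h ->
    lker (h \o f)%VF = lker f -> lker h = 0%VS.

(* P1 -p-> P0 -q-> M -> 0 is exact, and q : P0 -> M and P1 -> im p are
   projective covers. *)
Definition min_proj_presentation (P1 P0 M : rmod)
    (p : 'Hom(P1, P0)) (q : 'Hom(P0, M)) :=
  [/\ projective P1 /\ projective P0, mod_hom p /\ mod_hom q,
      limg p = lker q, limg q = fullv
    & essential_onto p /\ essential_onto q].

(* 0 -> N -j-> I1 -p-> I0 is exact, and j : N -> I1 and im p -> I0 are
   injective envelopes. *)
Definition min_inj_copresentation (N I1 I0 : rmod)
    (j : 'Hom(N, I1)) (p : 'Hom(I1, I0)) :=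
  [/\ injective_mod I1 /\ injective_mod I0, mod_hom j /\ mod_hom p,
      lker j = 0%VS, limg j = lker p
    & essential_in j /\ essential_in p].

End Modules.

(** * The conditions on T *)

Record arrow (k : fieldType) (C : lincat k) := Arrow {
  asrc : C;
  atgt : C;
  amor : mor asrc atgt }.

(* The i-th morphism of a chain, counted from 0; the last one if i > m. *)
Fixpoint chain_arrow (k : fieldType) (C : lincat k) (m : nat) (Z : C) :
    forall X : C, chain m X Z -> nat -> arrow C :=
  match m return forall X : C, chain m X Z -> nat -> arrow C with
  | 0 => fun X f _ => Arrow f
  | m'.+1 => fun X c i =>
      if i is i'.+1 then chain_arrow (projT2 c).2 i' else Arrow (projT2 c).1
  end.

(* The morphism h_i of a chain with morphisms h_{d+1}, ..., h_2, h_1, in this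
   order *)
Definition harrow (k : fieldType) (C : lincat k) (d : nat) (X Z : C)
    (c : chain d X Z) (i : nat) : arrow C := chain_arrow c (d + 1 - i).

Section Conditions.
Variables (k : fieldType) (d : nat) (C : angulated k d).
Variables (S : serre_functor C) (T : C).

(* [mor T -] vanishes on a. *)
Definition killed (a : arrow C) : Prop := homT_mor T (amor a) = 0.

Definition some_killed (X Z : C) (c : chain d X Z) : Prop :=
  exists i, (1 <= i <= d + 1)%N /\ killed (harrow c i).

(* Condition (a), with R as the requirement on h_{d+1}, ..., h_1 *)
Definition cond_a_with (R : forall X Z : C, chain d X Z -> Prop) : Prop :=
  forall M : rmod T,
    (forall j D, (0 < j < d)%N -> ess_image D -> ext_zero j D M) ->
  forall (T1 T0 : C) (f : mor T1 T0) (q : 'Hom(homT T T0, M)),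
    in_add T T1 -> in_add T T0 ->
    min_proj_presentation (homT_mor T f) q ->
  exists c : chain d T0 (susp C T1), angle (SSeq f c) /\ R _ _ c.

(* Condition (a'), with R as the requirement on h_{d+1}, ..., h_1.  The angle
   starts at Sigma^{-d} S T0 and its last morphism is g, composed with the
   identification of S T0 with Sigma^d Sigma^{-d} S T0. *)
Definition cond_a'_with (R : forall X Z : C, chain d X Z -> Prop) : Prop :=
  forall N : rmod T,
    (forall j D, (0 < j < d)%N -> ess_image D -> ext_zero j N D) ->
  forall (T1 T0 : C) (g : mor (S T1) (S T0)) (i : 'Hom(N, homT T (S T1))),
    in_add (S T) (S T1) -> in_add (S T) (S T0) ->
    min_inj_copresentation i (homT_mor T g) ->
  exists c : chain d (aut_inv (susp C) (S T0)) (S T1),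
    let c' := crcons (eqmor (esym (autVK (susp C) (S T0))) \oc g) c in
    angle (SSeq (projT2 c').1 (projT2 c').2) /\ R _ _ c.

Definition cond_a := cond_a_with some_killed.
Definition cond_a' := cond_a'_with some_killed.
Definition strong_a := cond_a_with (fun X Z c => killed (harrow c d)).
Definition strong_a' := cond_a'_with (fun X Z c => killed (harrow c 2)).

(* c is T_d -> T_{d-1} -> ... -> T_0 -> X. *)
Definition cond_b : Prop :=
  forall X : C, indecomposable X -> (exists u : mor T X, u <> 0) ->
  exists (Td : C) (c : chain d Td X) (h : mor X (susp C Td)),
    let c' := crcons h c in
    [/\ in_add T Td, all_inter (in_add T) c,
        angle (SSeq (projT2 c').1 (projT2 c').2)
      & homT_mor T h = 0].

End Conditions.

(* Main.v *)
(* Put F = mor T - and write Hom for homomorphisms of modules.  Then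
   Hom(F A, F X) = mor A X for A in add T and, by Serre duality,
   Hom(F X, F Z) = mor X Z for Z in add (S T), so that presentations and
   copresentations of modules come from morphisms, which complete to angles.

   (ii) => (i): by (b) the module F X has a projective resolution by objects of
   add T which remains exact under mor - Y in degrees 1, ..., d - 1.  Hence F is
   full and Ext^j(F X, F Y) = 0 for 0 < j < d.  If Ext^j(D, M) = 0 in this range,
   the angle of (a) gives an exact sequence 0 -> M -> F X_d -> ... -> F X_i -> 0,
   and the vanishing makes M a direct summand of F X_d, so M lies in D; (a') is
   dual.  D is functorially finite for every T: complete any presentation or
   copresentation to an angle.

   (i) => (strong a): M = F X, and completing f to an angle, fullness gives maps
   X -> X_d -> X whose Fitting idempotent e on X_d has image M under F and fixes
   h_{d+1}.  Thus 1 - e factors through h_d, so that its image splits off as a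
   trivial summand of the angle.

   (i) => (b): let T_d -> ... -> T_0 -> X induce a projective resolution of F X.
   The vanishing of Ext makes it a sequence of weak cokernels, hence homotopy
   equivalent to the angle U completing T_d -> T_{d-1} as long as the last
   morphism of U is ignored.  The homotopy at the right end corrects the
   component at T_d so that the composite U -> (T_i) -> U becomes an endomorphism
   of the angle, and its Fitting idempotents cut out an angle with terms in
   add T whose last term is a summand of X. *)

From HB Require Import structures.
From mathcomp Require Import all_boot all_algebra.
From Stdlib Require Import Classical_Prop ClassicalEpsilon.
Require Import Defs.

Set Implicit Arguments.
Unset Strict Implicit.
Unset Printing Implicit Defensive.

Import GRing.Theory.
Local Open Scope ring_scope.

(** * Linear categories *)

Section LinearCategory.
Variables (k : fieldType) (C : lincat k).
Implicit Types X Y Z W : C.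

(** Maps between angles are unique only in a weak sense, so composites that ought to be identities
    are mere endomorphisms. Hom-finiteness repairs this: Fitting idempotents are natural, so those
    taken term by term on an endomorphism of a sequence commute with its maps, and splitting them
    splits the sequence. Since summands of angles are angles, this is how new angles arise from
    completed ones. Ext is accessed through the functorial resolution by free modules M (x) Gamma.
    It is exact in M and turns the syzygy [omega] into a functor, so degrees are shifted by applying
    [omega] to whole exact sequences. An angle is also read as an endless family indexed by [nat]:
    its i-fold rotations have first morphisms that are exact at every place, and one morphism killed
    by mor T - cuts a finite exact sequence out of the family. From the section on angles on, the
    dimension is written d.+1. *)

Definition precomp X Y Z (f : mor X Y) (g : mor Y Z) := g \oc f.

HB.instance Definition _ X Y Z (g : mor Y Z) :=
  GRing.isLinear.Build k (mor X Y) (mor X Z) *:%R (comp g) (comp_linearr g).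
HB.instance Definition _ X Y Z (f : mor X Y) :=
  GRing.isLinear.Build k (mor Y Z) (mor X Z) *:%R (precomp f)
    (comp_linearl f).

Lemma compDr X Y Z (g : mor Y Z) (f f' : mor X Y) :
  g \oc (f + f') = g \oc f + g \oc f'.
Proof. exact: (linearD (comp g)). Qed.
Lemma compDl X Y Z (f : mor X Y) (g g' : mor Y Z) :
  (g + g') \oc f = g \oc f + g' \oc f.
Proof. exact: (linearD (precomp f)). Qed.
Lemma compBr X Y Z (g : mor Y Z) (f f' : mor X Y) :
  g \oc (f - f') = g \oc f - g \oc f'.
Proof. exact: (linearB (comp g)). Qed.
Lemma compBl X Y Z (f : mor X Y) (g g' : mor Y Z) :
  (g - g') \oc f = g \oc f - g' \oc f.
Proof. exact: (linearB (precomp f)). Qed.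
Lemma compm0 X Y Z (g : mor Y Z) : g \oc (0 : mor X Y) = 0.
Proof. exact: (linear0 (comp g)). Qed.
Lemma comp0m X Y Z (f : mor X Y) : (0 : mor Y Z) \oc f = 0.
Proof. exact: (linear0 (precomp f)). Qed.
Lemma compZr X Y Z (g : mor Y Z) a (f : mor X Y) :
  g \oc (a *: f) = a *: (g \oc f).
Proof. exact: (linearZ_LR (comp g)). Qed.
Lemma compZl X Y Z (f : mor X Y) a (g : mor Y Z) :
  (a *: g) \oc f = a *: (g \oc f).
Proof. exact: (linearZ_LR (precomp f)). Qed.

Lemma idem_compl X (e : mor X X) : e \oc e = e ->
  (idm X - e) \oc (idm X - e) = idm X - e.
Proof.
by move=> ee; rewrite compBr compm1 compBl comp1m ee subrr subr0.
Qed.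

Lemma is_iso_id X : is_iso (idm X).
Proof. by exists (idm X); rewrite comp1m. Qed.

Lemma is_iso_eqmor X Y (e : X = Y) : is_iso (eqmor e).
Proof. case: _ / e; exact: is_iso_id. Qed.

Lemma eqmorK X Y (e : X = Y) : eqmor (esym e) \oc eqmor e = idm X.
Proof. by case: _ / e; rewrite /= comp1m. Qed.
Lemma eqmorVK X Y (e : X = Y) : eqmor e \oc eqmor (esym e) = idm Y.
Proof. by case: _ / e; rewrite /= comp1m. Qed.

Lemma is_iso_zero X Y : idm X = 0 -> idm Y = 0 -> is_iso (0 : mor X Y).
Proof. by move=> X0 Y0; exists 0; rewrite !comp0m X0 Y0. Qed.

Lemma mor_from0 X Y (f : mor X Y) : idm X = 0 -> f = 0.
Proof. by move=> X0; rewrite -(compm1 f) X0 compm0. Qed.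
Lemma mor_to0 X Y (f : mor X Y) : idm Y = 0 -> f = 0.
Proof. by move=> Y0; rewrite -(comp1m f) Y0 comp0m. Qed.

Lemma iso_monic X Y Z (f : mor Y Z) (u v : mor X Y) :
  is_iso f -> f \oc u = f \oc v -> u = v.
Proof.
by move=> [g [gf _]] /(congr1 (comp g)); rewrite !compA gf !comp1m.
Qed.

Definition cpow X (phi : mor X X) n := iter n (comp phi) (idm X).

Lemma cpowS X (phi : mor X X) n : cpow phi n.+1 = phi \oc cpow phi n.
Proof. by []. Qed.

Lemma cpowD X (phi : mor X X) m n :
  cpow phi (m + n) = cpow phi m \oc cpow phi n.
Proof. by elim: m => [|m IH]; rewrite ?comp1m // addSn !cpowS IH compA. Qed.

Lemma cpow_nat X Y (phi : mor X X) (psi : mor Y Y) (h : mor X Y) n :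
  h \oc phi = psi \oc h -> h \oc cpow phi n = cpow psi n \oc h.
Proof.
move=> hE; elim: n => [|n IH]; first by rewrite compm1 comp1m.
by rewrite !cpowS compA hE -compA IH compA.
Qed.

Lemma cpow_fix X Y (phi : mor Y Y) (h : mor X Y) n :
  phi \oc h = h -> cpow phi n \oc h = h.
Proof.
by move=> hE; elim: n => [|n IH]; rewrite ?comp1m // cpowS -compA IH.
Qed.

Lemma cpow_fixr X Y (phi : mor X X) (h : mor X Y) n :
  h \oc phi = h -> h \oc cpow phi n = h.
Proof.
by move=> hE; elim: n => [|n IH]; rewrite ?compm1 // cpowS compA hE.
Qed.

(** The images of the powers of L decrease; as soon as two consecutive dimensions agree, the
    sequence of images is constant. *)
Lemma iter_img (V : vectType k) (L : {linear V -> V}) :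
  exists n, forall N v, (n <= N)%N -> exists w, iter n L v = iter N L w.
Proof.
pose U n : {vspace V} := iter n (fun U => (linfun L @: U)%VS) fullv.
have UP n v : iter n L v \in U n.
  elim: n => [|n IH]; first exact: memvf.
  by rewrite /U !iterS -(lfunE L) memv_img.
have PU n v : v \in U n -> exists w, v = iter n L w.
  elim: n v => [|n IH] v; first by exists v.
  by case/memv_imgP=> x /IH[w ->] ->; exists w; rewrite lfunE.
have US n : (U n.+1 <= U n)%VS.
  elim: n => [|n IH]; first exact: subvf.
  by rewrite /U iterS limgS.
have [n nP] : exists n, \dim (U n) = \dim (U n.+1).
  have H m n : (\dim (U n) <= m)%N -> exists n, \dim (U n) = \dim (U n.+1).
    elim: m n => [|m IH] n le.
      by exists n; have := dimvS (US n); move: le; rewrite leqn0 => /eqP ->;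
         rewrite leqn0 => /eqP ->.
    have := dimvS (US n); rewrite leq_eqVlt => /orP[/eqP e|lt];
      first by exists n.
    by apply: (IH n.+1); rewrite -ltnS (leq_trans lt).
  exact: (H _ 0%N (leqnn _)).
have UE N : (n <= N)%N -> U N = U n.
  move=> /subnKC <-; elim: (N - n)%N => [|m IH]; first by rewrite addn0.
  have e : U n.+1 = U n by apply/eqP; rewrite eqEdim US nP leqnn.
  by rewrite addnS -[RHS]e; congr (_ @: _)%VS; exact: IH.
exists n => N v le; apply: PU; rewrite (UE _ le); exact: UP.
Qed.

Lemma iter_comp X (phi a : mor X X) n : iter n (comp phi) a = cpow phi n \oc a.
Proof. by elim: n => [|n IH]; rewrite ?comp1m // iterS IH compA. Qed.
Lemma iter_precomp X (phi a : mor X X) n :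
  iter n (precomp phi) a = a \oc cpow phi n.
Proof.
elim: n => [|n IH]; rewrite ?compm1 // iterS IH /precomp -compA.
by congr (_ \oc _); rewrite -[RHS]/(cpow phi (1 + n)) addnC cpowD /cpow
  /= compm1.
Qed.

(* e is the projection onto the summand of X on which phi is invertible, along
   the summand on which phi is nilpotent. *)
Definition fitting X (phi e : mor X X) := exists n, forall N, (n <= N)%N ->
  [/\ cpow phi N \oc e = cpow phi N, e \oc cpow phi N = cpow phi N,
      exists psi, e = cpow phi N \oc psi & exists psi, e = psi \oc cpow phi N].

(** Left and right multiplication by phi on the finite dimensional space [mor X X] have stable
    images, so phi^n can be written both as phi^2n psi and as psi' phi^2n. *)
Lemma fitting_ex X (phi : mor X X) : exists e, fitting phi e.
Proof.
have [m mP] := iter_img (V := mor X X) (comp phi).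
have [m' mP'] := iter_img (V := mor X X) (precomp phi).
pose n := maxn m m'.
have R N : (n <= N)%N -> exists psi, cpow phi n = cpow phi N \oc psi.
  rewrite geq_max => /andP[le _].
  have [w] := mP N (idm X) le; rewrite !iter_comp compm1 => e.
  have [w' e'] : exists w', cpow phi n = cpow phi (N + (n - m)) \oc w'.
    have le2 : (m <= N + (n - m))%N by rewrite (leq_trans le) ?leq_addr.
    have [w1] := mP _ (cpow phi (n - m)) le2.
    by rewrite !iter_comp -cpowD subnKC ?leq_maxl // => ->; exists w1.
  by exists (cpow phi (n - m) \oc w'); rewrite e' compA -cpowD.
have L N : (n <= N)%N -> exists psi, cpow phi n = psi \oc cpow phi N.
  rewrite geq_max => /andP[_ le].
  have le2 : (m' <= N + (n - m'))%N by rewrite (leq_trans le) ?leq_addr.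
  have [w1] := mP' _ (cpow phi (n - m')) le2.
  rewrite !iter_precomp -cpowD subnK ?leq_maxr // => ->.
  by exists (w1 \oc cpow phi (n - m')); rewrite -compA -cpowD addnC.
have [psi e1] := R (n + n)%N (leq_addr _ _).
have [psi' e2] := L (n + n)%N (leq_addr _ _).
(* Both sides equal psi' phi^2n psi. Being a right and a left multiple of phi^n, the element acts as
   a unit on high powers from both sides. *)
have eE : cpow phi n \oc psi = psi' \oc cpow phi n.
  transitivity (psi' \oc cpow phi (n + n) \oc psi); first by rewrite -e2.
  by rewrite -compA -e1.
exists (cpow phi n \oc psi), n => N le; split.
- by rewrite -[in LHS](subnK le) cpowD -compA (compA (cpow phi n)) -cpowD -e1
    -cpowD subnK.
- by rewrite eE -[in LHS](subnKC le) cpowD compA -(compA psi') -cpowD -e2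
    -cpowD subnKC.
- by have [w e] := R N le; exists (w \oc psi); rewrite e compA.
- by have [w e] := L N le; exists (psi' \oc w); rewrite eE e compA.
Qed.

Lemma fitting_idem X (phi e : mor X X) : fitting phi e -> e \oc e = e.
Proof.
by move=> [n /(_ n (leqnn n)) [_ h [psi e1] _]]; rewrite {2}e1 compA h -e1.
Qed.

(** Since e is a multiple of phi^N on either side and acts as the identity on phi^N, it inherits
    every intertwining relation of phi. Idempotents chosen independently on the rungs of a commuting
    ladder are thus compatible. *)
Lemma fitting_nat X Y (phi e : mor X X) (phi' e' : mor Y Y) (h : mor X Y) :
  fitting phi e -> fitting phi' e' -> h \oc phi = phi' \oc h ->
  h \oc e = e' \oc h.
Proof.
move=> [n nP] [n' nP'] hE.
have [P1 P2 [p e1] [p' e2]] := nP _ (leq_maxl n n').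
have [P1' P2' [q e1'] [q' e2']] := nP' _ (leq_maxr n n').
have H := cpow_nat (maxn n n') hE.
transitivity (e' \oc h \oc e).
  by rewrite {2}e1 -compA (compA h) H compA (compA e') P2' -H {1}e1 -!compA.
by rewrite {1}e2' -(compA q') -H -(compA q') -(compA h) P1 H (compA q') -e2'.
Qed.

Lemma fitting_fix X Y (phi e : mor Y Y) (h : mor X Y) :
  fitting phi e -> phi \oc h = h -> e \oc h = h.
Proof.
move=> [n /(_ n (leqnn n)) [_ P _ _]] hE.
by rewrite -{1}(cpow_fix n hE) compA P (cpow_fix n hE).
Qed.

Lemma fitting_fixr X Y (phi e : mor X X) (h : mor X Y) :
  fitting phi e -> h \oc phi = h -> h \oc e = h.
Proof.
move=> [n /(_ n (leqnn n)) [P _ _ _]] hE.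
by rewrite -{1}(cpow_fixr n hE) -compA P (cpow_fixr n hE).
Qed.

(** The exponent n.+1 provides a factor [s \oc r] that can be peeled off at either end. *)
Lemma fitting_factor X Y (s : mor Y X) (r : mor X Y) e :
  fitting (s \oc r) e ->
  (exists w, e = s \oc w) /\ (exists w, e = w \oc r).
Proof.
move=> [n /(_ n.+1 (leqnSn n)) [_ _ [p e1] [p' e2]]]; split.
  by exists (r \oc (cpow (s \oc r) n \oc p)); rewrite e1 cpowS -!compA.
exists (p' \oc cpow (s \oc r) n \oc s).
by rewrite e2 -addn1 cpowD /cpow /= compm1 -!compA.
Qed.

Definition retract X Y := exists (i : mor X Y) (p : mor Y X), p \oc i = idm X.

Lemma retract_trans X Y Z : retract X Y -> retract Y Z -> retract X Z.
Proof.
move=> [i [p pi]] [j [q qj]]; exists (j \oc i), (p \oc q).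
by rewrite -compA (compA q) qj comp1m.
Qed.

Lemma isomorphic_retract X Y : isomorphic X Y -> retract X Y.
Proof. by move=> [f [g [gf fg]]]; exists f, g. Qed.

Lemma isomorphic_sym X Y : isomorphic X Y -> isomorphic Y X.
Proof. by move=> [f [g [gf fg]]]; exists g, f. Qed.

End LinearCategory.

(** * Linear functors and automorphisms *)

Section Functor.
Variables (k : fieldType) (C C' : lincat k) (F : linfunctor C C').

HB.instance Definition _ X Y :=
  GRing.isLinear.Build k (mor X Y) (mor (F X) (F Y)) *:%R (@fmor _ _ _ F X Y)
    (@fmor_linear _ _ _ F X Y).

Lemma fmorD X Y (f g : mor X Y) : fmor F (f + g) = fmor F f + fmor F g.
Proof. exact: (linearD (@fmor _ _ _ F X Y)). Qed.
Lemma fmor0 X Y : fmor F (0 : mor X Y) = 0.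
Proof. exact: (linear0 (@fmor _ _ _ F X Y)). Qed.

End Functor.

Section Automorphism.
Variables (k : fieldType) (C : lincat k) (F : automorphism C).

Lemma aut_inj X Y (f g : mor X Y) : fmor F f = fmor F g -> f = g.
Proof.
move=> e; have H := autK_mor F.
have := congr1 (fun u => eqmor (autK F Y) \oc fmor (aut_inv F) u) e.
rewrite /= !H => /(congr1 (precomp (eqmor (esym (autK F X))))).
by rewrite /precomp -!compA eqmorVK !compm1.
Qed.

Lemma aut_inv_inj X Y (f g : mor X Y) :
  fmor (aut_inv F) f = fmor (aut_inv F) g -> f = g.
Proof.
move=> e; have H := autVK_mor F.
have := congr1 (fun u => eqmor (autVK F Y) \oc fmor F u) e.
rewrite /= !H => /(congr1 (precomp (eqmor (esym (autVK F X))))).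
by rewrite /precomp -!compA eqmorVK !compm1.
Qed.

(** Objects come back only up to a propositional equality, so the preimage is corrected by [eqmor]
    on both sides. The equation is checked after [aut_inv], which is faithful. *)
Lemma aut_full X Y (g : mor (F X) (F Y)) : exists f, fmor F f = g.
Proof.
exists (eqmor (autK F Y) \oc fmor (aut_inv F) g \oc eqmor (esym (autK F X))).
apply: aut_inv_inj.
have H := autK_mor F.
apply: (iso_monic (is_iso_eqmor (autK F Y))).
by rewrite H -compA eqmorK compm1.
Qed.

End Automorphism.

(** * Direct sums, summands and indecomposable objects *)

Section Additive.
Variables (k : fieldType) (C : addcat k).
Implicit Types X Y Z W A B : C.

Definition orow X Y Z (f : mor X Z) (g : mor Y Z) : mor (osum X Y) Z :=
  f \oc opr1 X Y + g \oc opr2 X Y.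
Definition ocol X Y Z (f : mor Z X) (g : mor Z Y) : mor Z (osum X Y) :=
  oin1 X Y \oc f + oin2 X Y \oc g.

Lemma orow_in1 X Y Z (f : mor X Z) (g : mor Y Z) : orow f g \oc oin1 X Y = f.
Proof. by rewrite compDl -!compA opr1_in1 opr2_in1 compm1 compm0 addr0. Qed.
Lemma orow_in2 X Y Z (f : mor X Z) (g : mor Y Z) : orow f g \oc oin2 X Y = g.
Proof. by rewrite compDl -!compA opr1_in2 opr2_in2 compm1 compm0 add0r. Qed.
Lemma opr1_ocol X Y Z (f : mor Z X) (g : mor Z Y) : opr1 X Y \oc ocol f g = f.
Proof. by rewrite compDr !compA opr1_in1 opr1_in2 comp1m comp0m addr0. Qed.
Lemma opr2_ocol X Y Z (f : mor Z X) (g : mor Z Y) : opr2 X Y \oc ocol f g = g.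
Proof. by rewrite compDr !compA opr2_in1 opr2_in2 comp1m comp0m add0r. Qed.

Lemma osum_ext X Y Z (u v : mor (osum X Y) Z) :
  u \oc oin1 X Y = v \oc oin1 X Y -> u \oc oin2 X Y = v \oc oin2 X Y -> u = v.
Proof.
by move=> e1 e2; rewrite -[u]compm1 -[v]compm1 -osum_id !compDr !compA e1 e2.
Qed.

Lemma osum_coext X Y Z (u v : mor Z (osum X Y)) :
  opr1 X Y \oc u = opr1 X Y \oc v -> opr2 X Y \oc u = opr2 X Y \oc v -> u = v.
Proof.
by move=> e1 e2; rewrite -[u]comp1m -[v]comp1m -osum_id !compDl -!compA e1 e2.
Qed.

Lemma orow_ocol X Y Z W (f : mor X Z) (g : mor Y Z) (f' : mor W X)
    (g' : mor W Y) : orow f g \oc ocol f' g' = f \oc f' + g \oc g'.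
Proof. by rewrite compDl -!compA opr1_ocol opr2_ocol. Qed.

Lemma comp_orow X Y Z W (h : mor Z W) (f : mor X Z) (g : mor Y Z) :
  h \oc orow f g = orow (h \oc f) (h \oc g).
Proof. by rewrite compDr !compA. Qed.

Lemma mor_mx_in1 X Y X' Y' (a : mor X X') (b : mor Y X') (c : mor X Y')
    (e : mor Y Y') : mor_mx a b c e \oc oin1 X Y = ocol a c.
Proof.
by rewrite compDl -!compA -/(orow a b) -/(orow c e) !orow_in1.
Qed.
Lemma mor_mx_in2 X Y X' Y' (a : mor X X') (b : mor Y X') (c : mor X Y')
    (e : mor Y Y') : mor_mx a b c e \oc oin2 X Y = ocol b e.
Proof.
by rewrite compDl -!compA -/(orow a b) -/(orow c e) !orow_in2.
Qed.
Lemma opr1_mor_mx X Y X' Y' (a : mor X X') (b : mor Y X') (c : mor X Y')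
    (e : mor Y Y') : opr1 X' Y' \oc mor_mx a b c e = orow a b.
Proof. exact: opr1_ocol. Qed.
Lemma opr2_mor_mx X Y X' Y' (a : mor X X') (b : mor Y X') (c : mor X Y')
    (e : mor Y Y') : opr2 X' Y' \oc mor_mx a b c e = orow c e.
Proof. exact: opr2_ocol. Qed.

Lemma mor_mx_diagM X Y X' Y' X'' Y'' (f : mor X X') (g : mor Y Y')
    (f' : mor X' X'') (g' : mor Y' Y'') :
  mor_mx f' 0 0 g' \oc mor_mx f 0 0 g = mor_mx (f' \oc f) 0 0 (g' \oc g).
Proof.
apply: osum_ext; rewrite -compA ?mor_mx_in1 ?mor_mx_in2 /ocol compDr !compA
  ?mor_mx_in1 ?mor_mx_in2 /ocol !compDl -!compA !(comp0m, compm0, addr0, add0r).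
  by [].
by [].
Qed.

Lemma orow_mor_mx X Y X' Y' Z (f : mor X X') (g : mor Y Y')
    (f' : mor X' Z) (g' : mor Y' Z) :
  orow f' g' \oc mor_mx f 0 0 g = orow (f' \oc f) (g' \oc g).
Proof.
apply: osum_ext.
  by rewrite -compA mor_mx_in1 orow_ocol orow_in1 compm0 addr0.
by rewrite -compA mor_mx_in2 orow_ocol orow_in2 compm0 add0r.
Qed.

Lemma mor_mx_diag0 X Y X' Y' : mor_mx (0 : mor X X') 0 0 (0 : mor Y Y') = 0.
Proof. by rewrite /mor_mx !comp0m !addr0 !compm0 addr0. Qed.

Lemma retract_osum1 X Y : retract X (osum X Y).
Proof. by exists (oin1 X Y), (opr1 X Y); rewrite opr1_in1. Qed.

Lemma iso_osum X A B (i : mor A X) (p : mor X A) (j : mor B X) (q : mor X B) :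
  p \oc i = idm A -> q \oc j = idm B -> p \oc j = 0 -> q \oc i = 0 ->
  i \oc p + j \oc q = idm X -> is_iso (orow i j).
Proof.
move=> pi qj pj qi e; exists (ocol p q); split; last by rewrite orow_ocol.
apply: osum_coext; rewrite compA compm1 ?opr1_ocol ?opr2_ocol comp_orow.
  by rewrite pi pj /orow comp0m addr0 comp1m.
by rewrite qi qj /orow comp0m add0r comp1m.
Qed.

Hypothesis split : split_idempotents C.

Lemma retract_complement X A (i : mor A X) (p : mor X A) :
  p \oc i = idm A -> exists (B : C) (j : mor B X) (q : mor X B),
    [/\ q \oc j = idm B, p \oc j = 0, q \oc i = 0
      & i \oc p + j \oc q = idm X].
Proof.
move=> pi; have [|B [q [j [qj jq]]]] := split (e := idm X - i \oc p).
  by apply: idem_compl; rewrite compA -(compA i) pi compm1.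
exists B, j, q; split=> //.
- have : p \oc (j \oc q) = 0 by rewrite jq compBr compm1 compA pi comp1m subrr.
  by move/(congr1 (precomp j)); rewrite /precomp -!compA qj compm1 comp0m.
- have : (j \oc q) \oc i = 0 by rewrite jq compBl comp1m -compA pi compm1 subrr.
  by move/(congr1 (comp q)); rewrite !compA qj comp1m compm0.
- by rewrite jq addrC subrK.
Qed.

Lemma in_add_retract (T : C) X m : retract X (iter m (osum T) ozero) ->
  in_add T X.
Proof.
move=> [i [p pi]]; have [B [j [q [qj pj qi e]]]] := retract_complement pi.
by exists B, m, (orow i j); apply: (iso_osum pi qj).
Qed.

Lemma in_addP (T : C) X : in_add T X -> exists m,
  retract X (iter m (osum T) ozero).
Proof.
move=> [Y [m iso]]; exists m.
exact: retract_trans (retract_osum1 X Y) (isomorphic_retract iso).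
Qed.

Lemma in_add_trans (T : C) X Y : retract X Y -> in_add T Y -> in_add T X.
Proof.
by move=> r /in_addP[m r']; apply: (@in_add_retract _ _ m);
  apply: retract_trans r'.
Qed.

Lemma in_add_iter (T : C) m : in_add T (iter m (osum T) ozero).
Proof. by apply: (@in_add_retract _ _ m); exists (idm _), (idm _);
  rewrite comp1m. Qed.

Lemma in_add_ind (P : C -> Prop) (T : C) :
  (forall X Y, retract X Y -> P Y -> P X) -> P ozero -> P T ->
  (forall X Y, P X -> P Y -> P (osum X Y)) -> forall X, in_add T X -> P X.
Proof.
move=> Pr P0 PT Ps X /in_addP[m r]; apply: Pr r _.
by elim: m => [|m IH] //=; apply: Ps.
Qed.

Lemma indecomposable_idem X (e : mor X X) :
  indecomposable X -> e \oc e = e -> e = 0 \/ e = idm X.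
Proof.
move=> [_ ind] ee; have [A [p [i [pi ip]]]] := split ee.
have [B [j [q [qj pj qi s]]]] := retract_complement pi.
have iso : isomorphic X (osum A B).
  by apply: isomorphic_sym; exists (orow i j); apply: (iso_osum pi qj).
case: (ind _ _ iso) => z; [left | right].
  by rewrite -ip (mor_to0 p z) compm0.
by rewrite -s -ip (mor_to0 q z) compm0 addr0.
Qed.

Lemma indecomposable_fitting X (phi : mor X X) : indecomposable X ->
  (exists n, cpow phi n = 0) \/ exists psi, phi \oc psi = idm X.
Proof.
move=> ind; have [e fe] := fitting_ex phi.
case: (indecomposable_idem ind (fitting_idem fe)) => E.
  left; move: fe => [n /(_ n (leqnn n)) [P _ _ _]]; exists n.
  by rewrite -P E compm0.
right; move: fe => [n /(_ n.+1 (leqnSn n)) [_ _ [psi e1] _]].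
by exists (cpow phi n \oc psi); rewrite compA -cpowS -e1.
Qed.

(** The map u -> i u p embeds [mor A A] into [mor X X] and misses [j \oc q], because q (i u p) j = 0
    while q (j q) j is the identity of B. *)
Lemma End_dim_lt X A B (i : mor A X) (p : mor X A) (j : mor B X)
    (q : mor X B) : p \oc i = idm A -> p \oc j = 0 -> q \oc j = idm B ->
  idm B <> 0 -> (\dim {: mor A A} < \dim {: mor X X})%N.
Proof.
move=> pi pj qj B0.
pose L := (linfun (comp i) \o linfun (precomp p))%VF : 'Hom(mor A A, mor X X).
have LE u : L u = i \oc u \oc p by rewrite comp_lfunE !lfunE /= compA.
have L0 : lker L = 0%VS.
  apply/eqP/lker0P => u v; rewrite !LE => /(congr1 (fun w => p \oc w \oc i)).
  by rewrite !compA pi !comp1m -!compA pi !compm1.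
rewrite -(limg_dim_eq (f := L)); last by rewrite L0 capv0.
rewrite ltn_neqAle dimvS ?subvf // andbT; apply/eqP => e.
have : j \oc q \in (L @: fullv)%VS.
  have /eqP -> : (L @: fullv == fullv)%VS by rewrite eqEdim subvf e leqnn.
  exact: memvf.
case/memv_imgP => u _; rewrite LE => /(congr1 (fun w => q \oc w \oc j)).
rewrite -!compA pj !compm0 qj compm1 qj => z; exact: B0.
Qed.

(** Induction on the dimension of the endomorphism algebra, which drops for both summands of a
    proper decomposition. *)
Lemma decomposition_ind (P : C -> Prop) :
  (forall X Y, isomorphic X Y -> P Y -> P X) ->
  (forall X, idm X = 0 -> P X) -> (forall X, indecomposable X -> P X) ->
  (forall X Y, P X -> P Y -> P (osum X Y)) -> forall X, P X.
Proof.
move=> Pi P0 Pind Ps X.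
have [n] := ubnP (\dim {: mor X X}); elim: n X => // n IH X; rewrite ltnS => le.
case: (classic (idm X = 0)) => [/P0 // | X0].
case: (classic (indecomposable X)) => [/Pind // | nind].
have [A [B [iso [A0 B0]]]] : exists A B, isomorphic X (osum A B) /\
    idm A <> 0 /\ idm B <> 0.
  apply: NNPP => H; apply: nind; split=> // A B iso; apply: NNPP => H'.
  by apply: H; exists A, B; split=> //; split=> z; apply: H'; [left | right].
apply: (Pi _ _ iso); move: iso => [f [g [gf fg]]].
have E D D' (a : mor D (osum A B)) (b : mor (osum A B) D') :
  (b \oc f) \oc (g \oc a) = b \oc a.
  by rewrite -!compA (compA f) fg comp1m.
apply: Ps; apply: IH; apply: leq_trans le.
  apply: (@End_dim_lt X A B (g \oc oin1 A B) (opr1 A B \oc f)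
    (g \oc oin2 A B) (opr2 A B \oc f)) => //; rewrite E.
  - exact: opr1_in1.
  - exact: opr1_in2.
  - exact: opr2_in2.
apply: (@End_dim_lt X B A (g \oc oin2 A B) (opr2 A B \oc f)
    (g \oc oin1 A B) (opr1 A B \oc f)) => //; rewrite E.
- exact: opr2_in2.
- exact: opr2_in1.
- exact: opr1_in1.
Qed.

End Additive.

(** * Chains *)

Section Chains.
Variables (k : fieldType) (C : lincat k).

Definition ctail m (X Z : C) (c : chain m.+1 X Z) : chain m (projT1 c) Z :=
  (projT2 c).2.

Definition chd m (X Z : C) : chain m X Z -> {Y : C & mor X Y} :=
  match m return chain m X Z -> {Y : C & mor X Y} with
  | 0 => fun c => existT _ Z c
  | m'.+1 => fun c => existT _ (projT1 c) (projT2 c).1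
  end.

Definition ciso m (Z W : C) (g : mor Z W) (X Y : C) (f : mor X Y)
    (c : chain m X Z) (e : chain m Y W) :=
  exists h : chain_mor g f c e, chain_mor_iso h.

Lemma ciso_cons m (Z W : C) (g : mor Z W) (X Y : C) (f : mor X Y)
    (c : chain m.+1 X Z) (e : chain m.+1 Y W) (p : mor (projT1 c) (projT1 e)) :
  is_iso p -> (projT2 e).1 \oc f = p \oc (projT2 c).1 ->
  ciso g p (projT2 c).2 (projT2 e).2 -> ciso g f c e.
Proof. by move=> pP sq [h hP]; exists (existT _ p (sq, h)). Qed.

Lemma ciso_uncons m (Z W : C) (g : mor Z W) (X Y : C) (f : mor X Y)
    (c : chain m.+1 X Z) (e : chain m.+1 Y W) : ciso g f c e ->
  exists p : mor (projT1 c) (projT1 e),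
    [/\ is_iso p, (projT2 e).1 \oc f = p \oc (projT2 c).1
      & ciso g p (projT2 c).2 (projT2 e).2].
Proof. by move=> [[p [sq h]] [pP hP]]; exists p; split=> //; exists h. Qed.

Lemma chain_morP m (Z W : C) (g : mor Z W) (X Y : C) (f : mor X Y)
    (c : chain m.+1 X Z) (e : chain m.+1 Y W) :
  inhabited (chain_mor g f c e) <->
  exists p : mor (projT1 c) (projT1 e),
    (projT2 e).1 \oc f = p \oc (projT2 c).1 /\
    inhabited (chain_mor g p (projT2 c).2 (projT2 e).2).
Proof.
split=> [[[p [sq h]]] | [p [sq [h]]]]; first by exists p.
by split; exists p.
Qed.

Lemma ciso_inv m (Z W : C) (g : mor Z W) g' (X Y : C) (f : mor X Y) f'
    (c : chain m X Z) (e : chain m Y W) : g' \oc g = idm Z ->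
  f \oc f' = idm Y -> ciso g f c e -> ciso g' f' e c.
Proof.
move=> g'g; elim: m X Y f f' c e => [|m IH] X Y f f' c e ff'.
  move=> [/= sq _]; suff sq' : (c : mor X Z) \oc f' = g' \oc (e : mor Y W)
    by exists sq'.
  by rewrite -[c]comp1m -g'g -(compA g') -sq -!compA ff' compm1.
move=> /ciso_uncons[p [[p' [p'p pp']] sq h]].
apply: (@ciso_cons _ _ _ _ _ _ _ _ _ p'); last exact: IH h.
  by exists p.
by rewrite -[(projT2 c).1]comp1m -p'p -(compA p') -sq -!compA ff' compm1.
Qed.

Lemma ciso_crcons m (Z W Z' W' : C) (q : mor Z W) (q' : mor Z' W')
    (X Y : C) (p : mor X Y) (g : mor Z Z') (g' : mor W W')
    (c : chain m X Z) (e : chain m Y W) :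
  is_iso q -> g' \oc q = q' \oc g -> ciso q p c e ->
  ciso q' p (crcons g c) (crcons g' e).
Proof.
move=> qP sq; elim: m X Y p c e => [|m IH] X Y p c e.
  by move=> [sq0 _]; apply: (@ciso_cons 0 _ _ q' _ _ p (ccons (m := 0) (c : mor X Z)
    g)
    (ccons (m := 0) (e : mor Y W) g') q) => //; exists sq.
move=> /ciso_uncons[p' [p'P sq' h]].
apply: (@ciso_cons m.+1 _ _ q' _ _ p (crcons g c) (crcons g' e) p') => //.
exact: IH.
Qed.

Lemma ciso_cpost m (Z W : C) (q : mor Z W) (X : C) (c : chain m X Z) :
  ciso q (idm X) c (cpost q c).
Proof.
elim: m X c => [|m IH] X c /=.
  by have sq : (q \oc c) \oc idm X = q \oc c by [rewrite compm1]; exists sq.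
apply: (@ciso_cons m _ _ q _ _ (idm X) c (cpost q c) (idm _)) => //.
- exact: is_iso_id.
- by rewrite compm1 comp1m.
Qed.

Lemma ciso_cpostl m (Z Z' W : C) (g : mor Z' W) (s : mor Z Z') (X Y : C)
    (p : mor X Y) (c : chain m X Z) (e : chain m Y W) :
  ciso (g \oc s) p c e -> ciso g p (cpost s c) e.
Proof.
elim: m X Y p c e => [|m IH] X Y p c e.
  by move=> [sq _]; have sq' : (e : mor Y W) \oc p = g \oc (s \oc c)
    by [rewrite compA]; exists sq'.
move=> /ciso_uncons[p' [p'P sq' h]].
apply: (@ciso_cons m _ _ g _ _ p (cpost s c) e p') => //; exact: IH.
Qed.

Lemma chain_mor_crconsP m (Z W Z' W' : C) (q' : mor Z' W')
    (X Y : C) (p : mor X Y) (g : mor Z Z') (g' : mor W W')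
    (c : chain m X Z) (e : chain m Y W) :
  chain_mor q' p (crcons g c) (crcons g' e) ->
  exists q : mor Z W, g' \oc q = q' \oc g /\ inhabited (chain_mor q p c e).
Proof.
elim: m X Y p c e => [|m IH] X Y p c e /=.
  by move=> [q [sq sq']]; exists q.
move=> [p' [sq /IH[q [sq' [h]]]]]; exists q; split=> //.
by split; exists p'.
Qed.

Lemma crcons_ex m (X Z : C) (c : chain m.+1 X Z) :
  exists (Y : C) (g : mor Y Z) (c' : chain m X Y), c = crcons g c'.
Proof.
elim: m X c => [|m IH] X [Y [f c]]; first by exists Y, c, f.
have [Y' [g [c' ->]]] := IH _ c.
by exists Y', g, (ccons f c').
Qed.

Fixpoint cpairs (P : forall X Y Z : C, mor X Y -> mor Y Z -> Prop)
    m (Z : C) : forall X0 X : C, mor X0 X -> chain m X Z -> Prop :=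
  match m return forall X0 X : C, mor X0 X -> chain m X Z -> Prop with
  | 0 => fun X0 X f c => P _ _ _ f c
  | m'.+1 => fun X0 X f c =>
      P _ _ _ f (projT2 c).1 /\ cpairs P (projT2 c).1 (projT2 c).2
  end.

(** A rotation shifts the pairs by one and appends a new morphism at the far end. Looking at the
    first n pairs only ignores that morphism, which lets [angle_cpairs] go by induction on n. *)
Fixpoint cpairsn (P : forall X Y Z : C, mor X Y -> mor Y Z -> Prop)
    n m (Z : C) : forall X0 X : C, mor X0 X -> chain m X Z -> Prop :=
  match n, m return forall X0 X : C, mor X0 X -> chain m X Z -> Prop with
  | 0, _ => fun X0 X f c => True
  | n'.+1, 0 => fun X0 X f c => P _ _ _ f c
  | n'.+1, m'.+1 => fun X0 X f c =>
      P _ _ _ f (projT2 c).1 /\ cpairsn P n' (projT2 c).1 (projT2 c).2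
  end.

Lemma cpairsn_crcons P n m (Z W : C) (g : mor Z W) (X0 X : C) (f : mor X0 X)
    (c : chain m X Z) : (n <= m.+1)%N ->
  cpairsn P n f (crcons g c) -> cpairsn P n f c.
Proof.
elim: m n X0 X f c => [|m IH] [|n] X0 X f c //=; first by move=> _ [].
by move=> le [h1 h2]; split=> //; apply: IH.
Qed.

Lemma cpairsn_full P m (Z : C) (X0 X : C) (f : mor X0 X) (c : chain m X Z) :
  cpairsn P m.+1 f c -> cpairs P f c.
Proof.
by elim: m X0 X f c => [|m IH] X0 X f c //= [h1 h2]; split=> //; apply: IH.
Qed.

Lemma cpairs_crcons P m (Z W : C) (g : mor Z W) (X0 X : C) (f : mor X0 X)
    (c : chain m X Z) : cpairs P f (crcons g c) -> cpairs P f c.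
Proof.
elim: m X0 X f c => [|m IH] X0 X f c /=; first by case.
by move=> [h1 h2]; split=> //; apply: IH.
Qed.

Lemma cpairs_last P m (Z Z' W : C) (h : mor Z' W) (g : mor Z Z') (X0 X : C)
    (f : mor X0 X) (c : chain m X Z) :
  cpairs P f (crcons h (crcons g c)) -> P _ _ _ g h.
Proof.
elim: m X0 X f c => [|m IH] X0 X f c /=; first by case=> _ [].
by move=> [_]; apply: IH.
Qed.

Lemma cpairs_closed_last P m (X Z Z' W : C) (h : mor Z' W) (g : mor Z Z')
    (c : chain m X Z) (c' := crcons h (crcons g c)) :
  cpairs P (projT2 c').1 (ctail c') -> P _ _ _ g h.
Proof.
rewrite {}/c'; case: m c => [|m] c; first by move=> /= [].
exact: cpairs_last.
Qed.

Lemma chain_arrow_crcons m (Z W : C) (g : mor Z W) (X : C) (c : chain m X Z) i :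
  (i <= m)%N -> chain_arrow (crcons g c) i = chain_arrow c i.
Proof.
elim: m X c i => [|m IH] X c [|i] //= le; exact: IH.
Qed.

Lemma chain_arrow_crcons_last m (Z W : C) (g : mor Z W) (X : C)
    (c : chain m X Z) : chain_arrow (crcons g c) m.+1 = Arrow g.
Proof. by elim: m X c => [|m IH] X c //=; apply: IH. Qed.

(** Exhibits c as a retract of e. The retraction identities at the two ends are left to the user:
    for an angle the ends are A and Sg A, and the second identity follows from the first. *)
Fixpoint chain_retr m (Z W : C) (gi : mor Z W) (gr : mor W Z) :
    forall (X Y : C) (fi : mor X Y) (fr : mor Y X),
      chain m X Z -> chain m Y W -> Prop :=
  match m return forall (X Y : C) (fi : mor X Y) (fr : mor Y X),
      chain m X Z -> chain m Y W -> Prop with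
  | 0 => fun X Y fi fr c e => e \oc fi = gi \oc c /\ c \oc fr = gr \oc e
  | m'.+1 => fun X Y fi fr c e =>
      exists (pi : mor (projT1 c) (projT1 e)) (pr : mor (projT1 e) (projT1 c)),
        [/\ pr \oc pi = idm _, (projT2 e).1 \oc fi = pi \oc (projT2 c).1,
            (projT2 c).1 \oc fr = pr \oc (projT2 e).1
          & chain_retr gi gr pi pr (projT2 c).2 (projT2 e).2]
  end.

Lemma chain_retr_id m (X Z : C) (c : chain m X Z) :
  chain_retr (idm Z) (idm Z) (idm X) (idm X) c c.
Proof.
elim: m X c => [|m IH] X c /=; first by rewrite compm1 comp1m.
by exists (idm _), (idm _); rewrite !compm1 !comp1m; split.
Qed.

Lemma chain_retr_crcons m (Z W Z' W' : C) (gi : mor Z W) (gr : mor W Z)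
    (hi : mor Z' W') (hr : mor W' Z') (a : mor Z Z') (b : mor W W')
    (X Y : C) (fi : mor X Y) (fr : mor Y X) (c : chain m X Z)
    (e : chain m Y W) :
  gr \oc gi = idm _ -> b \oc gi = hi \oc a -> a \oc gr = hr \oc b ->
  chain_retr gi gr fi fr c e ->
  chain_retr hi hr fi fr (crcons a c) (crcons b e).
Proof.
move=> rg sq1 sq2; elim: m X Y fi fr c e => [|m IH] X Y fi fr c e /=.
  by move=> [h1 h2]; exists gi, gr.
by move=> [pi [pr [h1 h2 h3 h4]]]; exists pi, pr; split=> //; apply: IH.
Qed.

(** f is a weak kernel of g and g is a weak cokernel of f. *)
Definition wexact (X Y Z : C) (f : mor X Y) (g : mor Y Z) :=
  [/\ g \oc f = 0,
      forall W (u : mor W Y), g \oc u = 0 -> exists v, u = f \oc v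
    & forall W (u : mor Y W), u \oc f = 0 -> exists v, u = v \oc g].

End Chains.

Section ChainComplement.
Variables (k : fieldType) (C : addcat k).
Hypothesis split : split_idempotents C.

(** e carries the complement B into the complement D because [gr \oc e \oc j = c \oc fr \oc j = 0],
    so e becomes diagonal. *)
Lemma complement_square (X Y Z W B D : C) (fi : mor X Y) (fr : mor Y X)
    (gi : mor Z W) (gr : mor W Z) (j : mor B Y) (j' : mor D W) (q' : mor W D)
    (c : mor X Z) (e : mor Y W) :
  fr \oc j = 0 -> gi \oc gr + j' \oc q' = idm W ->
  e \oc fi = gi \oc c -> c \oc fr = gr \oc e ->
  e \oc orow fi j = orow gi j' \oc mor_mx c 0 0 (q' \oc e \oc j).
Proof.
move=> frj s sq1 sq2; rewrite orow_mor_mx comp_orow sq1; congr (orow _ _).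
rewrite -[LHS]comp1m -s compDl -!compA (compA gr) -sq2 -compA frj.
by rewrite !compm0 add0r.
Qed.

Lemma chain_complement m (Z W D : C) (gi : mor Z W) (gr : mor W Z)
    (j' : mor D W) (q' : mor W D) (X Y B : C) (fi : mor X Y) (fr : mor Y X)
    (j : mor B Y) (c : chain m X Z) (e : chain m Y W) :
  gi \oc gr + j' \oc q' = idm W -> fr \oc j = 0 ->
  chain_retr gi gr fi fr c e ->
  exists v : chain m B D, ciso (orow gi j') (orow fi j) (chain_sum c v) e.
Proof.
move=> s; elim: m X Y B fi fr j c e => [|m IH] X Y B fi fr j c e frj /=.
  move=> [sq1 sq2].
  by exists (q' \oc e \oc j), (complement_square frj s sq1 sq2).
move=> [pi [pr [rp sq1 sq2 h]]].
have [B1 [j1 [q1 [qj pj qi s1]]]] := retract_complement split rp.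
have [v hv] := IH _ _ _ _ _ _ _ _ pj h.
pose v' := ccons (q1 \oc (projT2 e).1 \oc j) v; exists v'.
apply: (@ciso_cons _ _ m _ _ _ _ _ _ (chain_sum c v') e (orow pi j1)) => //.
  exact: iso_osum rp qj pj qi s1.
exact: complement_square frj s1 sq1 sq2.
Qed.

End ChainComplement.

(** * Angles *)

Section Angles.
Variables (k : fieldType) (d : nat) (C : angulated k d.+1).
Notation Sg := (susp C).

(** Reading a sequence as one chain from A to Sg A makes the lemmas on chains apply to all its
    morphisms at once. *)
Definition sseq_of (A : C) (c : chain d.+2 A (Sg A)) : sseq d.+1 Sg :=
  SSeq (d := d.+1) (Sg := Sg) (projT2 c).1 (projT2 c).2.

Lemma angle_ciso (A B : C) (f : mor A B) (c : chain d.+2 A (Sg A))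
    (e : chain d.+2 B (Sg B)) :
  is_iso f -> ciso (fmor Sg f) f c e -> angle (sseq_of c) -> angle (sseq_of e).
Proof.
move=> fP /ciso_uncons[p [pP sq [h hP]]]; apply: angle_iso.
by exists f, p, h; split.
Qed.

Lemma susp_sum_orow (X Y Z : C) (f : mor X Z) (g : mor Y Z) :
  fmor Sg (orow f g) \oc susp_sum Sg X Y = orow (fmor Sg f) (fmor Sg g).
Proof.
by rewrite compDr !compA -!fmorM orow_in1 orow_in2.
Qed.

(* Complements of the components of the retraction form a chain whose sum with c
   is isomorphic to e. *)
Lemma retract_angle (A B : C) (i : mor A B) (p : mor B A)
    (c : chain d.+2 A (Sg A)) (e : chain d.+2 B (Sg B)) :
  split_idempotents C -> p \oc i = idm A ->
  chain_retr (fmor Sg i) (fmor Sg p) i p c e ->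
  angle (sseq_of e) -> angle (sseq_of c).
Proof.
move=> split pi h.
have [D [j [q [qj pj qi s]]]] := retract_complement split pi.
have sS : fmor Sg i \oc fmor Sg p + fmor Sg j \oc fmor Sg q = idm (Sg B).
  by rewrite -!fmorM -fmorD s fmor1.
have [v /ciso_uncons[f2 [f2P sq hv]]] := chain_complement split sS pj h.
have [g [gf fg]] := iso_osum pi qj pj qi s.
pose w := ccons (mor_mx (projT2 c).1 0 0 (projT2 v).1)
  (cpost (susp_sum Sg A D) (chain_sum (ctail c) (ctail v))).
suff E : ciso (fmor Sg g) g e w.
  move=> ae; have gP : is_iso g by exists (orow i j).
  by have /(@angle_summand _ _ C (sseq_of c) (sseq_of v))[] := angle_ciso gP E
    ae.
apply: (@ciso_inv _ _ _ _ _ (fmor Sg (orow i j)) _ _ _ (orow i j)) => //.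
  by rewrite -fmorM gf fmor1.
apply: (@ciso_cons _ _ d.+1 _ _ _ _ _ _ w e f2) => //.
by apply: ciso_cpostl; rewrite susp_sum_orow.
Qed.

(** Meant for A = Sg ozero, which is a zero object without being literally [ozero]: a rotated
    trivial angle is only isomorphic to the expected sequence. *)
Lemma zero_chain_crcons (A : C) m (X Z : C) : idm A = 0 ->
  ciso (idm Z) (idm X) (zero_chain m.+1 X Z)
    (crcons (0 : mor A Z) (zero_chain m X A)).
Proof.
move=> A0; elim: m X => [|m IH] X.
  have sq : (0 : mor A Z) \oc (0 : mor ozero A) = idm Z \oc (0 : mor ozero Z).
    by rewrite compm0 compm0.
  apply: (@ciso_cons _ _ 0 _ _ _ _ _ _ (zero_chain 1 X Z)
    (crcons (0 : mor A Z) (zero_chain 0 X A)) (0 : mor ozero A)).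
  - exact: is_iso_zero (ozeroP _) A0.
  - by rewrite !compm0 comp0m.
  - by exists sq.
apply: (@ciso_cons _ _ m.+1 _ _ _ _ _ _ (zero_chain m.+2 X Z)
    (crcons (0 : mor A Z) (zero_chain m.+1 X A)) (idm ozero)); last exact: IH.
  exact: is_iso_id.
by rewrite /= compm1 comp1m.
Qed.

(** Its rotation is isomorphic to the trivial angle on W. Maps into this angle detect weak
    cokernels. *)
Lemma angle_trivial2 (W : C) :
  angle (sseq_of (ccons (0 : mor ozero W)
    (ccons (idm W) (zero_chain d W (Sg ozero))))).
Proof.
apply/angle_rot; rewrite /rotation /=.
have z : idm (Sg ozero) = 0 :> mor (Sg ozero) _ by rewrite -fmor1 ozeroP fmor0.
have := angle_trivial (a := C) W.
rewrite fmor0 scaler0.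
have E := zero_chain_crcons d W (Sg W) z.
apply: (@angle_ciso W W (idm W) (ccons (idm W) (zero_chain d.+1 W (Sg W)))
  (ccons (idm W) (crcons 0 (zero_chain d W (Sg ozero))))).
  exact: is_iso_id.
apply: (@ciso_cons _ _ d.+1 _ _ _ _ _ _
  (ccons (idm W) (zero_chain d.+1 W (Sg W)))
  (ccons (idm W) (crcons 0 (zero_chain d W (Sg ozero)))) (idm W)) => //.
  exact: is_iso_id.
by rewrite fmor1.
Qed.

Lemma sign_neq0 n : (-1) ^+ n != 0 :> k.
Proof. by rewrite expf_neq0 // oppr_eq0 oner_neq0. Qed.

Lemma scale_signI (X Y : C) n (f g : mor X Y) :
  (-1) ^+ n *: f = (-1) ^+ n *: g -> f = g.
Proof. exact: (scalerI (sign_neq0 n)). Qed.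

(** Each clause completes a square against a trivial angle: the trivial angle on X mapped into x,
    the rotated one on W mapped into the rotation of x (its last component is Sigma of the wanted
    factor), and x mapped into [angle_trivial2]. *)
Lemma angle_wexact (X Y Z : C) (f : mor X Y) (g : mor Y Z)
    (c : chain d Z (Sg X)) :
  angle (SSeq (d := d.+1) f (ccons g c)) -> wexact f g.
Proof.
set x := SSeq _ _ => ax; split.
- have [|[p [/= sq _]]] := @angle_mor _ _ C (trivial_sseq d.+1 Sg X) x
    (idm X) f (angle_trivial X) ax; first by [].
  by rewrite sq compm0.
- move=> W u gu; have aW := (angle_rot _).1 (angle_trivial (a := C) W).
  have [|h] := @angle_mor _ _ C
     (rotation (trivial_sseq d.+1 Sg W)) (rotation x) u (0 : mor ozero Z)
     aW ((angle_rot _).1 ax); first by rewrite /= gu comp0m.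
  have [q [sq _]] := @chain_mor_crconsP _ _ d _ _ _ _ _ _ _ _ _ _
    (zero_chain d ozero (Sg W)) c h.
  move: sq; rewrite compZl compZr => /scale_signI; rewrite fmor1 compm1.
  by have [v <-] := aut_full q; rewrite -fmorM => /aut_inj e; exists v.
move=> W u uf.
have [|[p [/= sq _]]] := @angle_mor _ _ C x (sseq_of (ccons (0 : mor ozero W)
    (ccons (idm W) (zero_chain d W (Sg ozero)))))
  (0 : mor X ozero) u ax (angle_trivial2 W); first by rewrite /= uf comp0m.
by exists p; rewrite -sq comp1m.
Qed.

Lemma angle_cpairs (X Y : C) (f : mor X Y) (c : chain d.+1 Y (Sg X)) :
  angle (SSeq f c) -> cpairs (@wexact k C) f c.
Proof.
move=> a; apply: cpairsn_full.
have H n : (n <= d.+2)%N -> forall X Y (f : mor X Y) (c : chain d.+1 Y (Sg X)),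
    angle (SSeq f c) -> cpairsn (@wexact k C) n f c.
  elim: n => [|n IH] le {}X {}Y {}f [Z [g {}c]] {}a //.
  split; first exact: angle_wexact a.
  have := (angle_rot _).1 a; rewrite /rotation /= => /(IH (ltnW le)).
  by apply: cpairsn_crcons; exact: le.
exact: H.
Qed.

Lemma angle_last0 (X Y Z : C) (f : mor X Y) (g : mor Z (Sg X))
    (c : chain d Y Z) : angle (SSeq (d := d.+1) f (crcons g c)) ->
  fmor Sg f \oc g = 0.
Proof.
move=> a; have /angle_cpairs/cpairs_closed_last[+ _ _] := (angle_rot _).1 a.
by rewrite compZl => /eqP; rewrite scaler_eq0 (negbTE (sign_neq0 _)) => /eqP.
Qed.

Lemma angle_wexact_rot (x : sseq d.+1 Sg) : angle x ->
  wexact (ssmor x) (ssmor (rotation x)).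
Proof. by case: x => X Y f [Z [g c]] a; apply: (angle_wexact a). Qed.

Lemma angle_iter (x : sseq d.+1 Sg) i : angle x ->
  angle (iter i (@rotation _ _ _ Sg) x).
Proof. by move=> a; elim: i => //= i IH; exact: (angle_rot _).1 IH. Qed.

(** The last morphism has index d.+2; up to there no morphism carrying the sign of a rotation has
    reached the front. Positions in an angle thereby become indices into its rotations. *)
Lemma rotation_arrow (x : sseq d.+1 Sg) i : (i <= d.+2)%N ->
  chain_arrow (ccons (ssmor x) (sstail x)) i =
  Arrow (ssmor (iter i (@rotation _ _ _ Sg) x)).
Proof.
elim: i x => [|i IH] x le //.
rewrite iterSr -IH ?(ltnW le) //; case: x => X Y f [Z [g c]].
exact: esym (@chain_arrow_crcons _ _ d.+1 _ _
  ((-1) ^+ (d.+1 + 2) *: fmor Sg f) _ (ccons g c) i le).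
Qed.

(** Complete a desuspension of g as a first morphism and rotate once. *)
Lemma angle_with_last (Z W : C) (g : mor Z (Sg W)) :
  exists c : chain d.+1 W Z, angle (sseq_of (crcons g c)).
Proof.
pose kap := eqmor (autVK Sg Z).
(* The sign is chosen to cancel the one introduced by the rotation; kap identifies Sigma Sigma^-1 Z
   with Z. *)
have [al alE] := aut_full ((-1) ^+ (d.+1 + 2) *: (g \oc kap)).
have [c ac] := angle_ex (a := C) al.
exists (cpost kap c).
have := (angle_rot _).1 ac.
rewrite /rotation /= alE scalerA -expr2 sqrr_sign scale1r.
apply: (@angle_ciso W W (idm W) (crcons (g \oc kap) c)
  (crcons g (cpost kap c))); first exact: is_iso_id.
apply: ciso_crcons; last exact: ciso_cpost.
  exact: is_iso_eqmor.
by rewrite fmor1 comp1m.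
Qed.

End Angles.

(** * Modules *)

Section LinearMaps.
Variable k : fieldType.
Implicit Types U V W : vectType k.

Lemma limg_fullP V W (f : 'Hom(V, W)) :
  limg f = fullv <-> forall w, exists v, w = f v.
Proof.
split=> [e w|H].
  by have /memv_imgP[v _ ->] : w \in limg f by [rewrite e memvf]; exists v.
apply/eqP; rewrite eqEsubv subvf; apply/subvP => w _.
by have [v ->] := H w; apply: memv_img; apply: memvf.
Qed.

Lemma lker_eq0P V W (f : 'Hom(V, W)) :
  lker f = 0%VS <-> forall v, f v = 0 -> v = 0.
Proof.
split=> [e v fv|H]; last first.
  by apply/eqP; rewrite -subv0; apply/subvP => v; rewrite memv_ker memv0 =>
    /eqP/H/eqP.
by apply/eqP; rewrite -memv0 -e memv_ker fv.
Qed.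

Lemma limgP V W (f : 'Hom(V, W)) w : w \in limg f <-> exists v, w = f v.
Proof.
split=> [/memv_imgP[v _ ->] | [v ->]]; first by exists v.
by apply: memv_img; apply: memvf.
Qed.

Lemma lkerP V W (f : 'Hom(V, W)) v : v \in lker f <-> f v = 0.
Proof. by rewrite memv_ker; split=> [/eqP|->]. Qed.

Lemma limg_subP V V' W (f : 'Hom(V, W)) (g : 'Hom(V', W)) :
  (limg f <= limg g)%VS <-> forall v, exists v', f v = g v'.
Proof.
split=> [/subvP H v | H]; first by apply/limgP/H/limgP; exists v.
by apply/subvP => w /limgP[v ->]; apply/limgP.
Qed.

Lemma lker_subP V W W' (f : 'Hom(V, W)) (g : 'Hom(V, W')) :
  (lker f <= lker g)%VS <-> forall v, f v = 0 -> g v = 0.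
Proof.
split=> [/subvP H v /lkerP/H/lkerP // | H].
by apply/subvP => v /lkerP/H/lkerP.
Qed.

Lemma limg_lkerP V W U (f : 'Hom(V, W)) (g : 'Hom(W, U)) :
  limg f = lker g <->
  (forall v, g (f v) = 0) /\ (forall w, g w = 0 -> exists v, w = f v).
Proof.
split=> [e | [H1 H2]].
  split=> [v | w /lkerP]; first by apply/lkerP; rewrite -e; apply/limgP;
    exists v.
  by rewrite -e => /limgP.
apply/eqP; rewrite eqEsubv; apply/andP; split; apply/subvP => w.
  by move=> /limgP[v ->]; apply/lkerP.
by move=> /lkerP/H2/limgP.
Qed.

Lemma lfun_factor V W U (u : 'Hom(V, W)) (f : 'Hom(V, U)) :
  (lker u <= lker f)%VS -> exists g : 'Hom(W, U), f = (g \o u)%VF.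
Proof.
move=> /lker_subP H; exists (f \o u^-1)%VF; apply/lfunP => v.
rewrite !comp_lfunE; apply/eqP; rewrite -subr_eq0 -linearB; apply/eqP/H.
rewrite linearB /= limg_lfunVK ?subrr //; apply/limgP; by exists v.
Qed.

Lemma lfun_lift V W U (s : 'Hom(V, W)) (f : 'Hom(U, W)) :
  (limg f <= limg s)%VS -> exists g : 'Hom(U, V), f = (s \o g)%VF.
Proof.
move=> /subvP H; exists (s^-1 \o f)%VF; apply/lfunP => v.
by rewrite !comp_lfunE limg_lfunVK //; apply/H/limgP; exists v.
Qed.

Lemma linfunE V W (f : V -> W) : linear f -> forall v, linfun f v = f v.
Proof.
move=> fl v; pose fL := HB.pack_for {linear V -> W} f
  (GRing.isLinear.Build k V W *:%R f fl).
exact: (lfunE fL).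
Qed.

Lemma ex_min (A : Type) (P : A -> Prop) (f : A -> nat) :
  (exists a, P a) -> exists a, P a /\ forall b, P b -> (f a <= f b)%N.
Proof.
move=> [a]; have [n] := ubnP (f a); elim: n a => // n IH a; rewrite ltnS =>
  le Pa.
case: (classic (exists b, P b /\ (f b < f a)%N)) => [[b [Pb lt]] | H].
  exact: IH b (leq_trans lt le) Pb.
exists a; split=> // b Pb; rewrite leqNgt; apply/negP => lt.
by apply: H; exists b.
Qed.

End LinearMaps.

(** * Right modules, objects of add T and minimal presentations *)

Section RightModules.
Variables (k : fieldType) (C : addcat k) (T : C).
Implicit Types M N L P : rmod T.

Lemma ractDl M (x y : M) a : ract (x + y) a = ract x a + ract y a.
Proof. by have := ract_linearl (r := M) a 1 x y; rewrite !scale1r. Qed.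
Lemma ractZl M c (x : M) a : ract (c *: x) a = c *: ract x a.
Proof.
have := ract_linearl (r := M) a c x 0; rewrite !addr0.
have := ract_linearl (r := M) a 1 0 0; rewrite !scale1r addr0.
by move/eqP; rewrite -subr_eq addrN eq_sym => /eqP ->; rewrite addr0.
Qed.
Lemma ract0l M a : ract (0 : M) a = 0.
Proof. by rewrite -(scale0r (0 : M)) ractZl !scale0r. Qed.

Lemma mod_hom_comp M N L (g : 'Hom(N, L)) (f : 'Hom(M, N)) :
  mod_hom g -> mod_hom f -> mod_hom (g \o f)%VF.
Proof. by move=> gh fh x a; rewrite !comp_lfunE fh gh. Qed.
Lemma mod_hom_add M N (f g : 'Hom(M, N)) :
  mod_hom f -> mod_hom g -> mod_hom (f + g).
Proof. by move=> fh gh x a; rewrite !add_lfunE fh gh ractDl. Qed.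
Lemma mod_hom_opp M N (f : 'Hom(M, N)) : mod_hom f -> mod_hom (- f).
Proof.
by move=> fh x a; rewrite !opp_lfunE fh -scaleN1r -ractZl scaleN1r.
Qed.
Lemma mod_hom_sub M N (f g : 'Hom(M, N)) :
  mod_hom f -> mod_hom g -> mod_hom (f - g).
Proof. by move=> fh gh; apply: mod_hom_add => //; apply: mod_hom_opp. Qed.
Lemma mod_hom0 M N : mod_hom (0 : 'Hom(M, N)).
Proof. by move=> x a; rewrite !zero_lfunE ract0l. Qed.
Lemma mod_hom1 M : mod_hom (\1%VF : 'Hom(M, M)).
Proof. by move=> x a; rewrite !id_lfunE. Qed.

Lemma mod_factor M N L (q : 'Hom(M, N)) (f : 'Hom(M, L)) :
  mod_hom q -> limg q = fullv -> mod_hom f ->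
  (forall v, q v = 0 -> f v = 0) ->
  exists g : 'Hom(N, L), mod_hom g /\ f = (g \o q)%VF.
Proof.
move=> qh /limg_fullP qs fh /lker_subP/lfun_factor[g e]; exists g; split=>
  // x a.
have [v ->] := qs x.
by have E w : g (q w) = f w by [rewrite e comp_lfunE]; rewrite -qh !E fh.
Qed.

Lemma mod_lift M N L (j : 'Hom(N, M)) (f : 'Hom(L, M)) :
  mod_hom j -> lker j = 0%VS -> mod_hom f ->
  (forall v, exists w, f v = j w) ->
  exists g : 'Hom(L, N), mod_hom g /\ f = (j \o g)%VF.
Proof.
move=> jh /lker_eq0P j0 fh /limg_subP/lfun_lift[g e]; exists g; split=> // x a.
have E w : j (g w) = f w by rewrite e comp_lfunE.
by apply/eqP; rewrite -subr_eq0; apply/eqP/j0;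
  rewrite linearB /= jh !E fh subrr.
Qed.

Lemma homTE (X Y : C) (f : mor X Y) (u : mor T X) : homT_mor T f u = f \oc u.
Proof. exact: (linfunE (comp_linearr f)). Qed.

Lemma homT_hom (X Y : C) (f : mor X Y) : mod_hom (homT_mor T f).
Proof. by move=> u a; rewrite !homTE /= compA. Qed.

Lemma homT_morM (X Y Z : C) (g : mor Y Z) (f : mor X Y) :
  homT_mor T (g \oc f) = (homT_mor T g \o homT_mor T f)%VF.
Proof. by apply/lfunP => u; rewrite comp_lfunE !homTE compA. Qed.
Lemma homT_mor1 (X : C) : homT_mor T (idm X) = \1%VF.
Proof. by apply/lfunP => u; rewrite id_lfunE homTE comp1m. Qed.
Lemma homT_morD (X Y : C) (f g : mor X Y) :
  homT_mor T (f + g) = homT_mor T f + homT_mor T g.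
Proof. by apply/lfunP => u; rewrite add_lfunE !homTE compDl. Qed.
Lemma homT_morB (X Y : C) (f g : mor X Y) :
  homT_mor T (f - g) = homT_mor T f - homT_mor T g.
Proof. by apply/lfunP => u; rewrite add_lfunE opp_lfunE !homTE compBl. Qed.
Lemma homT_mor0 (X Y : C) : homT_mor T (0 : mor X Y) = 0.
Proof. by apply/lfunP => u; rewrite zero_lfunE homTE comp0m. Qed.
Lemma homT_eq0P (X Y : C) (f : mor X Y) :
  homT_mor T f = 0 <-> forall u : mor T X, f \oc u = 0.
Proof.
split=> [e u | H]; first by rewrite -homTE e zero_lfunE.
by apply/lfunP => u; rewrite homTE zero_lfunE H.
Qed.

Lemma orow_homT (X Y : C) M (p : 'Hom(homT T X, M)) (q : 'Hom(homT T Y, M)) :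
  mod_hom p -> mod_hom q ->
  exists r : 'Hom(homT T (osum X Y), M), [/\ mod_hom r,
    (r \o homT_mor T (oin1 X Y))%VF = p & (r \o homT_mor T (oin2 X Y))%VF = q].
Proof.
move=> ph qh; exists ((p \o homT_mor T (opr1 X Y)) + (q \o homT_mor T (opr2 X
  Y)))%VF.
split.
- by apply: mod_hom_add; apply: mod_hom_comp => //; apply: homT_hom.
- rewrite comp_lfunDl -!comp_lfunA -!homT_morM opr1_in1 opr2_in1.
  by rewrite homT_mor1 homT_mor0 comp_lfun1r comp_lfun0r addr0.
- rewrite comp_lfunDl -!comp_lfunA -!homT_morM opr1_in2 opr2_in2.
  by rewrite homT_mor1 homT_mor0 comp_lfun1r comp_lfun0r add0r.
Qed.

Lemma ocol_homT (X Y : C) M (p : 'Hom(M, homT T X)) (q : 'Hom(M, homT T Y)) :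
  mod_hom p -> mod_hom q ->
  exists r : 'Hom(M, homT T (osum X Y)), [/\ mod_hom r,
    (homT_mor T (opr1 X Y) \o r)%VF = p & (homT_mor T (opr2 X Y) \o r)%VF = q].
Proof.
move=> ph qh; exists ((homT_mor T (oin1 X Y) \o p) + (homT_mor T (oin2 X Y) \o
  q))%VF.
split.
- by apply: mod_hom_add; apply: mod_hom_comp => //; apply: homT_hom.
- rewrite comp_lfunDr !comp_lfunA -!homT_morM opr1_in1 opr1_in2.
  by rewrite homT_mor1 homT_mor0 comp_lfun1l comp_lfun0l addr0.
- rewrite comp_lfunDr !comp_lfunA -!homT_morM opr2_in1 opr2_in2.
  by rewrite homT_mor1 homT_mor0 comp_lfun1l comp_lfun0l add0r.
Qed.

Lemma homT_osum_ext (X Y : C) (V : vectType k)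
  (p q : 'Hom(homT T (osum X Y), V)) :
  (p \o homT_mor T (oin1 X Y))%VF = (q \o homT_mor T (oin1 X Y))%VF ->
  (p \o homT_mor T (oin2 X Y))%VF = (q \o homT_mor T (oin2 X Y))%VF -> p = q.
Proof.
move=> e1 e2; rewrite -[p]comp_lfun1r -[q]comp_lfun1r -homT_mor1 -osum_id.
by rewrite homT_morD !homT_morM !comp_lfunDr !comp_lfunA e1 e2.
Qed.

Lemma homT_osum_coext (X Y : C) (V : vectType k)
  (p q : 'Hom(V, homT T (osum X Y))) :
  (homT_mor T (opr1 X Y) \o p)%VF = (homT_mor T (opr1 X Y) \o q)%VF ->
  (homT_mor T (opr2 X Y) \o p)%VF = (homT_mor T (opr2 X Y) \o q)%VF -> p = q.
Proof.
move=> e1 e2; rewrite -[p]comp_lfun1l -[q]comp_lfun1l -homT_mor1 -osum_id.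
by rewrite homT_morD !homT_morM !comp_lfunDl -!comp_lfunA e1 e2.
Qed.

(** Asking for containment of images instead of surjectivity of s spares the passage to the
    submodule [limg s]; dually, [inj_ext] spares quotient modules. *)
Definition proj_lift P := forall M N (s : 'Hom(M, N)) (f : 'Hom(P, N)),
  mod_hom s -> mod_hom f -> (limg f <= limg s)%VS ->
  exists g : 'Hom(P, M), mod_hom g /\ f = (s \o g)%VF.

Definition inj_ext P := forall M L (u : 'Hom(M, L)) (f : 'Hom(M, P)),
  mod_hom u -> mod_hom f -> (lker u <= lker f)%VS ->
  exists g : 'Hom(L, P), mod_hom g /\ f = (g \o u)%VF.

Lemma proj_lift_projective P : proj_lift P -> projective P.
Proof. by move=> H M N s f sh se fh; apply: H; rewrite // se subvf. Qed.

Lemma inj_ext_injective P : inj_ext P -> injective_mod P.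
Proof. by move=> H M N s f sh se fh; apply: H; rewrite // se sub0v. Qed.

(* The properties of the objects of add T that matter below; iobj collects the
   dual ones, which hold on add (S T). *)
Definition pobj (A : C) := [/\ proj_lift (homT T A),
  forall Y (p : 'Hom(homT T A, homT T Y)), mod_hom p ->
    exists f : mor A Y, p = homT_mor T f
  & forall Y (f : mor A Y), homT_mor T f = 0 -> f = 0].

Definition iobj (A : C) := [/\ inj_ext (homT T A),
  forall Y (p : 'Hom(homT T Y, homT T A)), mod_hom p ->
    exists f : mor Y A, p = homT_mor T f
  & forall Y (f : mor Y A), homT_mor T f = 0 -> f = 0].

Lemma pobj_retract X Y : retract X Y -> pobj Y -> pobj X.
Proof.
move=> [i [p pi]] [Y1 Y2 Y3].
have E : (homT_mor T p \o homT_mor T i)%VF = \1%VF by rewrite -homT_morM pi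
  homT_mor1.
split.
- move=> M N s f sh fh /limg_subP H.
  have [||g [gh e]] := Y1 _ _ s (f \o homT_mor T p)%VF sh.
  + by apply: mod_hom_comp => //; apply: homT_hom.
  + by apply/limg_subP => v; rewrite comp_lfunE; apply: H.
  exists (g \o homT_mor T i)%VF; split.
    by apply: mod_hom_comp => //; apply: homT_hom.
  by rewrite comp_lfunA -e -comp_lfunA E comp_lfun1r.
- move=> Z f fh; have [|h e] := Y2 Z (f \o homT_mor T p)%VF.
    by apply: mod_hom_comp => //; apply: homT_hom.
  exists (h \oc i); rewrite homT_morM -e -comp_lfunA E comp_lfun1r //.
- move=> Z f e; rewrite -[f]compm1 -pi compA (Y3 _ (f \oc p)) ?comp0m //.
  by rewrite homT_morM e comp_lfun0l.
Qed.

Lemma iobj_retract X Y : retract X Y -> iobj Y -> iobj X.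
Proof.
move=> [i [p pi]] [Y1 Y2 Y3].
have E : (homT_mor T p \o homT_mor T i)%VF = \1%VF by rewrite -homT_morM pi
  homT_mor1.
split.
- move=> M N s f sh fh /lker_subP H.
  have [||g [gh e]] := Y1 _ _ s (homT_mor T i \o f)%VF sh.
  + by apply: mod_hom_comp => //; apply: homT_hom.
  + by apply/lker_subP => v /H; rewrite comp_lfunE => ->; rewrite linear0.
  exists (homT_mor T p \o g)%VF; split.
    by apply: mod_hom_comp => //; apply: homT_hom.
  by rewrite -comp_lfunA -e comp_lfunA E comp_lfun1l.
- move=> Z f fh; have [|h e] := Y2 Z (homT_mor T i \o f)%VF.
    by apply: mod_hom_comp => //; apply: homT_hom.
  exists (p \oc h); rewrite homT_morM -e comp_lfunA E comp_lfun1l //.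
- move=> Z f e; rewrite -[f]comp1m -pi -compA (Y3 _ (i \oc f)) ?compm0 //.
  by rewrite homT_morM e comp_lfun0r.
Qed.

Lemma pobj_osum X Y : pobj X -> pobj Y -> pobj (osum X Y).
Proof.
move=> [X1 X2 X3] [Y1 Y2 Y3]; split.
- move=> M N s f sh fh /limg_subP H.
  have [||g [gh e]] := X1 _ _ s (f \o homT_mor T (oin1 X Y))%VF sh.
  + by apply: mod_hom_comp => //; apply: homT_hom.
  + by apply/limg_subP => v; rewrite comp_lfunE; apply: H.
  have [||g' [gh' e']] := Y1 _ _ s (f \o homT_mor T (oin2 X Y))%VF sh.
  + by apply: mod_hom_comp => //; apply: homT_hom.
  + by apply/limg_subP => v; rewrite comp_lfunE; apply: H.
  have [r [rh r1 r2]] := orow_homT gh gh'.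
  by exists r; split=> //; apply: homT_osum_ext; rewrite -comp_lfunA ?r1 ?r2.
- move=> Z f fh; have [|h e] := X2 Z (f \o homT_mor T (oin1 X Y))%VF.
    by apply: mod_hom_comp => //; apply: homT_hom.
  have [|h' e'] := Y2 Z (f \o homT_mor T (oin2 X Y))%VF.
    by apply: mod_hom_comp => //; apply: homT_hom.
  exists (orow h h'); apply: homT_osum_ext;
    rewrite -homT_morM ?orow_in1 ?orow_in2 //.
- move=> Z f e; apply: osum_ext; rewrite comp0m; [apply: X3 | apply: Y3];
  by rewrite homT_morM e comp_lfun0l.
Qed.

Lemma iobj_osum X Y : iobj X -> iobj Y -> iobj (osum X Y).
Proof.
move=> [X1 X2 X3] [Y1 Y2 Y3]; split.
- move=> M N s f sh fh /lker_subP H.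
  have [||g [gh e]] := X1 _ _ s (homT_mor T (opr1 X Y) \o f)%VF sh.
  + by apply: mod_hom_comp => //; apply: homT_hom.
  + by apply/lker_subP => v /H; rewrite comp_lfunE => ->; rewrite linear0.
  have [||g' [gh' e']] := Y1 _ _ s (homT_mor T (opr2 X Y) \o f)%VF sh.
  + by apply: mod_hom_comp => //; apply: homT_hom.
  + by apply/lker_subP => v /H; rewrite comp_lfunE => ->; rewrite linear0.
  have [r [rh r1 r2]] := ocol_homT gh gh'.
  by exists r; split=> //; apply: homT_osum_coext; rewrite comp_lfunA ?r1 ?r2.
- move=> Z f fh; have [|h e] := X2 Z (homT_mor T (opr1 X Y) \o f)%VF.
    by apply: mod_hom_comp => //; apply: homT_hom.
  have [|h' e'] := Y2 Z (homT_mor T (opr2 X Y) \o f)%VF.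
    by apply: mod_hom_comp => //; apply: homT_hom.
  exists (ocol h h'); apply: homT_osum_coext;
    rewrite -homT_morM ?opr1_ocol ?opr2_ocol //.
- move=> Z f e; apply: osum_coext; rewrite compm0; [apply: X3 | apply: Y3];
  by rewrite homT_morM e comp_lfun0r.
Qed.

Lemma homT_zero (X : C) (u : mor T X) : idm X = 0 -> u = 0.
Proof. exact: mor_to0. Qed.

Lemma pobj0 (X : C) : idm X = 0 -> pobj X.
Proof.
move=> X0; have E (V : vectType k) (f g : 'Hom(homT T X, V)) : f = g.
  by apply/lfunP => u; rewrite (homT_zero u X0) !linear0.
split.
- by move=> M N s f _ _ _; exists 0; split; [exact: mod_hom0 | exact: E].
- by move=> Y p _; exists 0; apply: E.
- by move=> Y f _; apply: mor_from0.
Qed.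

Lemma iobj0 (X : C) : idm X = 0 -> iobj X.
Proof.
move=> X0; have E (V : vectType k) (f g : 'Hom(V, homT T X)) : f = g.
  by apply/lfunP => u; rewrite (homT_zero (f u) X0) (homT_zero (g u) X0).
split.
- by move=> M N s f _ _ _; exists 0; split; [exact: mod_hom0 | exact: E].
- by move=> Y p _; exists 0; apply: E.
- by move=> Y f _; apply: mor_to0.
Qed.

Definition act M (m : M) : 'Hom(homT T T, M)
  := linfun (fun u : mor T T => ract m u).

Lemma actE M (m : M) (u : mor T T) : act m u = ract m u.
Proof. exact: (linfunE (ract_linearr m)). Qed.

Lemma act_hom M (m : M) : mod_hom (act m).
Proof. by move=> u a; rewrite !actE /= ractM. Qed.

Lemma pobjT : pobj T.
Proof.
have E M (f : 'Hom(homT T T, M)) : mod_hom f -> f = act (f (idm T)).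
  by move=> fh; apply/lfunP => u; rewrite actE -fh /= comp1m.
split.
- move=> M N s f sh fh /limg_subP/(_ (idm T))[m e]; exists (act m).
  split; first exact: act_hom.
  by apply/lfunP => u; rewrite comp_lfunE actE sh -e -actE -E.
- by move=> Y p ph; exists (p (idm T)); apply/lfunP => u;
    rewrite homTE {1}(E _ _ ph) actE.
- by move=> Y f /homT_eq0P/(_ (idm T)); rewrite compm1.
Qed.

Lemma pobj_add X : in_add T X -> pobj X.
Proof.
apply: in_add_ind; [exact: pobj_retract | | exact: pobjT | exact: pobj_osum].
exact: pobj0 (ozeroP _).
Qed.

Definition submod M (U : {vspace M}) := forall x a, x \in U -> ract x a \in U.

Lemma submod_limg M N (f : 'Hom(M, N)) : mod_hom f -> submod (limg f).
Proof. by move=> fh x a /limgP[v ->]; apply/limgP; exists (ract v a). Qed.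
Lemma submod_lker M N (f : 'Hom(M, N)) : mod_hom f -> submod (lker f).
Proof. by move=> fh x a /lkerP e; apply/lkerP; rewrite fh e ract0l. Qed.
Lemma submod_full M : submod (fullv : {vspace M}).
Proof. by move=> x a _; apply: memvf. Qed.
Lemma submod0 M : submod (0%VS : {vspace M}).
Proof. by move=> x a; rewrite !memv0 => /eqP ->; rewrite ract0l. Qed.

(** One copy of T for each vector of a basis of U, mapped by [act]. *)
Lemma cover_ex M (U : {vspace M}) : submod U ->
  exists m (q : 'Hom(homT T (iter m (osum T) ozero), M)),
    mod_hom q /\ limg q = U.
Proof.
move=> Us.
have H (s : seq M) : {subset s <= U} ->
  exists m (q : 'Hom(homT T (iter m (osum T) ozero), M)),
    [/\ mod_hom q, (limg q <= U)%VS & forall x, x \in s -> x \in limg q].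
  elim: s => [|x s IH] sU.
    exists 0%N, 0; split=> //; first exact: mod_hom0.
    by apply/subvP => v /limgP[w ->]; rewrite zero_lfunE mem0v.
  have [|m [q [qh /subvP qU qs]]] := IH.
    by move=> y ys; apply: sU; rewrite inE ys orbT.
  have [r [rh r1 r2]] := orow_homT (act_hom x) qh.
  have E1 u : r (oin1 _ _ \oc u) = ract x u.
    by rewrite -actE -r1 comp_lfunE homTE.
  have E2 u : r (oin2 _ _ \oc u) = q u by rewrite -r2 comp_lfunE homTE.
  exists m.+1, r; split=> //.
    apply/subvP => v /limgP[w ->]; rewrite -[w]comp1m -osum_id compDl -!compA.
    rewrite linearD /= E1 E2 memvD //.
      by apply: Us; apply: sU; rewrite inE eqxx.
    by apply: qU; apply/limgP; exists (opr2 _ _ \oc w).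
  move=> y; rewrite inE => /orP[/eqP -> | /qs/limgP[w ->]]; apply/limgP.
    by exists (oin1 _ _ \oc idm T); rewrite E1 ract1.
  by exists (oin2 _ _ \oc w); rewrite E2.
have [|m [q [qh qU qs]]] := H (vbasis U); first by move=> x; apply: vbasis_mem.
exists m, q; split=> //; apply/eqP; rewrite eqEsubv qU /=.
have /span_basis <- := vbasisP U.
by apply/span_subvP => x; apply: qs.
Qed.

Hypothesis split : split_idempotents C.

(* A cover of least dimension is essential, by Fitting's lemma. *)
Lemma min_cover M (U : {vspace M}) : submod U ->
  exists (A : C) (q : 'Hom(homT T A, M)),
    [/\ in_add T A, mod_hom q, limg q = U & essential_onto q].
Proof.
move=> Us; pose cov := {A : C & 'Hom(homT T A, M)}.
pose mk (A : C) (q : 'Hom(homT T A, M)) : cov := existT _ A q.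
pose Q (x : cov) := [/\ in_add T (projT1 x), mod_hom (projT2 x) & limg (projT2
  x) = U].
have [|[A q] [[/= Aa qh qU] qmin]] := ex_min (P := Q)
    (fun x => \dim {: homT T (projT1 x)}).
  have [m [q [qh qU]]] := cover_ex Us.
  by exists (mk _ q); split=> //; exact: in_add_iter.
exists A, q; split=> // L h hh e.
have [A1 A2 A3] := pobj_add Aa.
have [|g [gh ge]] := A1 _ _ (q \o h)%VF q (mod_hom_comp qh hh) qh.
  by rewrite e subvv.
have [phi phiE] := A2 _ (h \o g)%VF (mod_hom_comp hh gh).
have [e0 fe] := fitting_ex phi.
have qphi : (q \o homT_mor T phi)%VF = q by rewrite -phiE comp_lfunA -ge.
have qpow n : (q \o homT_mor T (cpow phi n))%VF = q.
  elim: n => [|n IH]; first by rewrite homT_mor1 comp_lfun1r.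
  by rewrite cpowS homT_morM comp_lfunA qphi.
have qe : (q \o homT_mor T e0)%VF = q.
  case: fe => n /(_ n (leqnn n)) [E _ _ _].
  by rewrite -{1}(qpow n) -comp_lfunA -homT_morM E qpow.
have [Y [p [i [pi ip]]]] := split (fitting_idem fe).
(* The image Y of e0 still covers U, so by minimality its inclusion is onto under mor T -. As e0
   begins with the factor phi, and phi induces [h \o g], this makes h onto. *)
have QY : Q (mk Y (q \o homT_mor T i)%VF).
  split; first by apply: (@in_add_trans _ _ split _ _ A) => //; exists i, p.
    by apply: mod_hom_comp => //; apply: homT_hom.
  apply/eqP; rewrite -qU eqEsubv; apply/andP; split; apply/limg_subP => v /=.
    by exists (i \oc v); rewrite comp_lfunE homTE.
  exists (p \oc v); rewrite -{1}qe !comp_lfunE !homTE compA ip //.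
have i0 : lker (homT_mor T i) = 0%VS.
  apply/lker_eq0P => v; rewrite homTE => /(congr1 (comp p)).
  by rewrite compA pi comp1m compm0.
have ifull : limg (homT_mor T i) = fullv.
  apply/eqP; rewrite eqEdim subvf /= limg_dim_eq ?i0 ?capv0 //.
  exact: qmin QY.
case: fe => n /(_ n.+1 (leqnSn n)) [_ _ [psi E] _].
apply/limg_fullP => w; have [v ->] := (limg_fullP _).1 ifull w.
exists (g (cpow phi n \oc (psi \oc (i \oc v)))).
rewrite -comp_lfunE phiE !homTE compA -cpowS compA -E -ip -compA (compA p) pi.
by rewrite comp1m.
Qed.

Lemma min_presentation_ex M :
  exists (T1 T0 : C) (f : mor T1 T0) (q : 'Hom(homT T T0, M)),
    [/\ in_add T T1, in_add T T0 & min_proj_presentation (homT_mor T f) q].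
Proof.
have [T0 [q [T0a qh qfull qess]]] := min_cover (@submod_full M).
have [T1 [p [T1a ph pU pess]]] := min_cover (submod_lker qh).
have [_ T1f _] := pobj_add T1a.
have [f fE] := T1f _ _ ph.
exists T1, T0, f, q; split=> //; split=> //; rewrite -?fE //.
by split; apply: proj_lift_projective; [have [] := pobj_add T1a | have []
  := pobj_add T0a].
Qed.

End RightModules.

(** * Serre duality and minimal injective copresentations *)

Section SerreDuality.
Variables (k : fieldType) (C : addcat k) (S : serre_functor C) (T : C).
Implicit Types M N L : rmod T.

Lemma functional_preE (X Y Y' : C) (b : mor Y Y')
    (phi : 'Hom(mor X Y', k^o)) u :
  linfun (fun u : mor X Y => phi (b \oc u)) u = phi (b \oc u).
Proof.
have lin : linear (fun u : mor X Y => phi (b \oc u) : k^o).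
  by move=> a v w; rewrite comp_linearr linearP.
exact: (linfunE lin).
Qed.

Lemma serre_pre (X Y Y' : C) (b : mor Y Y') (phi : 'Hom(mor X Y', k^o)) :
  serre_iso S (linfun (fun u : mor X Y => phi (b \oc u))) =
  serre_iso S phi \oc b.
Proof.
have := serre_natural S (idm X) b phi.
rewrite fmor1 comp1m => <-; congr (serre_iso S _); apply/lfunP => u.
rewrite functional_preE linfunE ?compm1 // => a v w.
by rewrite !compm1 comp_linearr linearP.
Qed.

Lemma serre_iso_inj (X Y : C) : injective (@serre_iso _ _ S X Y).
Proof. exact: bij_inj (@serre_bij _ _ S X Y). Qed.

Lemma serre_iso0 (X Y : C) : serre_iso S (0 : 'Hom(mor X Y, k^o)) = 0.
Proof.
have := @serre_linear _ _ S X Y 1 0 0.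
by rewrite !scale1r addr0 => /eqP; rewrite -subr_eq addrN eq_sym => /eqP.
Qed.

(* The element of D (mor T T) = mor T (S T) attached to m by the functional
   lam on M. *)
Definition lamfun M (lam : 'Hom(M, k^o)) (m : M) : 'Hom(mor T T, k^o) :=
  linfun (fun a : mor T T => lam (ract m a)).

Lemma lamfunE M (lam : 'Hom(M, k^o)) (m : M) a :
  lamfun lam m a = lam (ract m a).
Proof.
have lin : linear (fun a : mor T T => lam (ract m a) : k^o).
  by move=> c v w; rewrite ract_linearr linearP.
exact: (linfunE lin).
Qed.

(** The isomorphism D M = Hom(M, D Gamma), with mor T (S T) in the place of D Gamma. *)
Definition colam M (lam : 'Hom(M, k^o)) : 'Hom(M, homT T (S T)) :=
  linfun (fun m => serre_iso S (lamfun lam m)).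

Lemma colamE M (lam : 'Hom(M, k^o)) m :
  colam lam m = serre_iso S (lamfun lam m).
Proof.
have lin : linear (fun m => serre_iso S (lamfun lam m) : homT T (S T)).
  move=> c v w; rewrite -(serre_linear S); congr (serre_iso S _).
  apply/lfunP => a; rewrite add_lfunE scale_lfunE !lamfunE ract_linearl.
  by rewrite linearP.
exact: (linfunE lin).
Qed.

Lemma colam_hom M (lam : 'Hom(M, k^o)) : mod_hom (colam lam).
Proof.
move=> m b; rewrite !colamE /= -serre_pre; congr (serre_iso S _).
by apply/lfunP => a; rewrite functional_preE !lamfunE ractM.
Qed.

Lemma colam_eq0 M (lam : 'Hom(M, k^o)) m :
  colam lam m = 0 <-> forall a, lam (ract m a) = 0.
Proof.
rewrite colamE; split=> [|H].
  rewrite -(serre_iso0 T T) => /serre_iso_inj e a.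
  by rewrite -lamfunE e zero_lfunE.
rewrite (_ : lamfun lam m = 0) ?serre_iso0 //.
by apply/lfunP => a; rewrite lamfunE H zero_lfunE.
Qed.

(** The functional is recovered by evaluating at the identity the element of D (mor T T) that
    corresponds to f m. *)
Lemma colam_ex M (f : 'Hom(M, homT T (S T))) : mod_hom f ->
  exists lam, f = colam lam.
Proof.
move=> fh; have [sinv sK Ks] := @serre_bij _ _ S T T.
have slin : linear (fun m : M => sinv (f m) (idm T) : k^o).
  move=> c v w; rewrite linearP.
  suff -> : sinv (c *: f v + f w) = c *: sinv (f v) + sinv (f w).
    by rewrite add_lfunE scale_lfunE.
  by apply: (can_inj sK); rewrite Ks serre_linear !Ks.
exists (linfun (fun m : M => sinv (f m) (idm T) : k^o)).
apply/lfunP => m; rewrite colamE -[LHS]Ks; congr (serre_iso S _).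
apply/lfunP => a; rewrite lamfunE (linfunE slin) fh /=.
have -> : sinv (f m \oc a) = linfun (fun u : mor T T => sinv (f m) (a \oc u) :
  k^o).
  by apply: (can_inj sK); rewrite Ks serre_pre Ks.
by rewrite functional_preE compm1.
Qed.

(** Through [colam], extending a module map into mor T (S T) amounts to extending a linear
    functional. *)
Lemma iobjST : iobj T (S T).
Proof.
split.
- move=> M L u f uh fh /lker_subP H; have [lam fE] := colam_ex fh.
  have [|mu muE] := lfun_factor (u := u) (f := lam).
    apply/lker_subP => v /H; rewrite fE => /colam_eq0/(_ (idm T)).
    by rewrite ract1.
  exists (colam mu); split; first exact: colam_hom.
  rewrite fE; apply/lfunP => v; rewrite comp_lfunE !colamE.
  congr (serre_iso S _); apply/lfunP => a; rewrite !lamfunE -uh.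
  by rewrite muE comp_lfunE.
- move=> Y p ph; have [lam pE] := colam_ex ph.
  exists (serre_iso S (lam : 'Hom(mor T Y, k^o))).
  by apply/lfunP => w; rewrite homTE -serre_pre pE colamE.
- move=> Y f; have [sinv sK Ks] := @serre_bij _ _ S T Y.
  move=> /homT_eq0P H; rewrite -[f]Ks -(serre_iso0 T Y); congr (serre_iso S _).
  apply/lfunP => w; rewrite zero_lfunE.
  have := H w; rewrite -[f]Ks -serre_pre -(serre_iso0 T T) => /serre_iso_inj.
  move=> /lfunP/(_ (idm T)); rewrite zero_lfunE.
  by rewrite functional_preE compm1 Ks.
Qed.

Lemma iobj_add X : in_add (S T) X -> iobj T X.
Proof.
apply: in_add_ind; [exact: iobj_retract | | exact: iobjST | exact: iobj_osum].
exact: iobj0 (ozeroP _).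
Qed.

Lemma separating_functional (V : vectType k) (U : {vspace V}) (x : V) :
  x \notin U -> exists lam : 'Hom(V, k^o), lam x <> 0 /\ forall u, u \in U ->
    lam u = 0.
Proof.
move=> xU; pose y v := v - projv U v.
have y0 : y x != 0.
  by rewrite subr_eq0; apply: contra xU => /eqP ->; apply: memv_proj.
have ylin : linear y.
  by move=> c v w; rewrite /y linearP scalerBr opprD addrACA.
have [i ci] : exists i, coord (vbasis {:V}) i (y x) != 0.
  apply/existsP; apply: contraT; rewrite negb_exists => /forallP H.
  move: y0; rewrite (coord_vbasis (memvf (y x))) big1 ?eqxx // => i _.
  by have := H i; rewrite negbK => /eqP ->; rewrite scale0r.
have lin : linear (fun v => coord (vbasis {:V}) i (y v) : k^o).
  by move=> c v w; rewrite ylin linearP.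
exists (linfun (fun v => coord (vbasis {:V}) i (y v) : k^o)); split.
  by rewrite (linfunE lin); apply/eqP.
by move=> u uU; rewrite (linfunE lin) /y projv_id // subrr linear0.
Qed.

(** A vector of the kernel of p outside U is separated from U by a functional lam. Adjoining
    [colam lam] shrinks the kernel, which still contains U because U is a submodule. *)
Lemma hull_ex M (U : {vspace M}) : submod U ->
  exists m (p : 'Hom(M, homT T (iter m (osum (S T)) ozero))),
    mod_hom p /\ lker p = U.
Proof.
move=> Us; suff H n m (p : 'Hom(M, homT T (iter m (osum (S T)) ozero))) :
    mod_hom p -> (U <= lker p)%VS -> (\dim (lker p) < n)%N ->
    exists m (p : 'Hom(M, homT T (iter m (osum (S T)) ozero))),
    mod_hom p /\ lker p = U.
  apply: (H (\dim (fullv : {vspace M})).+1 0%N 0); first exact: mod_hom0.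
    by apply/subvP => u _; apply/lkerP; rewrite zero_lfunE.
  by rewrite ltnS dimvS // subvf.
elim: n m p => // n IH m p ph Up; rewrite ltnS => le.
case: (eqVneq (lker p) U) => [<- | ne]; first by exists m, p.
have [x xp xU] : exists2 x, x \in lker p & x \notin U.
  apply: NNPP => H; move/eqP: ne; apply; apply/eqP; rewrite eqEsubv Up andbT.
  by apply/subvP => x xp; apply: contraT => xU; case: H; exists x.
have [lam [lx lU]] := separating_functional xU.
have [r [rh r1 r2]] := ocol_homT (colam_hom lam) ph.
have rP v : r v = 0 -> colam lam v = 0 /\ p v = 0.
  by move=> e; rewrite -r1 -r2 !comp_lfunE e !linear0.
apply: (IH m.+1 r rh).
  apply/subvP => u uU; apply/lkerP; rewrite -[r u]comp1m -osum_id compDl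
    -!compA.
  have -> : opr1 _ _ \oc r u = 0.
    rewrite -homTE -[LHS](comp_lfunE (homT_mor T _) r) r1.
    by apply/colam_eq0 => a; apply/lU/Us.
  have -> : opr2 _ _ \oc r u = 0.
    rewrite -homTE -[LHS](comp_lfunE (homT_mor T _) r) r2.
    by have /subvP/(_ u uU)/lkerP := Up.
  by rewrite !compm0 addr0.
apply: leq_trans le.
rewrite ltn_neqAle; have sub : (lker r <= lker p)%VS.
  by apply/lker_subP => v /rP[].
rewrite dimvS // andbT; apply/eqP => e.
have /eqP E : lker r == lker p by rewrite eqEdim sub e leqnn.
have /lkerP/rP[/colam_eq0/(_ (idm T)) + _] : x \in lker r by rewrite E.
by rewrite ract1.
Qed.

Lemma serre_ess_surj (Z : C) : exists T1 : C, isomorphic Z (S T1).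
Proof.
have [G [_ [eps [epsP _]]]] := serre_equiv S.
by exists (G Z); apply: isomorphic_sym; exists (eps Z).
Qed.

Hypothesis split : split_idempotents C.

(** Dual to [min_cover]: a hull of least dimension is essential. Targets must have the form S A, so
    [mkQ] first replaces an object of add (S T) by an isomorphic one, without changing the
    dimension. *)
Lemma min_hull M (U : {vspace M}) : submod U ->
  exists (A : C) (p : 'Hom(M, homT T (S A))),
    [/\ in_add (S T) (S A), mod_hom p, lker p = U & essential_in p].
Proof.
move=> Us; pose hull := {A : C & 'Hom(M, homT T (S A))}.
pose mk (A : C) (q : 'Hom(M, homT T (S A))) : hull := existT _ A q.
pose Q (x : hull) := [/\ in_add (S T) (S (projT1 x)), mod_hom (projT2 x)
  & lker (projT2 x) = U].
have mkQ (Z : C) (p : 'Hom(M, homT T Z)) : in_add (S T) Z -> mod_hom p ->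
    lker p = U -> exists A q, Q (mk A q) /\ \dim {: homT T (S A)} = \dim {:
      homT T Z}.
  move=> Za ph pU; have [A [f [g [gf fg]]]] := serre_ess_surj Z.
  have fph := mod_hom_comp (homT_hom (T := T) f) ph.
  exists A, (homT_mor T f \o p)%VF; split; last first.
    have f0 : lker (homT_mor T f) = 0%VS.
      apply/lker_eq0P => v; rewrite homTE => /(congr1 (comp g)).
      by rewrite compA gf comp1m compm0.
    rewrite -(limg_dim_eq (f := homT_mor T f) (U := fullv)) ?f0 ?capv0 //.
    congr (\dim _); apply/esym/limg_fullP => w; exists (g \oc w).
    by rewrite homTE compA fg comp1m.
  split; first by apply: (@in_add_trans _ _ split _ _ Z) => //; exists g, f.
    exact: fph.
  apply/eqP; rewrite -pU eqEsubv; apply/andP; split; apply/lker_subP => v.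
    rewrite comp_lfunE homTE => /(congr1 (comp g)).
    by rewrite compA gf comp1m compm0.
  by rewrite comp_lfunE => ->; rewrite linear0.
have [|[A p] [[/= Aa ph pU] pmin]] := ex_min (P := Q)
    (fun x => \dim {: homT T (S (projT1 x))}).
  have [m [p [ph pU]]] := hull_ex Us.
  have [A [q [Qq _]]] := mkQ _ p (in_add_iter split (S T) m) ph pU.
  by exists (mk A q).
exists A, p; split=> // L h hh e.
have [A1 A2 A3] := iobj_add Aa.
have [|g [gh ge]] := A1 _ _ (h \o p)%VF p (mod_hom_comp hh ph) ph.
  by rewrite e subvv.
have [phi phiE] := A2 _ (g \o h)%VF (mod_hom_comp gh hh).
have [e0 fe] := fitting_ex phi.
have phip : (homT_mor T phi \o p)%VF = p by rewrite -phiE -comp_lfunA -ge.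
have powp n : (homT_mor T (cpow phi n) \o p)%VF = p.
  elim: n => [|n IH]; first by rewrite homT_mor1 comp_lfun1l.
  by rewrite cpowS homT_morM -comp_lfunA IH.
have ep : (homT_mor T e0 \o p)%VF = p.
  case: fe => n /(_ n (leqnn n)) [_ E _ _].
  by rewrite -{1}(powp n) comp_lfunA -homT_morM E powp.
have [Y [q [i [qi iq]]]] := split (fitting_idem fe).
have [] := mkQ Y (homT_mor T q \o p)%VF.
- by apply: (@in_add_trans _ _ split _ _ (S A)) => //; exists i, q.
- by apply: mod_hom_comp => //; apply: homT_hom.
- apply/eqP; rewrite -pU eqEsubv; apply/andP; split; apply/lker_subP => v.
    rewrite -{2}ep !comp_lfunE !homTE -iq -compA => ->.
    by rewrite compm0.
  by rewrite comp_lfunE => ->; rewrite linear0.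
move=> A' [q' [/pmin /= le dE]].
have i0 : lker (homT_mor T i) = 0%VS.
  apply/lker_eq0P => v; rewrite homTE => /(congr1 (comp q)).
  by rewrite compA qi comp1m compm0.
have ifull : limg (homT_mor T i) = fullv.
  by apply/eqP; rewrite eqEdim subvf /= limg_dim_eq ?i0 ?capv0 // -dE.
case: fe => n /(_ n.+1 (leqnSn n)) [_ _ _ [psi E]].
apply/lker_eq0P => w hw; have [v wE] := (limg_fullP _).1 ifull w.
have : e0 \oc w = w by rewrite wE homTE -iq -compA (compA q) qi comp1m.
move=> <-; rewrite E -addn1 cpowD {2}/cpow /= compm1 -!compA -(homTE phi w).
by rewrite -phiE comp_lfunE hw linear0 !compm0.
Qed.

Lemma min_copresentation_ex M :
  exists (T1 T0 : C) (g : mor (S T1) (S T0)) (i : 'Hom(M, homT T (S T1))),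
    [/\ in_add (S T) (S T1), in_add (S T) (S T0)
      & min_inj_copresentation i (homT_mor T g)].
Proof.
have [T1 [i [T1a ih iU iess]]] := min_hull (@submod0 _ _ _ M).
have [T0 [p [T0a ph pU pess]]] := min_hull (submod_limg ih).
have [_ T0f _] := iobj_add T0a.
have [g gE] := T0f _ _ ph.
exists T1, T0, g, i; split=> //; split=> //; rewrite -?gE //.
by split; apply: inj_ext_injective; [have [] := iobj_add T1a | have []
  := iobj_add T0a].
Qed.

End SerreDuality.

(** * Vanishing of Ext *)

Section FreeModules.
Variables (k : fieldType) (C : addcat k) (T : C).
Implicit Types M N L : rmod T.

Let n := \dim {: mor T T}.
Let gam (i : 'I_n) : mor T T := (vbasis {: mor T T})`_i.
Let crd (i : 'I_n) (a : mor T T) : k := coord (vbasis {: mor T T}) i a.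

Lemma gam_crd a : a = \sum_i crd i a *: gam i.
Proof. exact: coord_vbasis (memvf a). Qed.

Lemma crd_gam i j : crd i (gam j) = (i == j)%:R.
Proof.
by rewrite /crd /gam coord_free ?(basis_free (vbasisP _)) // eq_sym.
Qed.

Lemma crdD i a b : crd i (a + b) = crd i a + crd i b.
Proof. exact: linearD. Qed.
Lemma crdZ i c b : crd i (c *: b) = c * crd i b.
Proof. exact: linearZ. Qed.
Lemma crd_sum i (J : finType) (F : J -> mor T T) :
  crd i (\sum_j F j) = \sum_j crd i (F j).
Proof. exact: linear_sum. Qed.

Lemma comp_suml (X Y Z : C) (J : finType) (f : mor X Y) (F : J -> mor Y Z) :
  (\sum_j F j) \oc f = \sum_j F j \oc f.
Proof. exact: (linear_sum (precomp f)). Qed.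

Lemma ract_sumr M (m : M) (J : finType) (F : J -> mor T T) :
  ract m (\sum_j F j) = \sum_j ract m (F j).
Proof. by rewrite -actE linear_sum; apply: eq_bigr => j _; rewrite /= actE. Qed.
Lemma ractZr M (m : M) c a : ract m (c *: a) = c *: ract m a.
Proof. by rewrite -actE linearZ /= actE. Qed.
Lemma ractDr M (m : M) a b : ract m (a + b) = ract m a + ract m b.
Proof. by rewrite -actE linearD /= !actE. Qed.
Lemma ract_suml M (J : finType) (F : J -> M) a :
  ract (\sum_j F j) a = \sum_j ract (F j) a.
Proof.
by apply: (big_morph (fun m => ract m a)) => [x y|]; rewrite ?ractDl ?ract0l.
Qed.

(* M (x) mor T T, an element being given by its coordinates in M with respect
   to a basis of mor T T. *)
Definition fcar M : vectType k := {ffun 'I_n -> M}.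

Definition fact M (x : fcar M) (a : mor T T) : fcar M :=
  [ffun j => \sum_i crd j (gam i \oc a) *: (x : {ffun 'I_n -> M}) i].

Lemma fact_linearl M a : linear (fun x : fcar M => fact x a).
Proof.
move=> c x y; apply/ffunP => j; rewrite !ffunE scaler_sumr -big_split.
by apply: eq_bigr => i _; rewrite !ffunE scalerDr !scalerA mulrC.
Qed.

Lemma fact_linearr M x : linear (@fact M x).
Proof.
move=> c a b; apply/ffunP => j; rewrite !ffunE scaler_sumr -big_split.
by apply: eq_bigr => i _; rewrite compDr compZr crdD crdZ scalerDl scalerA.
Qed.

Lemma fact1 M (x : fcar M) : fact x (idm T) = x.
Proof.
apply/ffunP => j; rewrite ffunE (bigD1 j) //= compm1 crd_gam eqxx scale1r.
rewrite big1 ?addr0 // => i ne; rewrite compm1 crd_gam eq_sym (negbTE ne).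
by rewrite scale0r.
Qed.

Lemma factM M (x : fcar M) a b : fact x (a \oc b) = fact (fact x a) b.
Proof.
apply/ffunP => l; rewrite !ffunE.
under [RHS]eq_bigr => j _ do rewrite ffunE scaler_sumr.
rewrite exchange_big; apply: eq_bigr => i _.
under eq_bigr => j _ do rewrite scalerA.
rewrite -scaler_suml compA; congr (_ *: _).
rewrite {1}(gam_crd (gam i \oc a)) comp_suml crd_sum.
by apply: eq_bigr => j _; rewrite compZl crdZ mulrC.
Qed.

Definition free_mod M : rmod T :=
  RMod (@fact_linearl M) (@fact_linearr M) (@fact1 M) (@factM M).

(** The module map m (x) a -> h(m) a that corresponds to the linear map h. With [free_unit], which
    is m -> m (x) 1, it gives the adjunction between linear maps on M and module maps on
    [free_mod M]. *)
Definition free_map M N (h : 'Hom(M, N)) : 'Hom(free_mod M, N) :=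
  linfun (fun x : free_mod M =>
    \sum_i ract (h ((x : {ffun 'I_n -> M}) i)) (gam i)).

Lemma free_mapE M N (h : 'Hom(M, N)) x : free_map h x =
  \sum_i ract (h ((x : {ffun 'I_n -> M}) i)) (gam i).
Proof.
have lin : linear (fun x : free_mod M =>
    \sum_i ract (h ((x : {ffun 'I_n -> M}) i)) (gam i) : N).
  move=> c v w; rewrite scaler_sumr -big_split; apply: eq_bigr => i _.
  by rewrite !ffunE linearP ractDl ractZl.
exact: (linfunE lin).
Qed.

Lemma free_map_hom M N (h : 'Hom(M, N)) : mod_hom (free_map h).
Proof.
move=> x a; rewrite !free_mapE ract_suml.
under eq_bigr => j _ do rewrite /= ffunE linear_sum ract_suml.
rewrite exchange_big; apply: eq_bigr => i _.
rewrite -ractM [in RHS](gam_crd (gam i \oc a)) ract_sumr.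
by apply: eq_bigr => j _; rewrite linearZ /= ractZl ractZr.
Qed.

Lemma free_map_comp M N L (s : 'Hom(N, L)) (h : 'Hom(M, N)) : mod_hom s ->
  (s \o free_map h)%VF = free_map (s \o h)%VF.
Proof.
move=> sh; apply/lfunP => x; rewrite comp_lfunE !free_mapE linear_sum.
by apply: eq_bigr => i _; rewrite comp_lfunE /= sh.
Qed.

Definition free_unit M : 'Hom(M, free_mod M) :=
  linfun (fun m : M => [ffun j => crd j (idm T) *: m] : free_mod M).

Lemma free_unitE M m : free_unit M m = [ffun j => crd j (idm T) *: m].
Proof.
have lin : linear (fun m : M => [ffun j => crd j (idm T) *: m] : free_mod M).
  by move=> c v w; apply/ffunP => j; rewrite !ffunE scalerDr !scalerA mulrC.
exact: (linfunE lin).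
Qed.

Lemma free_map_unit M N (h : 'Hom(M, N)) m : free_map h (free_unit M m) = h m.
Proof.
rewrite free_mapE -[RHS]ract1 [in RHS](gam_crd (idm T)) ract_sumr.
by apply: eq_bigr => i _; rewrite free_unitE ffunE linearZ /= ractZl ractZr.
Qed.

Lemma free_gen M (x : free_mod M) :
  x = \sum_i ract (free_unit M ((x : {ffun 'I_n -> M}) i)) (gam i).
Proof.
apply/ffunP => j; rewrite sum_ffunE (bigD1 j) //= free_unitE !ffunE.
have E i (m : M) :
    \sum_l crd j (gam l \oc gam i) *: ([ffun j0 => crd j0 (idm T) *: m] :
      {ffun 'I_n -> M}) l = crd j (gam i) *: m.
  under eq_bigr => l _ do rewrite ffunE scalerA.
  rewrite -scaler_suml; congr (_ *: _).
  rewrite -{2}(comp1m (gam i)) [in RHS](gam_crd (idm T)) comp_suml crd_sum.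
  by apply: eq_bigr => l _; rewrite compZl crdZ mulrC.
rewrite E crd_gam eqxx scale1r big1 ?addr0 // => i ne.
by rewrite free_unitE !ffunE E crd_gam eq_sym (negbTE ne) scale0r.
Qed.

Lemma free_mapP M N (f : 'Hom(free_mod M, N)) : mod_hom f ->
  f = free_map (f \o free_unit M)%VF.
Proof.
move=> fh; apply/lfunP => x; rewrite {1}(free_gen x) linear_sum free_mapE.
by apply: eq_bigr => i _; rewrite comp_lfunE /= fh.
Qed.

Lemma free_proj_lift M : proj_lift (free_mod M).
Proof.
move=> L N s f sh fh /limg_subP H.
have [|h hE] := lfun_lift (s := s) (f := (f \o free_unit M)%VF).
  by apply/limg_subP => v; rewrite comp_lfunE; apply: H.
exists (free_map h); split; first exact: free_map_hom.
by rewrite free_map_comp // -hE -free_mapP.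
Qed.

Definition free_fun M N (b : 'Hom(M, N)) : 'Hom(free_mod M, free_mod N) :=
  free_map (free_unit N \o b)%VF.

Lemma free_funE M N (b : 'Hom(M, N)) (x : free_mod M) :
  free_fun b x = [ffun i => b ((x : {ffun 'I_n -> M}) i)].
Proof.
rewrite free_mapE [RHS](free_gen (M := N)); apply: eq_bigr => i _.
by rewrite comp_lfunE !ffunE.
Qed.

Lemma free_fun_hom M N (b : 'Hom(M, N)) : mod_hom (free_fun b).
Proof. exact: free_map_hom. Qed.

Lemma free_map_fun M N L (h : 'Hom(N, L)) (b : 'Hom(M, N)) :
  (free_map h \o free_fun b)%VF = free_map (h \o b)%VF.
Proof.
apply/lfunP => x; rewrite comp_lfunE free_funE !free_mapE.
by apply: eq_bigr => i _; rewrite ffunE comp_lfunE.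
Qed.

Lemma free_fun_inj M N (b : 'Hom(M, N)) : (forall v, b v = 0 -> v = 0) ->
  forall x, free_fun b x = 0 -> x = 0.
Proof.
move=> b0 x; rewrite free_funE => /ffunP e; apply/ffunP => i.
by have := e i; rewrite !ffunE => /b0.
Qed.

(** [free_mod] ignores the action on its argument, so exactness is checked coordinate by
    coordinate. *)
Lemma free_fun_exact M N L (b : 'Hom(M, N)) (b' : 'Hom(N, L)) :
  limg b = lker b' -> limg (free_fun b) = lker (free_fun b').
Proof.
move=> /limg_lkerP[H1 H2]; apply/limg_lkerP; split=> x.
  by rewrite !free_funE; apply/ffunP => i; rewrite !ffunE H1.
rewrite free_funE => /ffunP e.
have /fin_all_exists[y yE] i : exists y, (x : {ffun 'I_n -> N}) i = b y.
  by apply: H2; have := e i; rewrite !ffunE.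
exists ([ffun i => y i] : {ffun 'I_n -> M}); rewrite free_funE.
by apply/ffunP => i; rewrite !ffunE yE.
Qed.

Definition aug M : 'Hom(free_mod M, M) := free_map \1%VF.

Lemma aug_hom M : mod_hom (aug M).
Proof. exact: free_map_hom. Qed.
Lemma aug_unit M m : aug M (free_unit M m) = m.
Proof. by rewrite free_map_unit id_lfunE. Qed.
Lemma aug_surj M : limg (aug M) = fullv.
Proof. by apply/limg_fullP => m; exists (free_unit M m); rewrite aug_unit. Qed.
Lemma aug_nat M N (b : 'Hom(M, N)) x : mod_hom b ->
  aug N (free_fun b x) = b (aug M x).
Proof.
move=> bh; rewrite -!comp_lfunE free_map_fun free_map_comp //.
by rewrite comp_lfun1l comp_lfun1r.
Qed.

Section Kernel.
Variables (M N : rmod T) (f : 'Hom(M, N)) (fh : mod_hom f).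

Definition kact (x : subvs_of (lker f)) (a : mor T T) : subvs_of (lker f) :=
  vsproj (lker f) (ract (vsval x) a).

Lemma kactE x a : vsval (kact x a) = ract (vsval x) a.
Proof. by rewrite vsprojK //; apply: submod_lker (subvsP x). Qed.

Let vsvalP c (x y : subvs_of (lker f)) :
  vsval (c *: x + y) = c *: vsval x + vsval y.
Proof. exact: (linearP (vsval : subvs_of (lker f) -> M)). Qed.

Fact kact_linearl a : linear (fun x => kact x a).
Proof.
move=> c x y; apply: val_inj.
by rewrite /= !kactE vsvalP ractDl ractZl.
Qed.
Fact kact_linearr x : linear (kact x).
Proof.
move=> c a b; apply: val_inj.
by rewrite /= !kactE ractDr ractZr.
Qed.
Fact kact1 x : kact x (idm T) = x.
Proof. by apply: val_inj; rewrite /= kactE ract1. Qed.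
Fact kactM x a b : kact x (a \oc b) = kact (kact x a) b.
Proof. by apply: val_inj; rewrite /= !kactE ractM. Qed.

Definition kermod : rmod T :=
  @RMod k C T (subvs_of (lker f)) kact kact_linearl kact_linearr kact1 kactM.

Definition kerinc : 'Hom(kermod, M) := linfun (fun x : kermod => vsval x).

Lemma kerincE x : kerinc x = vsval x.
Proof.
have lin : linear (fun x : kermod => vsval x : M) by exact: linearP.
exact: (linfunE lin).
Qed.
Lemma kerinc_hom : mod_hom kerinc.
Proof. by move=> x a; rewrite !kerincE kactE. Qed.
Lemma kerinc_inj x : kerinc x = 0 -> x = 0.
Proof. by rewrite kerincE => e; apply: val_inj; rewrite /= e. Qed.
Lemma kerinc0 x : f (kerinc x) = 0.
Proof. by rewrite kerincE; apply/lkerP/subvsP. Qed.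
Lemma kerinc_img v : f v = 0 -> exists x, v = kerinc x.
Proof.
by move=> /lkerP e; exists (vsproj (lker f) v); rewrite kerincE vsprojK.
Qed.
End Kernel.

Definition omega M : rmod T := kermod (@aug_hom M).
Definition oinc M : 'Hom(omega M, free_mod M) := kerinc (@aug_hom M).

Lemma oinc_hom M : mod_hom (oinc M). Proof. exact: kerinc_hom. Qed.

Lemma aug_oinc M x : aug M (oinc M x) = 0. Proof. exact: kerinc0. Qed.

Lemma oinc_inj M x : oinc M x = 0 -> x = 0. Proof. exact: kerinc_inj. Qed.

(** The linear pseudo-inverse of [oinc N] is harmless: naturality of [aug] sends the kernel of
    [aug M] into that of [aug N]. *)
Definition omega_fun M N (b : 'Hom(M, N)) : 'Hom(omega M, omega N) :=
  ((oinc N)^-1 \o free_fun b \o oinc M)%VF.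

Lemma oinc_fun M N (b : 'Hom(M, N)) x : mod_hom b ->
  oinc N (omega_fun b x) = free_fun b (oinc M x).
Proof.
move=> bh; rewrite !comp_lfunE limg_lfunVK //; apply/limgP/kerinc_img.
by rewrite aug_nat // kerinc0 linear0.
Qed.

Lemma omega_fun_hom M N (b : 'Hom(M, N)) : mod_hom b -> mod_hom (omega_fun b).
Proof.
move=> bh x a; apply/eqP; rewrite -subr_eq0; apply/eqP.
apply: kerinc_inj; rewrite -/(oinc N) linearB /=.
by rewrite oinc_hom !oinc_fun // oinc_hom free_fun_hom subrr.
Qed.

(* Ext^1(M, N) = 0, computed from 0 -> omega M -> free_mod M -> M -> 0 *)
Definition vext M N := forall g : 'Hom(omega M, N), mod_hom g ->
  exists h : 'Hom(free_mod M, N), mod_hom h /\ g = (h \o oinc M)%VF.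

Definition free_d M i : 'Hom(free_mod (iter i.+1 omega M), free_mod (iter i
  omega M)) :=
  (oinc (iter i omega M) \o aug (omega (iter i omega M)))%VF.

Lemma oinc_exact M : limg (oinc M) = lker (aug M).
Proof. by apply/limg_lkerP; split; [exact: kerinc0 | exact: kerinc_img]. Qed.

Lemma limg_compr (U V W : vectType k) (f : 'Hom(V, W)) (g : 'Hom(U, V)) :
  limg g = fullv -> limg (f \o g)%VF = limg f.
Proof. by move=> e; rewrite limg_comp e. Qed.

Lemma free_d_hom M i : mod_hom (free_d M i).
Proof. exact: mod_hom_comp (@oinc_hom _) (@aug_hom _). Qed.

Lemma free_d_img M i : limg (free_d M i) = limg (oinc (iter i omega M)).
Proof. exact: limg_compr (@aug_surj _). Qed.

(** Kept transparent, since its terms and differentials have to reduce when a statement on Ext is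
    instantiated with it. *)
Definition free_resolution M : proj_resolution M.
Proof.
apply: (@ProjResolution _ _ _ M (fun i => free_mod (iter i omega M)) (free_d M)
  (aug M)).
- by move=> i; apply: proj_lift_projective; apply: free_proj_lift.
- exact: free_d_hom.
- exact: aug_hom.
- move=> i; rewrite free_d_img oinc_exact; apply/eqP; rewrite eqEsubv.
  apply/andP; split; apply/lker_subP => v; rewrite comp_lfunE.
    by move=> ->; rewrite linear0.
  exact: kerinc_inj.
- by rewrite free_d_img oinc_exact.
- exact: aug_surj.
Defined.

(** A map on the (i+1)-st syzygy becomes a cocycle after composition with [aug]; evaluating on
    [free_unit] undoes that composition. *)
Lemma ext_zero_vext i M N : ext_zero i.+1 M N -> vext (iter i omega M) N.
Proof.
move=> /(_ (free_resolution M)) /= H g gh.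
have [||h [hh e]] := H (g \o aug _)%VF.
- exact: mod_hom_comp gh (@aug_hom _).
- apply/lfunP => x; rewrite !comp_lfunE zero_lfunE.
  exact: etrans (congr1 g (@aug_oinc (iter i.+1 omega M) _)) (linear0 g).
exists h; split=> //; apply/lfunP => x.
have := congr1 (fun f : 'Hom(_, _) => f (free_unit _ x)) e.
by rewrite /= !comp_lfunE aug_unit.
Qed.

(** B is the pushout of L and [free_mod M] along [omega M]: a linear section tau of sig gives
    [free_map tau] over M, and this restricts to kap : omega M -> L. Ext^1 = 0 extends [v \o kap] to
    h on [free_mod M], and h and v glue. *)
Lemma vext_extend (L B M N : rmod T) (iota : 'Hom(L, B)) (sig : 'Hom(B, M))
  (v : 'Hom(L, N)) :
  mod_hom iota -> mod_hom sig -> mod_hom v -> lker iota = 0%VS ->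
  limg iota = lker sig -> limg sig = fullv -> vext M N ->
  exists w : 'Hom(B, N), mod_hom w /\ v = (w \o iota)%VF.
Proof.
move=> ih sh vh i0 /limg_lkerP[si is_] ss ve.
have [|tau tE] := lfun_lift (s := sig) (f := \1%VF).
  by rewrite ss subvf.
have Et x : sig (free_map tau x) = aug M x.
  by rewrite -comp_lfunE free_map_comp // -tE.
have [||kap [kh kE]] := mod_lift ih i0 (f := (free_map tau \o oinc M)%VF).
- exact: mod_hom_comp (@free_map_hom _ _ _) (@oinc_hom _).
- by move=> x; apply: is_; rewrite comp_lfunE Et kerinc0.
have [h [hh hE]] := ve _ (mod_hom_comp vh kh).
(* Here b is split into the image of [free_unit M (sig b)] and a remainder in L. The splitting is
   only linear; [wE] shows that w is the glued map, hence a module map. *)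
pose w : 'Hom(B, N) := (h \o free_unit M \o sig)%VF +
  (v \o iota^-1 \o (\1 - (free_map tau \o free_unit M \o sig)))%VF.
have wE p l : w (free_map tau p + iota l) = h p + v l.
  pose q := free_unit M (aug M p) - p.
  have [q' q'E] : exists q', q = oinc M q'.
    by apply: kerinc_img; rewrite linearB /= aug_unit subrr.
  have sE : sig (free_map tau p + iota l) = aug M p.
    by rewrite linearD /= si addr0 Et.
  have uE : free_unit M (aug M p) = p + q by rewrite /q addrC subrK.
  rewrite add_lfunE !comp_lfunE add_lfunE opp_lfunE id_lfunE !comp_lfunE.
  rewrite sE uE.
  have -> : free_map tau p + iota l - free_map tau (p + q) = iota (l - kap q').
    rewrite (linearD (free_map tau) p q) (linearB iota) /= opprD addrACA.
    have -> : iota (kap q') = free_map tau q.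
      by rewrite q'E -(comp_lfunE iota) -kE comp_lfunE.
    by rewrite subrr add0r.
  rewrite lker0_lfunK ?i0 // (linearD h) (linearB v) /= q'E.
  have -> : h (oinc M q') = v (kap q') by rewrite -comp_lfunE -hE comp_lfunE.
  by rewrite -addrA; congr (_ + _); rewrite addrC subrK.
have bE b : exists p l, b = free_map tau p + iota l.
  have [|l lE] := is_ (b - free_map tau (free_unit M (sig b))).
    by rewrite linearB /= Et aug_unit subrr.
  by exists (free_unit M (sig b)), l; rewrite -lE addrC subrK.
exists w; split; last first.
  by apply/lfunP => l; rewrite comp_lfunE -[iota l]add0r
    -(linear0 (free_map tau)) wE linear0 add0r.
move=> b a; have [p [l ->]] := bE b.
by rewrite ractDl -ih -(free_map_hom tau) !wE ractDl hh vh.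
Qed.

(* Given an exact sequence 0 -> L -> B_0 -> ... -> B_n -> 0, the obstruction
   to extending v : L -> N to B_0 lies in Ext^1(ker (B_1 -> B_2), N).  It is
   handled by applying the exact functor Omega to B_1 -> ... -> B_n. *)
Lemma exact_extend m N L (B : nat -> rmod T) (b : forall i, 'Hom(B i, B i.+1))
    (iota : 'Hom(L, B 0)) (v : 'Hom(L, N)) :
  mod_hom iota -> (forall i, mod_hom (b i)) -> mod_hom v ->
  lker iota = 0%VS -> limg iota = lker (b 0) ->
  (forall i, (i < m)%N -> limg (b i) = lker (b i.+1)) -> b m = 0 ->
  (forall i j, (i <= m)%N -> (j < m)%N -> vext (iter j omega (B i)) N) ->
  exists w : 'Hom(B 0, N), mod_hom w /\ v = (w \o iota)%VF.
Proof.
elim: m L B b iota v => [|m IH] L B b iota v ih bh vh i0 i1 be bn ve.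
  have is_ : limg iota = fullv.
    apply/eqP; rewrite eqEsubv subvf i1 bn /=; apply/subvP => x _.
    by apply/lkerP; rewrite zero_lfunE.
  have [|w [wh ->]] := mod_factor ih is_ vh; last by exists w.
  by move=> x /((lker_eq0P _).1 i0) ->; rewrite linear0.
(* By exactness this kernel is the image of b 0, that is, the cokernel of iota. *)
pose M := kermod (bh 1%N).
have /limg_lkerP[b10 b1s] := be 0%N (ltn0Sn _).
have [||sig [sh sE]] := mod_lift (kerinc_hom (fh := bh 1%N)) _ (bh 0%N).
- by apply/lker_eq0P => x; apply: kerinc_inj.
- by move=> x; apply: kerinc_img.
have sEx x : kerinc (bh 1%N) (sig x) = b 0 x by rewrite sE comp_lfunE.
apply: (vext_extend (M := M) (sig := sig) ih sh vh i0).
- rewrite i1; apply/eqP; rewrite eqEsubv; apply/andP.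
  split; apply/lker_subP => x; last by rewrite -sEx => ->; rewrite linear0.
  by rewrite -sEx; apply: kerinc_inj.
- apply/limg_fullP => y; have [|x xE] := b1s (kerinc (bh 1%N) y);
    first exact: kerinc0.
  exists x; apply/eqP; rewrite -subr_eq0; apply/eqP.
  by apply: (kerinc_inj (fh := bh 1%N)); rewrite linearB /= sEx xE subrr.
move=> g gh.
have kh := kerinc_hom (fh := bh 1%N).
have kmono x : kerinc (bh 1%N) x = 0 -> x = 0 by apply: kerinc_inj.
have [||||||||w [wh wE]] := IH (omega M) (fun i => omega (B i.+1))
    (fun i => omega_fun (b i.+1)) (omega_fun (kerinc (bh 1%N))) g.
- exact: omega_fun_hom.
- by move=> i; apply: omega_fun_hom.
- exact: gh.
- apply/lker_eq0P => x e; apply: oinc_inj; apply: (free_fun_inj kmono).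
  by rewrite -oinc_fun // e linear0.
- apply/limg_lkerP; split=> x.
    apply: oinc_inj; rewrite !oinc_fun //.
    by rewrite !free_funE; apply/ffunP => i; rewrite !ffunE kerinc0.
  move=> e; have ke : limg (kerinc (bh 1%N)) = lker (b 1%N).
    by apply/limg_lkerP; split; [exact: kerinc0 | exact: kerinc_img].
  have [|y yE] := ((limg_lkerP _ _).1 (free_fun_exact ke)).2 (oinc _ x).
    by rewrite -oinc_fun // e linear0.
  have [|y' y'E] := kerinc_img (@aug_hom M) (v := y).
    by apply: kmono; rewrite -aug_nat // -yE aug_oinc.
  exists y'; apply/eqP; rewrite -subr_eq0; apply/eqP/oinc_inj.
  by rewrite linearB /= oinc_fun // yE y'E subrr.
- move=> i le; apply/limg_lkerP; split=> x.
    apply: oinc_inj; rewrite !oinc_fun // !free_funE; apply/ffunP => j.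
    by rewrite !ffunE; have /limg_lkerP[-> _] := be i.+1 le.
  move=> e.
  have [|y yE] := ((limg_lkerP _ _).1 (free_fun_exact (be i.+1 le))).2
    (oinc _ x).
    by rewrite -oinc_fun // e linear0.
  have [|z zE] := ((limg_lkerP _ _).1 (be i (ltnW le))).2 (aug _ y).
    by rewrite -aug_nat // -yE aug_oinc.
  (* The preimage y need not lie in omega; subtracting the image of z (x) 1 corrects this without
     changing its image under the next map. *)
  have [|y' y'E] := kerinc_img (@aug_hom _)
    (v := y - free_fun (b i) (free_unit _ z)).
    by rewrite linearB /= aug_nat // aug_unit zE subrr.
  exists y'; apply/eqP; rewrite -subr_eq0; apply/eqP/oinc_inj.
  rewrite linearB /= oinc_fun // -[oinc _ y']y'E linearB /= -yE.
  rewrite opprB addrCA subrr addr0 !free_funE; apply/ffunP => j.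
  by rewrite !ffunE; have /limg_lkerP[-> _] := be i (ltnW le).
- apply/lfunP => x; rewrite zero_lfunE; apply: oinc_inj.
  by rewrite oinc_fun // bn free_funE; apply/ffunP => j;
    rewrite !ffunE zero_lfunE.
(* One application of omega trades one map of the sequence for one degree of Ext. *)
- move=> i j le lt; rewrite -[iter j _ _]iterSr; exact: ve.
(* Now w lives on omega (B 1); Ext^1(B 1, N) = 0 extends it to the free module on B 1, whose
   restriction to the free module on M extends g. *)
have [h1 [h1h h1E]] := ve 1%N 0%N (ltn0Sn _) (ltn0Sn _) w wh.
exists (h1 \o free_fun (kerinc (bh 1%N)))%VF; split.
  exact: mod_hom_comp h1h (@free_fun_hom _ _ _).
apply/lfunP => x; rewrite wE h1E.
transitivity (h1 (oinc (B 1%N) (omega_fun (kerinc (bh 1%N)) x))).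
  by rewrite !comp_lfunE.
by rewrite (oinc_fun x kh) !comp_lfunE.
Qed.

End FreeModules.

(** * Projective resolutions, their comparison and lifting of cocycles *)

Section ProjectiveResolutions.
Variables (k : fieldType) (C : addcat k) (T : C).
Implicit Types M N L P : rmod T.

(** P is a direct summand of mor T A for a finite sum A of copies of T. *)
Lemma projective_proj_lift P : projective P -> proj_lift P.
Proof.
move=> Pp; have [m [q [qh qs]]] := cover_ex (@submod_full _ _ _ P).
have [g [gh gE]] := Pp _ _ q \1%VF qh qs (@mod_hom1 _ _ _ P).
have [A1 _ _] : pobj T (iter m (osum T) ozero : C).
  elim: m {q qh qs g gh gE} => [|m IH]; first exact: pobj0 (ozeroP _).
  exact: pobj_osum (pobjT T) IH.
move=> M N s f sh fh /limg_subP H.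
have [||h [hh hE]] := A1 _ _ s (f \o q)%VF sh.
- exact: mod_hom_comp.
- by apply/limg_subP => v; rewrite comp_lfunE.
exists (h \o g)%VF; split; first exact: mod_hom_comp.
by rewrite comp_lfunA -hE -comp_lfunA -gE comp_lfun1r.
Qed.

Lemma mod_iso_inv M N (f : 'Hom(M, N)) :
  mod_hom f -> lker f = 0%VS -> limg f = fullv ->
  exists g : 'Hom(N, M), [/\ mod_hom g, (g \o f)%VF = \1%VF & (f \o g)%VF
    = \1%VF].
Proof.
move=> fh f0 fs; have [|g [gh gE]] := mod_factor fh fs (@mod_hom1 _ _ _ M).
  by move=> v /((lker_eq0P _).1 f0) ->; rewrite linear0.
exists g; split=> //; apply/lfunP => w; have [v ->] := (limg_fullP _).1 fs w.
by rewrite -comp_lfunE -comp_lfunA -gE comp_lfun1r id_lfunE.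
Qed.

Lemma mod_isoP M N : mod_iso M N <-> exists (f : 'Hom(M, N)) (g : 'Hom(N, M)),
  [/\ mod_hom f, mod_hom g, (g \o f)%VF = \1%VF & (f \o g)%VF = \1%VF].
Proof.
split=> [[f [fh f0 fs]] | [f [g [fh gh gf fg]]]].
  by have [g [gh gf fg]] := mod_iso_inv fh f0 fs; exists f, g.
exists f; split=> //.
  apply/lker_eq0P => v e; rewrite -[v](id_lfunE) -gf comp_lfunE e linear0 //.
by apply/limg_fullP => w; exists (g w); rewrite -comp_lfunE fg id_lfunE.
Qed.

Lemma ext_zero_isor i M N N' : mod_iso N N' -> ext_zero i M N' ->
  ext_zero i M N.
Proof.
move=> /mod_isoP[f [g [fh gh gf fg]]] H P.
have E (P' : rmod T) (u : 'Hom(P', N)) : u = (g \o (f \o u))%VF.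
  by rewrite comp_lfunA gf comp_lfun1l.
case: i H => [|i] /(_ P) H u uh ud.
  rewrite (E _ u) (H (f \o u)%VF) ?comp_lfun0r //; first exact: mod_hom_comp.
  by rewrite -comp_lfunA ud comp_lfun0r.
have [||w [wh wE]] := H (f \o u)%VF.
- exact: mod_hom_comp.
- by rewrite -comp_lfunA ud comp_lfun0r.
exists (g \o w)%VF; split; first exact: mod_hom_comp.
by rewrite -comp_lfunA -wE -E.
Qed.

(** A resolution of M becomes one of M' by composing its augmentation with the isomorphism. *)
Lemma ext_zero_isol i M M' N : mod_iso M M' -> ext_zero i M' N ->
  ext_zero i M N.
Proof.
move=> /mod_isoP[f [g [fh gh gf fg]]] H P.
have inj x : f x = 0 -> x = 0.
  by move=> e; rewrite -[x]id_lfunE -gf comp_lfunE e linear0.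
have e0 : limg (pr_d P 0) = lker (f \o pr_aug P)%VF.
  rewrite pr_exact0; apply/eqP; rewrite eqEsubv; apply/andP.
  split; apply/lker_subP => v; rewrite comp_lfunE; last exact: inj.
  by move=> ->; rewrite linear0.
have es : limg (f \o pr_aug P)%VF = fullv.
  apply/limg_fullP => w; have [p pE] := (limg_fullP _).1 (pr_aug_surj P) (g w).
  by exists p; rewrite comp_lfunE -pE -comp_lfunE fg id_lfunE.
by case: i H => [|i] H; exact (H (ProjResolution (@pr_proj _ _ _ _ P)
  (@pr_d_hom _ _ _ _ P) (mod_hom_comp fh (pr_aug_hom (p := P))) (pr_exact P) e0
    es)).
Qed.

(* One step of the comparison of the resolution P3 -> P2 -> P1 -> P0 with the
   exact complex B -> A -> A0 of projectives: al and be are the components of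
   the chain maps, s that of a homotopy from be al to the identity. *)
Definition comparison (P2 P1 P0 A A0 : rmod T) (d2 : 'Hom(P2, P1))
    (d1 : 'Hom(P1, P0)) (f : 'Hom(A, A0)) (al : 'Hom(P1, A)) (be : 'Hom(A, P1))
    (s : 'Hom(P1, P2)) :=
  [/\ [/\ mod_hom al, mod_hom be & mod_hom s],
      forall x, f (al (d2 x)) = 0, forall y, f y = 0 -> d1 (be y) = 0
    & forall x, d2 x = be (al (d2 x)) + d2 (s (d2 x))].

Lemma comparison_step (P3 P2 P1 P0 B A A0 : rmod T) (d3 : 'Hom(P3, P2))
    (d2 : 'Hom(P2, P1)) (d1 : 'Hom(P1, P0)) (g : 'Hom(B, A)) (f : 'Hom(A, A0))
    (al : 'Hom(P1, A)) (be : 'Hom(A, P1)) (s : 'Hom(P1, P2)) :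
  mod_hom d3 -> mod_hom d2 -> mod_hom g -> limg d3 = lker d2 ->
  limg d2 = lker d1 -> proj_lift P2 -> proj_lift B ->
  (forall x, f (g x) = 0) -> (forall x, f x = 0 -> exists y, x = g y) ->
  comparison d2 d1 f al be s ->
  exists al1 be1 s1, [/\ comparison d3 d2 g al1 be1 s1,
    forall x, g (al1 x) = al (d2 x), forall x, d2 (be1 x) = be (g x)
    & forall x, x = be1 (al1 x) + d3 (s1 x) + s (d2 x)].
Proof.
move=> d3h d2h gh /limg_lkerP[d23 ex2] /limg_lkerP[d12 ex1] P2p Bp fg exg.
move=> [[alh beh sh] cA cB cC].
have [||al1 [al1h al1E]] := P2p _ _ g (al \o d2)%VF gh.
- exact: mod_hom_comp.
- by apply/limg_subP => x; rewrite comp_lfunE; apply: exg.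
have {}al1E x : g (al1 x) = al (d2 x) by rewrite -!comp_lfunE al1E.
have [||be1 [be1h be1E]] := Bp _ _ d2 (be \o g)%VF d2h.
- exact: mod_hom_comp.
- by apply/limg_subP => x; rewrite comp_lfunE; apply/ex1/cB/fg.
have {}be1E x : d2 (be1 x) = be (g x) by rewrite -!comp_lfunE be1E.
(* The homotopy identity of the previous degree puts the image of h into the kernel of d2, so h
   lifts along d3; the lift is the next homotopy. *)
pose h := (\1 - (be1 \o al1) - (s \o d2))%VF : 'Hom(P2, P2).
have hE x : h x = x - be1 (al1 x) - s (d2 x).
  by rewrite !(add_lfunE, opp_lfunE, comp_lfunE, id_lfunE).
have [||s1 [s1h s1E]] := P2p _ _ d3 h d3h.
- apply: mod_hom_sub; last exact: mod_hom_comp.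
  by apply: mod_hom_sub; [exact: mod_hom1 | exact: mod_hom_comp].
- apply/limg_subP => x; apply: ex2; rewrite hE !linearB /= be1E al1E.
  by rewrite -addrA -opprD -cC subrr.
have {}s1E x : x = be1 (al1 x) + d3 (s1 x) + s (d2 x).
  by rewrite -(comp_lfunE d3) -s1E hE -addrA subrK addrC subrK.
exists al1, be1, s1; split=> //; split=> //.
- by move=> x; rewrite al1E d23 linear0.
- by move=> y e; rewrite be1E e linear0.
- by move=> x; rewrite {1}(s1E (d3 x)) d23 linear0 addr0.
Qed.

Definition rpair (X Y Z : C) (f : mor X Y) (g : mor Y Z) :=
  [/\ g \oc f = 0, forall u : mor T Y, g \oc u = 0 -> exists v, u = f \oc v
    & forall W (w : mor Y W), w \oc f = 0 -> exists v, w = v \oc g].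

(* Chains whose image under mor T - is the beginning of a projective
   resolution and which stay exact under mor - W, except at the left end. *)
Fixpoint resol m (X : C) : forall Q : C, chain m Q X -> Prop :=
  match m return forall Q : C, chain m Q X -> Prop with
  | 0 => fun Q u => pobj T Q /\ forall w : mor T X, exists v, w = u \oc v
  | m'.+1 => fun Q c => [/\ pobj T Q,
      rpair (projT2 c).1 (projT2 (chd (projT2 c).2)) & resol (projT2 c).2]
  end.

Section Comparison.
Variables (X : C) (P : proj_resolution (homT T X)).

(** The resolution augmented by mor T X in position 0, so that the augmentation is treated as a
    differential. *)
Let Pp i : rmod T := if i is j.+1 then P j else homT T X.
Let dd i : 'Hom(Pp i.+1, Pp i) :=
  match i return 'Hom(Pp i.+1, Pp i) with
  | 0 => pr_aug P
  | j.+1 => pr_d P j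
  end.

Let dd_hom i : mod_hom (dd i).
Proof. by case: i => [|i]; [exact: pr_aug_hom | exact: pr_d_hom]. Qed.

Let dd_exact i : limg (dd i.+1) = lker (dd i).
Proof. by case: i => [|i]; [exact: pr_exact0 | exact: pr_exact]. Qed.

Let Pp_lift i : proj_lift (Pp i.+1).
Proof. exact: projective_proj_lift (pr_proj (p := P) (i := i)). Qed.

Lemma resol_comparison m (Q : C) (c : chain m Q X) : resol c ->
  exists al be s,
    comparison (dd m.+1) (dd m) (homT_mor T (projT2 (chd c))) al be s.
Proof.
elim: m Q c => [|m IH] Q c /=.
  move=> [[Q1 _ _] us].
  (* The comparison starts at mor T X itself: identities for the two chain maps, zero maps to the
     right and a zero homotopy. *)
  have c0 : comparison (P2 := Pp 1) (P1 := homT T X) (P0 := homT T X)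
    (A := homT T X) (A0 := homT T X)
      (pr_aug P) 0 0 \1%VF \1%VF 0.
    split; first by split; [exact: mod_hom1 | exact: mod_hom1 |
      exact: mod_hom0].
    - by move=> x; rewrite zero_lfunE.
    - by move=> x _; rewrite zero_lfunE.
    - by move=> x; rewrite !id_lfunE zero_lfunE linear0 addr0.
  have [|||||||||al [be [s [H _ _ _]]]] := comparison_step (d3 := dd 1)
    (g := homT_mor T c) _ _ _ _ _ _ _ _ _ c0.
  - exact: dd_hom.
  - exact: pr_aug_hom.
  - exact: homT_hom.
  - exact: (dd_exact 0).
  - apply/limg_lkerP; split=> x; first by rewrite zero_lfunE.
    by move=> _; apply: (limg_fullP _).1 (pr_aug_surj P) x.
  - exact: (@Pp_lift 0).
  - exact: Q1.
  - by move=> x; rewrite zero_lfunE.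
  - by move=> x _; have [v ->] := us x; exists v; rewrite homTE.
  by exists al, be, s.
move=> [[Q1 _ _] [fg ex _] /IH[al [be [s H]]]].
have [|||||||||al1 [be1 [s1 [H1 _ _ _]]]] := comparison_step (d3 := dd m.+2)
  (g := homT_mor T (projT2 c).1) _ _ _ _ _ _ _ _ _ H.
- exact: dd_hom.
- exact: dd_hom.
- exact: homT_hom.
- exact: dd_exact.
- exact: dd_exact.
- exact: Pp_lift.
- exact: Q1.
- by move=> x; rewrite !homTE compA fg comp0m.
- by move=> x; rewrite homTE => /ex[v ->]; exists v; rewrite homTE.
by exists al1, be1, s1.
Qed.

(** A cocycle phi gives a morphism y inducing [phi \o be]. It kills the morphism one place further
    left, so it factors through the weak cokernel as z; the homotopy then exhibits phi as the
    coboundary of z al' + phi s'. The extra place on the left is why the chain has length m.+2. *)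
Lemma resol_ext_step m (Q1 : C) (c : chain m.+2 Q1 X) (Y : C) : resol c ->
  forall f : 'Hom(P m.+1, homT T Y), mod_hom f -> (f \o pr_d P m.+1)%VF = 0 ->
  exists g : 'Hom(P m, homT T Y), mod_hom g /\ f = (g \o pr_d P m)%VF.
Proof.
move=> /= [[Q1l _ Q1f] [fg ex cok] [[Ql Qf _] [fg' ex' cok'] rc]] phi phih phid.
have [al' [be' [s' H']]] := resol_comparison rc.
have [|||||||||al [be [s [H alE _ sE]]]] := comparison_step (d3 := dd m.+2)
    (g := homT_mor T (projT2 (projT2 c).2).1) _ _ _ _ _ _ _ _ _ H'.
- exact: dd_hom.
- exact: dd_hom.
- exact: homT_hom.
- exact: dd_exact.
- exact: dd_exact.
- exact: Pp_lift.
- exact: Ql.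
- by move=> x; rewrite !homTE compA fg' comp0m.
- by move=> x; rewrite homTE => /ex'[v ->]; exists v; rewrite homTE.
have [|||||||||al1 [be1 [s1 [_ _ be1E _]]]] := comparison_step (d3 := dd m.+3)
    (g := homT_mor T (projT2 c).1) _ _ _ _ _ _ _ _ _ H.
- exact: dd_hom.
- exact: dd_hom.
- exact: homT_hom.
- exact: dd_exact.
- exact: dd_exact.
- exact: Pp_lift.
- exact: Q1l.
- by move=> x; rewrite !homTE compA fg comp0m.
- by move=> x; rewrite homTE => /ex[v ->]; exists v; rewrite homTE.
case: H => [[alh beh sh] _ _ _]; case: H' => [[alh' beh' sh'] _ _ _].
have phid0 x : phi (dd m.+2 x) = 0 by rewrite -comp_lfunE phid zero_lfunE.
have [y yE] := Qf _ _ (mod_hom_comp phih beh).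
have y0 : y \oc (projT2 c).1 = 0.
  apply: Q1f; apply/lfunP => u; rewrite zero_lfunE homTE -compA -(homTE _ u).
  by rewrite -(homTE y) -yE comp_lfunE -be1E phid0.
have [z zE] := cok _ _ y0.
exists ((homT_mor T z \o al') + (phi \o s'))%VF; split.
  apply: mod_hom_add; apply: mod_hom_comp => //; exact: homT_hom.
apply/lfunP => x; rewrite {1}(sE x) !linearD /= phid0 addr0.
rewrite comp_lfunE add_lfunE !comp_lfunE; congr (_ + _).
by rewrite -(comp_lfunE phi) yE zE homT_morM comp_lfunE alE.
Qed.

End Comparison.

Lemma resol_ext_zero m (Q X Y : C) (c : chain m.+1 Q X) i : resol c ->
  (0 < i <= m)%N -> ext_zero i (homT T X) (homT T Y).
Proof.
case: i => // i; elim: m Q c => [|m IH] Q c rc /=; first by rewrite ltn0.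
rewrite ltnS leq_eqVlt => /orP[/eqP E | lt]; last first.
  by case: rc => _ _ /IH; apply.
by move=> P; rewrite E; apply: resol_ext_step rc.
Qed.

(** Dimension shifting along B: a lift g of f to B m exists by projectivity, and its failure to be a
    cocycle is itself a cocycle one degree higher, with values one place further left. It is lifted
    by induction and is a coboundary there because Ext vanishes. *)
Lemma cocycle_lift N (P : proj_resolution N) m (B : nat -> rmod T)
    (b : forall i, 'Hom(B i, B i.+1)) : (forall i, mod_hom (b i)) ->
  lker (b 0) = 0%VS -> (forall i, (i < m)%N -> limg (b i) = lker (b i.+1)) ->
  forall i, (forall j l, (l < m)%N -> (i < j <= i + m)%N -> ext_zero j N (B l)) ->
  forall f : 'Hom(P i, B m.+1), mod_hom f -> (f \o pr_d P i)%VF = 0 ->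
    (limg f <= limg (b m))%VS ->
  exists g : 'Hom(P i, B m), [/\ mod_hom g, (g \o pr_d P i)%VF = 0
    & f = (b m \o g)%VF].
Proof.
move=> bh b0; elim: m => [|m IH] be i ez f fh fd fb;
  have Pl := projective_proj_lift (pr_proj (p := P) (i := i));
  have [g [gh gE]] := Pl _ _ _ _ (bh _) fh fb.
  exists g; split=> //; apply/lfunP => x; rewrite zero_lfunE.
  apply: (lker_eq0P _).1 b0 _ _.
  by rewrite -comp_lfunE comp_lfunA -gE fd zero_lfunE.
have [|||||f2 [f2h f2d f2E]] := IH _ i.+1 _ (g \o pr_d P i)%VF.
- by move=> j lt; apply: be; apply: ltnW.
- move=> j l lt /andP[h1 h2]; apply: ez; first exact: ltnW.
  by rewrite (ltnW h1) addnS -addSn.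
- exact: mod_hom_comp gh (pr_d_hom (p := P) (i := i)).
- rewrite -comp_lfunA (_ : (pr_d P i \o pr_d P i.+1)%VF = 0) ?comp_lfun0r //.
  apply/lfunP => x; rewrite comp_lfunE zero_lfunE.
  by have /limg_lkerP[-> _] := pr_exact P i.
- rewrite (be m (leqnn _)); apply/subvP => y /limgP[x ->]; apply/lkerP.
  by rewrite -comp_lfunE comp_lfunA -gE fd zero_lfunE.
have [|||h [hh hE]] := ez i.+1 m (leqnn _) _ P f2.
- by rewrite leqnn addnS ltnS leq_addr.
- exact: f2h.
- exact: f2d.
(* Subtracting the coboundary witness kills the obstruction, and does not change the image in the
   next term because consecutive maps of B compose to zero. *)
exists (g - (b m \o h))%VF; split.
- by apply: mod_hom_sub => //; apply: mod_hom_comp.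
- apply/lfunP => x; rewrite comp_lfunE add_lfunE opp_lfunE comp_lfunE
    zero_lfunE.
  by rewrite -(comp_lfunE g) f2E hE !comp_lfunE subrr.
- apply/lfunP => x; rewrite comp_lfunE add_lfunE opp_lfunE comp_lfunE linearB
    /=.
  have /limg_lkerP[-> _] := be m (leqnn _).
  by rewrite subr0 gE comp_lfunE.
Qed.

End ProjectiveResolutions.

(** * The essential image of mor T - *)

Section ExactFamilies.
Variables (k : fieldType) (C : addcat k) (T : C).
Implicit Types M N L : rmod T.
Variables (X : nat -> C) (a : forall i, mor (X i) (X i.+1)).
Hypothesis ex : forall i, limg (homT_mor T (a i)) = lker (homT_mor T (a i.+1)).

Definition mod_retract M N := exists (i : 'Hom(M, N)) (p : 'Hom(N, M)),
  [/\ mod_hom i, mod_hom p & (p \o i)%VF = \1%VF].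

Lemma mod_retract0 M : (forall m : M, m = 0) -> mod_retract M (homT T ozero).
Proof.
move=> M0; exists 0, 0; split; [exact: mod_hom0 | exact: mod_hom0 |].
by apply/lfunP => m; rewrite [RHS]M0 [LHS]M0.
Qed.

(** M is the cokernel of a 0 and embeds into mor T (X 2). The killed morphism ends the exact
    sequence to the right of M, and [exact_extend] applied to the identity of M gives a retraction.
    For j = 0 the map a 0 is onto and M = 0. *)
Lemma left_summand M (sig : 'Hom(homT T (X 1), M)) j :
  mod_hom sig -> limg sig = fullv -> limg (homT_mor T (a 0)) = lker sig ->
  (forall i Y, (0 < i < j)%N -> ext_zero i (homT T Y) M) ->
  homT_mor T (a j.+1) = 0 -> exists Y, mod_retract M (homT T Y).
Proof.
move=> sh ss si ez aj; case: j ez aj => [|j] ez aj.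
  exists ozero; apply: mod_retract0 => m; have [v ->] := (limg_fullP _).1 ss m.
  apply/lkerP; rewrite -si ex; apply/lkerP.
  by rewrite aj zero_lfunE.
exists (X 2).
have [|iota [ih iE]] := mod_factor sh ss (homT_hom (T := T) (a 1)).
  by move=> v /lkerP; rewrite -si ex => /lkerP.
have iEx v : iota (sig v) = homT_mor T (a 1) v by rewrite iE comp_lfunE.
have [||||||||w [wh wE]] := exact_extend (m := j) (L := M)
    (B := fun i => homT T (X i.+2)) (b := fun i => homT_mor T (a i.+2))
    (iota := iota) (v := \1%VF).
- exact: ih.
- by move=> i; apply: homT_hom.
- exact: mod_hom1.
- apply/lker_eq0P => m; have [v ->] := (limg_fullP _).1 ss m.
  by rewrite iEx => /lkerP; rewrite -ex si => /lkerP.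
- rewrite -ex; apply/eqP; rewrite eqEsubv; apply/andP; split;
    apply/limg_subP => v.
    by have [u ->] := (limg_fullP _).1 ss v; exists u; rewrite iEx.
  by exists (sig v); rewrite iEx.
- by move=> i _; apply: ex.
- exact: aj.
- move=> i l _ lt; apply: ext_zero_vext; apply: ez.
  by rewrite ltn0Sn ltnS.
by exists iota, w.
Qed.

(** N is the image of a n, and the killed morphism makes the sequence X j.+1 -> ... -> X n -> N
    exact with 0 on the left. [cocycle_lift] in degree 0 lifts iota along a n to a cocycle, which
    descends to a section of X n -> N. *)
Lemma right_summand N n j (iota : 'Hom(N, homT T (X n.+1))) :
  (j <= n)%N -> mod_hom iota -> lker iota = 0%VS ->
  limg iota = limg (homT_mor T (a n)) ->
  (forall i Y, (0 < i < n)%N -> ext_zero i N (homT T Y)) ->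
  homT_mor T (a j) = 0 -> exists Y, mod_retract N (homT T Y).
Proof.
rewrite leq_eqVlt => /orP[/eqP -> | lt] ih i0 ii ez aj.
  exists ozero; apply: mod_retract0 => m; apply: (lker_eq0P _).1 i0 _ _.
  have /limgP[v ->] : iota m \in limg (homT_mor T (a n)).
    by rewrite -ii; apply/limgP; exists m.
  by rewrite aj zero_lfunE.
(* Writing n as m + j.+1 reindexes the family to start at X j.+1. *)
exists (X n); have E := subnK lt; set m := (n - j.+1)%N in E.
case: _ / E iota ih i0 ii ez {lt} => iota ih i0 ii ez.
have [||rho [rh rE]] := mod_lift ih i0 (f := homT_mor T (a (m + j.+1)%N)).
- exact: homT_hom.
- by apply/limg_subP; rewrite ii subvv.
pose P := free_resolution N.
have [|||||||g [gh gd gE]] := @cocycle_lift _ _ _ N P m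
    (fun i => homT T (X (i + j.+1)%N)) (fun i => homT_mor T (a (i + j.+1)%N))
    _ _ _
    0 _ (iota \o aug N)%VF.
- by move=> i; apply: homT_hom.
- by apply/eqP; rewrite -subv0 -ex aj; apply/subvP => v /limgP[w ->];
    rewrite zero_lfunE mem0v.
- by move=> i _; apply: ex.
- move=> i l _ /andP[h1 h2]; apply: ez; rewrite h1 /= (leq_ltn_trans h2) //.
  by rewrite add0n addnS ltnS leq_addr.
- exact: mod_hom_comp ih (@aug_hom _ _ _ _).
- apply/lfunP => x; rewrite comp_lfunE zero_lfunE comp_lfunE.
  have /limg_lkerP[-> _] : limg (pr_d P 0) = lker (aug N) by apply: pr_exact0.
  by rewrite linear0.
- rewrite limg_compr ?ii ?subvv //; exact: aug_surj.
have [|w [wh wE]] := mod_factor (@aug_hom _ _ _ N) (@aug_surj _ _ _ N) gh.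
  move=> v /lkerP; rewrite -(pr_exact0 P) => /limgP[u ->].
  by rewrite -comp_lfunE gd zero_lfunE.
exists w, rho; split=> //; apply/lfunP => x.
rewrite id_lfunE comp_lfunE; apply/eqP; rewrite -subr_eq0; apply/eqP.
apply: (lker_eq0P _).1 i0 _ _.
rewrite linearB /= -(comp_lfunE iota) -rE.
have [v ->] := (limg_fullP _).1 (@aug_surj _ _ _ N) x.
rewrite -(comp_lfunE w) -wE -comp_lfunE -(comp_lfunE iota) gE.
by rewrite subrr.
Qed.

End ExactFamilies.

Section Retracts.
Variables (k : fieldType) (C : addcat k) (T : C).
Hypothesis split : split_idempotents C.
Hypothesis full : homT_full T.
Implicit Types M N L : rmod T.

(** Fullness yields phi inducing the idempotent i p, but phi itself need not be idempotent. Its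
    Fitting idempotent induces the same module map and can be split in C. *)
Lemma mod_retract_image M Y : mod_retract M (homT T Y) -> ess_image M.
Proof.
move=> [i [p [ih ph pi]]].
have [phi phiE] := full (mod_hom_comp ih ph).
have idem : (homT_mor T phi \o homT_mor T phi)%VF = homT_mor T phi.
  by rewrite -phiE comp_lfunA -(comp_lfunA i) pi comp_lfun1r.
have powE n : homT_mor T (cpow phi n.+1) = homT_mor T phi.
  elim: n => [|n IH]; first by rewrite /cpow /= compm1.
  by rewrite cpowS homT_morM IH.
have [e fe] := fitting_ex phi.
have eE : homT_mor T e = homT_mor T phi.
  case: fe => n /(_ n.+1 (leqnSn n)) [_ h1 _ [psi h2]].
  have e1 : homT_mor T e = (homT_mor T psi \o homT_mor T phi)%VF.
    by rewrite {1}h2 homT_morM powE.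
  have := congr1 (@homT_mor _ _ T _ _) h1; rewrite homT_morM powE => <-.
  by rewrite e1 -comp_lfunA idem.
have [Z [q [j [qj jq]]]] := split (fitting_idem fe).
exists Z; apply/mod_isoP; exists (homT_mor T q \o i)%VF, (p \o homT_mor T j)%VF.
split.
- exact: mod_hom_comp (homT_hom (T := T) q) ih.
- exact: mod_hom_comp ph (homT_hom (T := T) j).
- rewrite comp_lfunA -(comp_lfunA p) -homT_morM jq eE -phiE.
  by rewrite -(comp_lfunA p) -(comp_lfunA i) pi comp_lfun1r pi.
- rewrite comp_lfunA -(comp_lfunA _ i) phiE -eE -!homT_morM -jq.
  by rewrite compA qj comp1m qj homT_mor1.
Qed.

End Retracts.

(** * Chains inducing projective resolutions: sums, isomorphisms, fullness *)

Section ResolutionChains.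
Variables (k : fieldType) (C : addcat k) (T : C).

Lemma resol_full m (Q X : C) (c : chain m.+1 Q X) : resol T c ->
  forall Y (p : 'Hom(homT T X, homT T Y)), mod_hom p ->
    exists f : mor X Y, p = homT_mor T f.
Proof.
elim: m Q c => [|m IH] Q c; last by move=> [_ _ /IH].
move=> [[_ _ Qf] [fg _ cok] [[_ Q'f _] us]] Y p ph.
set u := (projT2 c).2 : mor _ X in fg cok us.
have [y yE] := Q'f _ (p \o homT_mor T u)%VF
  (mod_hom_comp ph (homT_hom (T := T) u)).
have y0 : y \oc (projT2 c).1 = 0.
  apply: Qf; rewrite homT_morM -yE -comp_lfunA -homT_morM.
  by rewrite fg homT_mor0 comp_lfun0r.
have [z zE] := cok _ _ y0; exists z; apply/lfunP => w.
have [v ->] := us w; have := congr1 (fun f : 'Hom(_, _) => f v) yE.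
by rewrite /= comp_lfunE !homTE zE -compA.
Qed.

Lemma chd_sum m (X Y Z W : C) (c : chain m X Z) (e : chain m Y W) :
  chd (chain_sum c e) =
  existT _ (osum _ _) (mor_mx (projT2 (chd c)) 0 0 (projT2 (chd e))).
Proof. by case: m c e. Qed.

Lemma rpair_sum (X Y Z X' Y' Z' : C) (f : mor X Y) (g : mor Y Z)
    (f' : mor X' Y') (g' : mor Y' Z') : rpair T f g -> rpair T f' g' ->
  rpair T (mor_mx f 0 0 f') (mor_mx g 0 0 g').
Proof.
move=> [gf ex cok] [gf' ex' cok']; split.
- by rewrite mor_mx_diagM gf gf' mor_mx_diag0.
- move=> u e.
  have [|v vE] := ex (opr1 _ _ \oc u).
    have := congr1 (comp (opr1 _ _)) e; rewrite compA opr1_mor_mx compm0.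
    by rewrite /orow comp0m addr0 compA.
  have [|v' vE'] := ex' (opr2 _ _ \oc u).
    have := congr1 (comp (opr2 _ _)) e; rewrite compA opr2_mor_mx compm0.
    by rewrite /orow comp0m add0r compA.
  exists (ocol v v'); apply: osum_coext;
    rewrite compA ?opr1_mor_mx ?opr2_mor_mx orow_ocol comp0m.
    by rewrite addr0.
  by rewrite add0r.
- move=> W w e.
  have [|v vE] := cok _ (w \oc oin1 _ _).
    have := congr1 (precomp (oin1 _ _)) e;
      rewrite /precomp -compA mor_mx_in1 comp0m.
    by rewrite /ocol compm0 addr0 compA.
  have [|v' vE'] := cok' _ (w \oc oin2 _ _).
    have := congr1 (precomp (oin2 _ _)) e;
      rewrite /precomp -compA mor_mx_in2 comp0m.
    by rewrite /ocol compm0 add0r compA.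
  exists (orow v v'); rewrite orow_mor_mx -vE -vE'.
  by apply: osum_ext; rewrite ?orow_in1 ?orow_in2.
Qed.

Lemma resol_sum m (Q Q' X X' : C) (c : chain m Q X) (c' : chain m Q' X') :
  resol T c -> resol T c' -> resol T (chain_sum c c').
Proof.
elim: m Q Q' c c' => [|m IH] Q Q' c c' /=.
  move=> [Qp us] [Qp' us']; split; first exact: pobj_osum.
  move=> w; have [v vE] := us (opr1 _ _ \oc w).
  have [v' vE'] := us' (opr2 _ _ \oc w).
  exists (ocol v v'); apply: osum_coext;
    rewrite compA ?opr1_mor_mx ?opr2_mor_mx orow_ocol comp0m.
    by rewrite addr0.
  by rewrite add0r.
move=> [Qp r rc] [Qp' r' rc']; split; first exact: pobj_osum.
  by rewrite chd_sum; apply: rpair_sum.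
exact: IH.
Qed.

Lemma rpair_iso (X Y Z Z' : C) (f : mor X Y) (g : mor Y Z) (kap : mor Z Z') :
  is_iso kap -> rpair T f g -> rpair T f (kap \oc g).
Proof.
move=> kP; have [kap' [kk' k'k]] := kP; move=> [gf ex cok]; split.
- by rewrite -compA gf compm0.
- move=> u e; apply: ex; apply: (iso_monic kP).
  by rewrite compA e compm0.
- move=> W w /cok[v ->]; exists (v \oc kap').
  by rewrite -compA (compA kap') kk' comp1m.
Qed.

Lemma resol_iso m (Q X X' : C) (c : chain m Q X) (kap : mor X X') :
  is_iso kap -> resol T c -> resol T (cpost kap c).
Proof.
move=> kP; elim: m Q c => [|m IH] Q c /=.
  move=> [Qp us]; split=> // w; have [kap' [kk' k'k]] := kP.
  have [v vE] := us (kap' \oc w); exists v.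
  by rewrite -compA -vE compA k'k comp1m.
move=> [Qp r rc]; split=> //; last exact: IH.
case: m c r {rc IH} => [|m] c r //=; exact: rpair_iso.
Qed.

Lemma resol_zero m (Q X : C) : idm Q = 0 -> (forall w : mor T X, w = 0) ->
  resol T (zero_chain m Q X).
Proof.
move=> + X0; elim: m Q => [|m IH] Q Q0 /=.
  split; first exact: pobj0.
  by move=> w; exists 0; rewrite (X0 w) compm0.
split; [exact: pobj0 | | exact: IH (ozeroP _)].
have z := ozeroP C; split.
- by rewrite compm0.
- by move=> u _; exists 0; rewrite comp0m (mor_to0 u z).
- by move=> W w _; exists 0; rewrite comp0m (mor_from0 w z).
Qed.

Lemma wexact_rpair (X Y Z : C) (f : mor X Y) (g : mor Y Z) :
  wexact f g -> rpair T f g.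
Proof. by move=> [h1 h2 h3]; split=> // u /h2. Qed.

Lemma wexact_homT (X Y Z : C) (f : mor X Y) (g : mor Y Z) :
  wexact f g -> limg (homT_mor T f) = lker (homT_mor T g).
Proof.
move=> [gf h _]; apply/limg_lkerP; split=> u; rewrite !homTE.
  by rewrite compA gf comp0m.
by move=> /h[v ->]; exists v; rewrite homTE.
Qed.

End ResolutionChains.

(** * From conditions (a), (a'), (b) to cluster tilting and fullness *)

Section SecondToFirst.
Variables (k : fieldType) (d : nat) (C : angulated k d.+1).
Variables (S : serre_functor C) (T : C).
Hypothesis split : split_idempotents C.

Lemma angle_resol m (Q X Z : C) (c : chain m Q X) (h : mor X Z)
    (c' := crcons h c) : in_add T Q -> all_inter (in_add T) c ->
  cpairs (@wexact _ C) (projT2 c').1 (ctail c') -> homT_mor T h = 0 ->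
  resol T c.
Proof.
rewrite {}/c' => + + + h0; elim: m Q c => [|m IH] Q c Qa.
  move=> _ [_ ex _]; split; first exact: pobj_add.
  by move=> w; apply: ex; rewrite -homTE h0 zero_lfunE.
move=> [Q'a Ia] [r rc]; split; first exact: pobj_add.
  apply: wexact_rpair; move: r; rewrite /ctail /=.
  by case: m {IH Ia rc} c Q'a.
exact: IH.
Qed.

Hypothesis b : cond_b T.

(** Condition (b) speaks of indecomposables not killed by mor T -. Killed objects have a zero chain,
    and the rest follows by decomposing into indecomposables. *)
Lemma cond_b_resol (X : C) : exists (Q : C) (c : chain d.+1 Q X), resol T c.
Proof.
move: X; apply: (@decomposition_ind _ C) => [X Y iso [Q [c rc]] | X X0 | X ind
    | X Y [Q [c rc]] [Q' [c' rc']]].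
- have [f fP] := isomorphic_sym iso.
  by exists Q, (cpost f c); apply: resol_iso.
- exists ozero, (zero_chain d.+1 ozero X); apply: resol_zero;
    first exact: ozeroP.
  by move=> w; apply: mor_to0.
- case: (classic (exists u : mor T X, u <> 0)) => [nz | z]; last first.
    exists ozero, (zero_chain d.+1 ozero X); apply: resol_zero.
      exact: ozeroP.
    by move=> w; apply: NNPP => w0; apply: z; exists w.
  have [Td [c [h [Ta Ia ac h0]]]] := b ind nz.
  by exists Td, c; apply: (angle_resol Ta Ia (angle_cpairs ac) h0).
- by exists (osum Q Q'), (chain_sum c c'); apply: resol_sum.
Qed.

Lemma cond_b_full : homT_full T.
Proof. by move=> X Y p; have [Q [c /resol_full]] := cond_b_resol X; apply. Qed.

Lemma cond_b_ext i (M N : rmod T) : (0 < i < d.+1)%N ->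
  ess_image M -> ess_image N -> ext_zero i M N.
Proof.
move=> le [X isoX] [Y isoY]; apply: (ext_zero_isol isoX);
  apply: (ext_zero_isor isoY).
by have [Q [c rc]] := cond_b_resol X; apply: (resol_ext_zero _ rc).
Qed.

Lemma ess_image_homT (X : C) : ess_image (homT T X).
Proof.
exists X; apply/mod_isoP; exists \1%VF, \1%VF.
by split; rewrite ?comp_lfun1l //; exact: mod_hom1.
Qed.

Lemma cond_a_image (M : rmod T) : cond_a T ->
  (forall i A, (0 < i < d.+1)%N -> ess_image A -> ext_zero i A M) ->
  ess_image M.
Proof.
move=> a H; have [T1 [T0 [f [q [T1a T0a mp]]]]] := min_presentation_ex split M.
have [c [ac [i [/andP[i1 i2] kc]]]] := a M H T1 T0 f q T1a T0a mp.
case: mp => _ [fh qh] fq qs _.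
have [Y r] : exists Y, mod_retract M (homT T Y); last first.
  exact (mod_retract_image split cond_b_full r).
pose x := SSeq (d := d.+1) (Sg := susp C) f c.
(* f is morphism 0 of the angle, so h_i, at place d.+1 + 1 - i of c, has index one more. *)
have arrowE := @rotation_arrow _ _ _ x (d.+1 + 1 - i).+1.
apply: (@left_summand _ _ T (fun i => ss1 (iter i (@rotation _ _ _ _) x))
  (fun i => ssmor (iter i (@rotation _ _ _ _) x)) _ M q (d.+1 + 1 - i)) => //.
- by move=> j; apply/wexact_homT/angle_wexact_rot/angle_iter.
- move=> j Y /andP[j1 j2]; apply: H; last exact: ess_image_homT.
  rewrite j1 /= (leq_trans j2) // leq_subLR addn1 -addn1 addnC leq_add2r //.
have le : (d.+1 + 1 - i < d.+2)%N by rewrite addn1 ltn_subrL i1.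
move: kc; rewrite /harrow -[chain_arrow c _]/(chain_arrow (ccons f c) _.+1).
by rewrite arrowE.
Qed.

(** Equal arrows need not have convertible end objects; a square with isomorphisms allows transport
    between them. *)
Lemma arrow_iso (D : lincat k) (A B A' B' : D) (f : mor A B) (f' : mor A' B') :
  Arrow f = Arrow f' -> exists (u : mor A A') (v : mor B B'),
    [/\ is_iso u, is_iso v & f' \oc u = v \oc f].
Proof.
pose P (x : arrow D) := exists (u : mor A (asrc x)) (v : mor B (atgt x)),
  [/\ is_iso u, is_iso v & amor x \oc u = v \oc f].
move=> e; have : P (Arrow f); last by rewrite e.
by exists (idm A), (idm B); rewrite compm1 comp1m; split; try exact: is_iso_id.
Qed.

Lemma cond_a'_image (N : rmod T) : cond_a' S T ->
  (forall i A, (0 < i < d.+1)%N -> ess_image A -> ext_zero i N A) ->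
  ess_image N.
Proof.
move=> a H; have [T1 [T0 [g [q [T1a T0a mp]]]]] := min_copresentation_ex S
  split N.
have [c [ac [i [/andP[i1 i2] kc]]]] := a N H T1 T0 g q T1a T0a mp.
case: mp => _ [qh gh] q0 qg _.
have [Y r] : exists Y, mod_retract N (homT T Y); last first.
  exact (mod_retract_image split cond_b_full r).
set g' := eqmor _ \oc g in ac.
pose x := sseq_of (crcons g' c).
have ax : angle x by exact: ac.
pose rot i := iter i (@rotation _ _ _ (susp C)) x.
have full_c j : (j <= d.+2)%N -> chain_arrow (crcons g' c) j = Arrow
  (ssmor (rot j)).
  by move=> le; rewrite -rotation_arrow.
have E2 : Arrow (ssmor (rot d.+2)) = Arrow g'.
  by rewrite -full_c // chain_arrow_crcons_last.
have [u [v [[u' [u'u uu']] vP sq]]] := arrow_iso E2.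
have gz w : g \oc w = 0 <-> g' \oc w = 0.
  rewrite /g' -compA; split=> [-> | e]; first by rewrite compm0.
  apply: (iso_monic (is_iso_eqmor (esym (autVK (susp C) (S T0))))).
  by rewrite e compm0.
have exr j : limg (homT_mor T (ssmor (rot j))) = lker
  (homT_mor T (ssmor (rot j.+1))).
  by apply/wexact_homT/angle_wexact_rot/angle_iter.
(* g' has index d.+2, so N is the image of the morphism of index d.+1; u' carries q into the source
   of the rotated copy of g'. *)
apply: (@right_summand _ _ T (fun i => ss1 (rot i)) (fun i => ssmor (rot i))
  exr N d.+1 (d.+1 + 1 - i) (homT_mor T u' \o q)%VF).
- by rewrite leq_subLR addnC leq_add2r.
- exact: mod_hom_comp (homT_hom (T := T) u') qh.
- apply/lker_eq0P => n; rewrite comp_lfunE homTE => e.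
  apply: (lker_eq0P _).1 q0 _ _.
  by rewrite -[q n]comp1m -uu' -compA e compm0.
- rewrite exr; apply/limg_lkerP; split=> [n | w].
    rewrite comp_lfunE !homTE; apply: (iso_monic vP).
    rewrite compA -sq -compA (compA u) uu' comp1m compm0; apply/gz.
    by rewrite -homTE; apply/lkerP; rewrite -qg; apply/limgP; exists n.
  rewrite homTE => e.
  have : homT_mor T g (u \oc w) = 0.
    by rewrite homTE; apply/gz; rewrite compA sq -compA e compm0.
  move=> /lkerP; rewrite -qg => /limgP[n nE]; exists n.
  by rewrite comp_lfunE homTE -nE compA u'u comp1m.
- by move=> j Y le; apply: H => //; apply: ess_image_homT.
have le : (d.+1 + 1 - i <= d.+1)%N.
  by rewrite leq_subLR addnC leq_add2r.
by move: kc; rewrite /harrow -(chain_arrow_crcons g') // full_c // ltnW.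
Qed.

(** For a right approximation take a weak kernel K of the copresentation g: a map from mor T Y to M
    gives Y -> S T1 annihilated by g, which factors through K. Left approximations come from the
    weak cokernel of a presentation. *)
Lemma image_functorially_finite : functorially_finite (ess_image (T := T)).
Proof.
move=> M; split.
  have [T1 [T0 [g [q [T1a T0a [_ [qh gh] q0 qg _]]]]]] := min_copresentation_ex
    S split M.
  pose g' := eqmor (esym (autVK (susp C) (S T0))) \oc g.
  have [c ac] := angle_with_last g'.
  have [K [h [c0 cE]]] := crcons_ex c.
  have := angle_cpairs ac; rewrite cE => /cpairs_closed_last[gh0 ex _].
  have gz A (w : mor A (S T1)) : g \oc w = 0 <-> g' \oc w = 0.
    rewrite /g' -compA; split=> [-> | e]; first by rewrite compm0.
    apply: (iso_monic (is_iso_eqmor (esym (autVK (susp C) (S T0))))).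
    by rewrite e compm0.
  have [_ If Iff] := iobj_add T1a; have [_ _ I0f] := iobj_add T0a.
  have [||rho [rh rE]] := mod_lift qh q0 (f := homT_mor T h).
  - exact: homT_hom.
  - apply/limg_subP; rewrite qg; apply/subvP => y /limgP[x ->]; apply/lkerP.
    by rewrite !homTE; apply/gz; rewrite compA gh0 comp0m.
  exists (homT T K), rho; split=> //; first exact: ess_image_homT.
  move=> B be [Y /mod_isoP[th [th' [thh thh' t't tt']]]] beh.
  have [y yE] := If _ _ (mod_hom_comp qh (mod_hom_comp beh thh')).
  have [w wE] : exists w, y = h \oc w.
    apply/ex/gz; apply: I0f; rewrite homT_morM -yE comp_lfunA.
    apply/lfunP => x; rewrite comp_lfunE zero_lfunE comp_lfunE.
    by apply/lkerP; rewrite -qg; apply/limgP; exists ((be \o th')%VF x).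
  exists (homT_mor T w \o th)%VF; split.
    exact: mod_hom_comp (homT_hom (T := T) w) thh.
  apply/lfunP => x; apply/eqP; rewrite -subr_eq0; apply/eqP.
  apply: (lker_eq0P _).1 q0 _ _; rewrite linearB /= comp_lfunE.
  have qr z : q (rho z) = h \oc z by rewrite -comp_lfunE -rE homTE.
  have yz z : y \oc z = q (be (th' z)) by rewrite -homTE -yE !comp_lfunE.
  rewrite qr !comp_lfunE homTE compA -wE yz -(comp_lfunE th') t't id_lfunE.
  by rewrite subrr.
have [T1 [T0 [f [q [T1a T0a [_ [fh qh] fq qs _]]]]]] := min_presentation_ex
  split M.
have [[K [h c]] ac] := angle_ex (a := C) f.
have [fh0 _ cok] := angle_wexact ac.
have [_ _ Pf1] := pobj_add T1a; have [_ Pf0 Pff0] := pobj_add T0a.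
have [|rho [rh rE]] := mod_factor qh qs (homT_hom (T := T) h).
  move=> v /lkerP; rewrite -fq => /limgP[u ->].
  by rewrite !homTE compA fh0 comp0m.
exists (homT T K), rho; split=> //; first exact: ess_image_homT.
move=> B be [Y /mod_isoP[th [th' [thh thh' t't tt']]]] beh.
have [y yE] := Pf0 _ _ (mod_hom_comp (mod_hom_comp thh beh) qh).
have [w wE] : exists w, y = w \oc h.
  apply/cok/Pf1; rewrite homT_morM -yE.
  apply/lfunP => x; rewrite comp_lfunE zero_lfunE comp_lfunE.
  rewrite (_ : q _ = 0) ?linear0 //; apply/lkerP; rewrite -fq.
  by apply/limgP; exists x.
exists (th' \o homT_mor T w)%VF; split.
  exact: mod_hom_comp thh' (homT_hom (T := T) w).
apply/lfunP => x; have [v ->] := (limg_fullP _).1 qs x.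
have rq z : rho (q z) = h \oc z by rewrite -comp_lfunE -rE homTE.
have yz z : y \oc z = th (be (q z)) by rewrite -homTE -yE !comp_lfunE.
rewrite !comp_lfunE rq homTE compA -wE yz -(comp_lfunE th') t't id_lfunE //.
Qed.

Lemma second_to_first : cond_a T -> cond_a' S T ->
  cluster_tilting d.+1 (ess_image (T := T)) /\ homT_full T.
Proof.
move=> a a'; split; last exact: cond_b_full.
split; first exact: image_functorially_finite.
- move=> M; split=> [Mi i A le Ai | H]; first exact: cond_b_ext.
  exact: cond_a'_image.
- move=> M; split=> [Mi i A le Ai | H]; first exact: cond_b_ext.
  exact: cond_a_image.
Qed.

End SecondToFirst.

(** * Pruning angles *)

Section ChainSurgery.
Variables (k : fieldType) (C : lincat k).

Definition cpre m (B L Z : C) (g : mor B L) : chain m L Z -> chain m B Z :=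
  match m return chain m L Z -> chain m B Z with
  | 0 => fun c => c \oc g
  | m'.+1 => fun c => ccons ((projT2 c).1 \oc g) (projT2 c).2
  end.

Lemma chain_retr_cpre m (B L Z : C) (i : mor B L) (p : mor L B)
    (c : chain m L Z) :
  projT2 (chd c) \oc (i \oc p) = projT2 (chd c) ->
  chain_retr (idm Z) (idm Z) i p (cpre i c) c.
Proof.
case: m c => [|m] c /=.
  by move=> e; rewrite !comp1m -compA e.
move=> e; exists (idm _), (idm _); rewrite !comp1m -compA e.
by split=> //; apply: chain_retr_id.
Qed.

Fixpoint clast m (Z : C) : forall X : C, chain m X Z -> {Y : C & mor Y Z} :=
  match m return forall X : C, chain m X Z -> {Y : C & mor Y Z} with
  | 0 => fun X c => existT _ X c
  | m'.+1 => fun X c => clast (projT2 c).2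
  end.

Lemma chain_retr_cpost m (X L B : C) (i : mor B L) (p : mor L B)
    (c : chain m X L) :
  (i \oc p) \oc projT2 (clast c) = projT2 (clast c) ->
  chain_retr i p (idm X) (idm X) (cpost p c) c.
Proof.
elim: m X c => [|m IH] X c /= e.
  by rewrite !compm1 compA e.
exists (idm _), (idm _); rewrite !compm1 !comp1m; split=> //; exact: IH.
Qed.

Lemma cpairs_clast P m (X Z W : C) (h : mor Z W) (c : chain m X Z)
    (c' := crcons h c) :
  cpairs P (projT2 c').1 (ctail c') -> P _ _ _ (projT2 (clast c)) h.
Proof.
rewrite {}/c'; elim: m X c => [|m IH] X c //=.
by move=> [_ H]; apply: IH.
Qed.

Lemma cpairs_chd P m (X0 X Z : C) (f : mor X0 X) (c : chain m X Z) :
  cpairs P f c -> P _ _ _ f (projT2 (chd c)).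
Proof. by case: m c => [|m] c //= []. Qed.

Lemma cpairs_closed_crcons P m (X Z W : C) (h : mor Z W) (c : chain m.+1 X Z)
    (c' := crcons h c) :
  cpairs P (projT2 c').1 (ctail c') -> cpairs P (projT2 c).1 (ctail c).
Proof. exact: cpairs_crcons. Qed.

End ChainSurgery.

Section Pruning.
Variable k : fieldType.

(* When d > 0, the factorisation of idm K - e through the next morphism K -> L
   splits off a trivial angle on a common summand of K and L.  When d = 0, that
   summand comes from T1, and fmin makes it vanish. *)
Lemma prune_left (d : nat) (C : angulated k d.+1) (T T1 T0 K : C)
    (f : mor T1 T0) (h : mor T0 K) (c1 : chain d K (susp C T1)) (e : mor K K) :
  split_idempotents C -> angle (SSeq (d := d.+1) f (ccons h c1)) ->
  e \oc e = e -> e \oc h = h ->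
  (forall W (g : mor K W) (w : mor T K), g \oc h = 0 -> g \oc (e \oc w) = 0) ->
  (forall E : mor T1 T1, E \oc E = E -> f \oc E = 0 -> E = 0) ->
  exists c : chain d.+1 T0 (susp C T1),
    angle (SSeq f c) /\ killed T (harrow c d.+1).
Proof.
move=> split ac ee eh kill fmin.
have fee : (idm K - e) \oc (idm K - e) = idm K - e.
  exact: idem_compl.
have feh : (idm K - e) \oc h = 0 by rewrite compBl comp1m eh subrr.
have pairs := angle_cpairs ac.
case: d C T T1 T0 K f h c1 e split ac ee eh kill fmin fee feh pairs =>
  [|d] C T T1 T0 K f h c1 e
  split ac ee eh kill fmin fee feh pairs.
  exists (ccons h c1); split=> //.
  rewrite /killed /harrow /=; set h1 : mor K _ := c1.
  have [_ [hh _ hcok]] := pairs.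
  have [t tE] := hcok _ _ feh; rewrite -/h1 in tE hh.
  (* E is idempotent on Sigma T1, and the idempotent on T1 that it comes from is annihilated by
     f. *)
  pose E := h1 \oc (idm K - e) \oc t.
  have EE : E \oc E = E.
    rewrite /E -!compA (compA t) -tE (compA _ _ (_ \oc t)) fee.
    by rewrite (compA _ _ t) fee.
  have h1E : h1 \oc (idm K - e) = 0.
    rewrite -fee [X in _ \oc (_ \oc X)]tE !compA -/E.
    have [E0 E0E] := aut_full E.
    suff -> : E = 0 by rewrite comp0m.
    rewrite -E0E (fmin E0) ?fmor0 //.
      by apply: (@aut_inj _ _ (susp C)); rewrite fmorM E0E.
    apply: (@aut_inj _ _ (susp C)); rewrite fmorM E0E fmor0 /E !compA.
    by rewrite (@angle_last0 _ 0 C _ _ _ f h1 h ac) !comp0m.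
  apply/homT_eq0P => w; rewrite -[h1](subrK (h1 \oc e)) -{1}[h1]compm1 -compBr.
  by rewrite h1E add0r -compA; apply: kill.
case: c1 ac pairs => L [hd c2] ac pairs.
have [hh hcok pairs2] : [/\ hd \oc h = 0,
    forall W (u : mor K W), u \oc h = 0 -> exists v, u = v \oc hd
    & cpairs (@wexact k C) hd c2] by case: pairs => _ [[]].
clear pairs.
have [t tE] := hcok _ _ feh.
have [hdc _ _] := cpairs_chd pairs2.
(* The subtracted idempotent cuts out the copy in L of the image of [idm K - e], so e and e' remove
   the two ends of a trivial summand. *)
pose e' := idm L - hd \oc (idm K - e) \oc t.
have idem' : (hd \oc (idm K - e) \oc t) \oc (hd \oc (idm K - e) \oc t) =
    hd \oc (idm K - e) \oc t.
  rewrite -!compA (compA t) -tE (compA _ _ (_ \oc t)) fee.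
  by rewrite (compA _ _ t) fee.
have [|B [p' [i' [pi' ip']]]] := split L e'.
  exact: idem_compl idem'.
have [A [p [i [pi ip]]]] := split _ _ ee.
have ei : e \oc i = i by rewrite -ip -compA pi compm1.
have e'hd : e' \oc hd = hd \oc e.
  rewrite /e' compBl comp1m -(compA _ t) -tE -(compA hd) fee.
  by rewrite -[hd in hd - _]compm1 -compBr opprB addrC subrK.
exists (ccons (p \oc h) (ccons (p' \oc hd \oc i) (cpre i' c2))); split.
  apply: (@retract_angle _ _ C T1 T1 (idm T1) (idm T1) (ccons f _)
    (ccons f (ccons h (ccons hd c2))) split) => //; first exact: comp1m.
  rewrite !fmor1; exists (idm T0), (idm T0).
  rewrite /= !compm1 !comp1m; split=> //; exists i, p; split=> //.
    by rewrite compA ip eh.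
  exists i', p'; split=> //.
  - by rewrite !compA ip' e'hd -compA ei.
  - by rewrite -!compA ip -e'hd -ip' !compA pi' comp1m.
  apply: chain_retr_cpre; rewrite ip' compBr compm1 !compA hdc !comp0m subr0 //.
rewrite /harrow addn1 subSS subSn // subnn /killed /=.
apply/homT_eq0P => w; rewrite -ei -!compA; rewrite (compA p' hd); apply: kill.
by rewrite -compA hh compm0.
Qed.

(** Dual to [prune_left]: [idm K - e] factors through the morphism that precedes h, so the trivial
    summand is shared by K and the object before it. For d = 0 that object is W, where gmin makes
    the summand vanish. *)
Lemma prune_right (d : nat) (C : angulated k d.+1) (T W K Z : C)
    (c0 : chain d W K) (h : mor K Z) (g : mor Z (susp C W)) (e : mor K K) :
  split_idempotents C -> angle (sseq_of (crcons g (crcons h c0))) ->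
  e \oc e = e -> h \oc e = h ->
  (forall A (f : mor A K) (w : mor T A), h \oc f = 0 -> e \oc (f \oc w) = 0) ->
  (forall E : mor (susp C W) (susp C W), E \oc E = E -> E \oc g = 0 -> E = 0) ->
  exists c : chain d.+1 W Z,
    angle (sseq_of (crcons g c)) /\ killed T (harrow c 2).
Proof.
move=> split ac ee he kill gmin.
have fee := idem_compl ee.
have hfe : h \oc (idm K - e) = 0 by rewrite compBr compm1 he subrr.
have pairs := angle_cpairs ac.
case: d C T W K Z c0 h g e split ac ee he kill gmin fee hfe pairs
  => [|d] C T W K Z c0 h g e split ac ee he kill gmin fee hfe pairs.
  exists (crcons h c0); split=> //.
  rewrite /killed /harrow /=; set h2 : mor W K := c0.
  have [hh hex] : h \oc h2 = 0 /\
      forall A (u : mor A K), h \oc u = 0 -> exists v, u = h2 \oc v.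
    by case: pairs => [[]].
  have [t tE] := hex _ _ hfe.
  pose E := t \oc (idm K - e) \oc h2.
  have EE : E \oc E = E.
    by rewrite /E -!compA (compA h2) -tE (compA (idm K - e) (idm K - e)) fee
      (compA (idm K - e) (idm K - e)) fee.
  have E0 : E = 0.
    apply: (@aut_inj _ _ (susp C)); rewrite fmor0; apply: gmin.
      by rewrite -fmorM EE.
    by rewrite /E fmorM -compA (@angle_last0 _ 0 C _ _ _ h2 g h ac) compm0.
  have hE : (idm K - e) \oc h2 = 0.
    by rewrite -fee [X in X \oc _ \oc _]tE -!compA (compA t) -/E E0 compm0.
  apply/homT_eq0P => w; rewrite -[h2](subrK (e \oc h2)) -{1}[h2]comp1m -compBl.
  by rewrite hE add0r -compA; apply: kill.
have [L [h2 [c2 cE]]] := crcons_ex c0; rewrite {}cE in ac pairs.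
have [hh hex _] := cpairs_closed_last (cpairs_closed_crcons pairs).
have [hc2 _ _] := cpairs_clast (cpairs_closed_crcons (cpairs_closed_crcons
  pairs)).
have [t tE] := hex _ _ hfe.
have idem' : (t \oc (idm K - e) \oc h2) \oc (t \oc (idm K - e) \oc h2) =
    t \oc (idm K - e) \oc h2.
  by rewrite -!compA (compA h2) -tE (compA (idm K - e) (idm K - e)) fee
    (compA (idm K - e) (idm K - e)) fee.
pose e' := idm L - t \oc (idm K - e) \oc h2.
have [|B [p' [i' [pi' ip']]]] := split L e'; first exact: idem_compl idem'.
have [A [p [i [pi ip]]]] := split _ _ ee.
have pe : p \oc e = p by rewrite -ip compA pi comp1m.
have h2e' : h2 \oc e' = e \oc h2.
  rewrite /e' compBr compm1 !compA -tE fee.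
  by rewrite -[h2 in h2 - _]comp1m -compBl opprB addrC subrK.
exists (crcons (h \oc i) (crcons (p \oc h2 \oc i') (cpost p' c2))); split.
  apply: (@retract_angle _ _ C W W (idm W) (idm W)
    (crcons g (crcons (h \oc i) (crcons (p \oc h2 \oc i') (cpost p' c2))))
    (crcons g (crcons h (crcons h2 c2))) split _ _ ac); first exact: comp1m.
  rewrite !fmor1; apply: (@chain_retr_crcons _ _ _ _ _ _ _ (idm Z) (idm Z)).
  - exact: comp1m.
  - by rewrite comp1m compm1.
  - by rewrite comp1m compm1.
  apply: (@chain_retr_crcons _ _ _ _ _ _ _ i p) => //.
  - by rewrite comp1m.
  - by rewrite comp1m -compA ip.
  apply: (@chain_retr_crcons _ _ _ _ _ _ _ i' p') => //.
  - by rewrite !compA ip -h2e' -ip' -!compA pi' compm1.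
  - by rewrite -!compA ip' h2e' compA pe.
  apply: chain_retr_cpost.
  by rewrite ip' compBl comp1m -compA hc2 compm0 subr0.
rewrite /harrow addn1 !subSS subn0 chain_arrow_crcons //
  chain_arrow_crcons_last.
apply/homT_eq0P => w; rewrite /= -pe -!compA (compA h2) kill ?compm0 //.
by rewrite compA hh comp0m.
Qed.

End Pruning.

(** * The strong conditions from cluster tilting and fullness *)

Section FirstToStrong.
Variables (k : fieldType) (d : nat) (C : angulated k d.+1).
Variables (S : serre_functor C) (T : C).
Hypothesis split : split_idempotents C.
Hypothesis full : homT_full T.
Notation Sg := (susp C).

Lemma first_to_strong_a :
  (forall M : rmod T, (forall i A, (0 < i < d.+1)%N -> ess_image A ->
     ext_zero i A M) -> ess_image M) -> strong_a T.
Proof.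
move=> ct M Mext T1 T0 f q T1a T0a [_ [fh qh] fq qs [fess _]].
have [X /mod_isoP[th [th' [thh thh' t't tt']]]] : ess_image M.
  by apply: ct => i A le Ai; apply: Mext.
have [_ _ P1f] := pobj_add T1a; have [_ P0 P0f] := pobj_add T0a.
have [u uE] := P0 _ _ (mod_hom_comp thh qh).
have us (w : mor T X) : exists w', w = u \oc w'.
  have [v vE] := (limg_fullP _).1 qs (th' w); exists v.
  by rewrite -homTE -uE comp_lfunE -vE -comp_lfunE tt' id_lfunE.
have uf : u \oc f = 0.
  apply: P1f; rewrite homT_morM -uE; apply/lfunP => v.
  rewrite zero_lfunE !comp_lfunE.
  by have /limg_lkerP[-> _] := fq; rewrite linear0.
have [[K [h c1]] ac] := angle_ex (a := C) f.
have [hf0 _ hcok] := angle_wexact ac.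
have [r rE] := hcok _ _ uf.
have [|sg [sgh sgE]] := mod_factor qh qs (homT_hom (T := T) h).
  by move=> v /lkerP; rewrite -fq => /limgP[v' ->];
    rewrite !homTE compA hf0 comp0m.
have [s sE] := full (mod_hom_comp sgh thh').
have su : s \oc u = h.
  apply/eqP; rewrite -subr_eq0; apply/eqP/P0f.
  rewrite homT_morB homT_morM -sE -uE -comp_lfunA (comp_lfunA th') t't.
  by rewrite comp_lfun1l -sgE subrr.
have [e fe] := fitting_ex (s \oc r).
have eh : e \oc h = h by apply: (fitting_fix fe); rewrite -compA -rE su.
have [[w0 ew] _] := fitting_factor fe.
apply: (prune_left split ac (fitting_idem fe) eh) => [W g w gh | E EE fE].
  (* Since e = s w0, a lift of w0 w along u together with s u = h makes e w factor through h. *)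
  have [w' w'E] := us (w0 \oc w).
  by rewrite ew -(compA s) w'E (compA s) su compA gh comp0m.
(* f (1 - E) = f, so the projective cover onto the image of f forces 1 - E to be onto; E annihilates
   its image. *)
apply: P1f; have /limg_fullP Hs : limg (homT_mor T (idm T1 - E)) = fullv.
  apply: fess; first exact: homT_hom.
  by rewrite -homT_morM compBr compm1 fE subr0.
apply/homT_eq0P => w; have [v ->] := Hs w.
by rewrite homTE compA compBr compm1 EE subrr comp0m.
Qed.

Lemma first_to_strong_a' :
  (forall M : rmod T, (forall i A, (0 < i < d.+1)%N -> ess_image A ->
     ext_zero i M A) -> ess_image M) -> strong_a' S T.
Proof.
move=> ct N Next T1 T0 g q T1a T0a [_ [qh gh] q0 qg [_ gess]].
have [X /mod_isoP[th [th' [thh thh' t't tt']]]] : ess_image N.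
  by apply: ct => i A le Ai; apply: Next.
have [_ I1 I1f] := iobj_add T1a; have [_ _ I0f] := iobj_add T0a.
have [v vE] := I1 _ _ (mod_hom_comp qh thh').
have v0 A (w : mor T A) (f : mor A X) : v \oc (f \oc w) = 0 -> f \oc w = 0.
  move=> e; have : q (th' (f \oc w)) = 0 by rewrite -comp_lfunE vE homTE.
  move=> /((lker_eq0P _).1 q0) e'.
  by rewrite -[f \oc w](id_lfunE (f \oc w : homT T X)) -tt' comp_lfunE e'
    linear0.
have gv : g \oc v = 0.
  apply: I0f; rewrite homT_morM -vE; apply/lfunP => x.
  rewrite zero_lfunE comp_lfunE comp_lfunE.
  by apply/lkerP; rewrite -qg; apply/limgP; exists (th' x).
pose eps := eqmor (esym (autVK Sg (S T0))); pose g' := eps \oc g.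
have [c ac] := angle_with_last g'.
have [K [h [c0 cE]]] := crcons_ex c; rewrite {}cE in ac.
have [gh0 hex _] := cpairs_closed_last (angle_cpairs ac).
have [s sE] : exists s, v = h \oc s by apply: hex; rewrite -compA gv compm0.
have gz A (w : mor A (S T1)) : g' \oc w = 0 -> g \oc w = 0.
  have epsP : is_iso eps by exact: is_iso_eqmor.
  by rewrite -compA => e; apply: (iso_monic epsP); rewrite e compm0.
have [||rho [rh rhE]] := mod_lift qh q0 (f := homT_mor T h).
- exact: homT_hom.
- apply/limg_subP; rewrite qg; apply/subvP => y /limgP[x ->]; apply/lkerP.
  by rewrite !homTE; apply: gz; rewrite compA gh0 comp0m.
have [r rE] := full (mod_hom_comp thh rh).
have vr : v \oc r = h.
  apply/eqP; rewrite -subr_eq0; apply/eqP/I1f.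
  rewrite homT_morB homT_morM -rE -vE -comp_lfunA (comp_lfunA th') t't.
  by rewrite comp_lfun1l -rhE subrr.
have [e fe] := fitting_ex (s \oc r).
have he : h \oc e = h by apply: (fitting_fixr fe); rewrite compA -sE vr.
have [_ [w0 ew]] := fitting_factor fe.
apply: (prune_right split ac (fitting_idem fe) he) => [A f w hf | E EE Eg].
  rewrite ew -compA (compA r) (v0 _ w (r \oc f)) ?compm0 //.
  by rewrite !compA vr hf comp0m.
pose eps' := eqmor (autVK Sg (S T0)).
have ee' : eps \oc eps' = idm _ by exact: eqmorK.
have e'e : eps' \oc eps = idm _ by exact: eqmorVK.
(* Conjugation moves E from Sigma Sigma^-1 S T0 to S T0, where the injective envelope of the
   copresentation can act. *)
pose E1 := eps' \oc E \oc eps.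
have E1E : E1 \oc E1 = E1.
  by rewrite /E1 -!compA (compA eps) ee' comp1m (compA E) EE.
suff E10 : E1 = 0.
  rewrite -[E]comp1m -ee' -[_ \oc E]compm1 -ee' -!compA (compA eps')
    (compA _ eps).
  by rewrite -/E1 E10 comp0m compm0.
apply: I0f.
have E1g : E1 \oc g = 0 by rewrite /E1 -!compA Eg compm0.
have H : lker (homT_mor T (idm (S T0) - E1)) = 0%VS.
  apply: gess; first exact: homT_hom.
  by rewrite -homT_morM compBl comp1m E1g subr0.
apply/homT_eq0P => w; apply: (lker_eq0P _).1 H _ _.
by rewrite homTE compA compBl comp1m E1E subrr comp0m.
Qed.

End FirstToStrong.

(** * Angles from projective resolutions *)

Section ChainComparison.
Variables (k : fieldType) (C : addcat k).

Definition wcok (X Y Z : C) (f : mor X Y) (g : mor Y Z) :=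
  g \oc f = 0 /\ forall W (w : mor Y W), w \oc f = 0 -> exists v, w = v \oc g.

Lemma cpairs_sub (P Q : forall X Y Z : C, mor X Y -> mor Y Z -> Prop) :
  (forall X Y Z (f : mor X Y) (g : mor Y Z), P _ _ _ f g -> Q _ _ _ f g) ->
  forall m (X0 X Z : C) (f : mor X0 X) (c : chain m X Z),
    cpairs P f c -> cpairs Q f c.
Proof.
move=> PQ; elim=> [|m IH] X0 X Z f c /=; first exact: PQ.
by move=> [/PQ h1 /IH h2].
Qed.

Lemma chain_map_ex m (X0 X0' X X' Z Z' : C) (f : mor X0 X) (f' : mor X0' X')
    (p0 : mor X0 X0') (p : mor X X') (c : chain m X Z) (c' : chain m X' Z') :
  p \oc f = f' \oc p0 -> cpairs wcok f c -> cpairs wcok f' c' ->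
  exists q, inhabited (chain_mor q p c c').
Proof.
elim: m X0 X0' X X' f f' p0 p c c' => [|m IH] X0 X0' X X' f f' p0 p c c' sq.
  move=> [_ cok] [z' _].
  have [|q qE] := cok _ ((c' : mor X' Z') \oc p).
    by rewrite -compA sq compA z' comp0m.
  by exists q; split.
move=> [[_ cok] rc] [[z' _] rc'].
have [|q qE] := cok _ ((projT2 c').1 \oc p).
  by rewrite -compA sq compA z' comp0m.
have [q' H] := IH _ _ _ _ _ _ _ _ (projT2 c).2 (projT2 c').2 (esym qE) rc rc'.
by exists q'; apply/chain_morP; exists q.
Qed.

(** The homotopy is built from left to right by weak cokernels. Nothing follows Z, so at the right
    end the relation holds only after composition with the last morphism. *)
Lemma chain_homotopy m (X0 X X' Z Z' : C) (f : mor X0 X) (s0 : mor X X0)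
    (iX : mor X X') (rX : mor X' X) (iZ : mor Z Z') (rZ : mor Z' Z)
    (c : chain m X Z) (c' : chain m X' Z') :
  inhabited (chain_mor iZ iX c c') -> inhabited (chain_mor rZ rX c' c) ->
  cpairs wcok f c -> (rX \oc iX - idm X - f \oc s0) \oc f = 0 ->
  exists s, (rZ \oc iZ - idm Z - projT2 (clast c) \oc s) \oc projT2 (clast c)
    = 0.
Proof.
have E (A B A' B' D : C) (h : mor A B) (h' : mor A' B') (i : mor A A')
    (r : mor A' A) (j : mor B B') (q : mor B' B) (g : mor D A) (s : mor A D) s1 :
  h' \oc i = j \oc h -> h \oc r = q \oc h' -> h \oc g = 0 ->
  r \oc i - idm A - g \oc s = s1 \oc h ->
  (q \oc j - idm B - h \oc s1) \oc h = 0.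
  move=> sq sq' hg e; rewrite !compBl -!compA -sq (compA q) -sq' comp1m -e.
  by rewrite !compBr !compA hg comp0m subr0 compm1 subrr.
elim: m X0 X X' f s0 iX rX c c' => [|m IH] X0 X X' f s0 iX rX c c'.
  move=> [sq] [sq'] [cf cok] /cok[s1 s1E].
  by exists s1; apply: (E _ _ _ _ _ _ _ _ _ _ _ _ _ _ sq sq' cf s1E).
move=> /chain_morP[i1 [sq hi]] /chain_morP[r1 [sq' hr]] [[cf cok] rc]
  /cok[s1 s1E].
apply: (IH _ _ _ _ s1 i1 r1 _ (ctail c') hi hr rc).
exact: (E _ _ _ _ _ _ _ _ _ _ _ _ _ _ sq sq' cf s1E).
Qed.

Lemma chain_mor_clast m (X X' Z Z' : C) (p : mor X X') (q : mor Z Z')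
    (c : chain m X Z) (c' : chain m X' Z') : inhabited (chain_mor q p c c') ->
  exists p0, projT2 (clast c') \oc p0 = q \oc projT2 (clast c).
Proof.
elim: m X X' p c c' => [|m IH] X X' p c c'; first by move=> [sq]; exists p.
by move=> /chain_morP[p1 [_ /IH]].
Qed.

Lemma fitting_retract (X Y A : C) (i : mor X Y) (r : mor Y X) (e : mor Y Y)
    (j : mor A Y) (p : mor Y A) :
  fitting (i \oc r) e -> p \oc j = idm A -> j \oc p = e -> retract A X.
Proof.
move=> /fitting_factor[[w ew] _] pj jp; exists (w \oc j), (p \oc i).
by rewrite -compA (compA i) -ew -jp !compA pj comp1m pj.
Qed.

Lemma fitting_fmor (D : lincat k) (F : linfunctor C D) (X : C)
  (phi e : mor X X) :
  fitting phi e -> fitting (fmor F phi) (fmor F e).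
Proof.
have E m : cpow (fmor F phi) m = fmor F (cpow phi m).
  by elim: m => [|m IH]; rewrite ?fmor1 // !cpowS IH fmorM.
move=> [n nP]; exists n => N /nP[h1 h2 [psi h3] [psi' h4]];
  rewrite E -!fmorM h1 h2.
by split=> //; [exists (fmor F psi) | exists (fmor F psi')];
  rewrite -fmorM -?h3 -?h4.
Qed.

Lemma split_square (X Y A B : C) (g : mor X Y) (phi e : mor X X)
    (phi' e' : mor Y Y) (j : mor A X) (p : mor X A) (j' : mor B Y)
      (p' : mor Y B) :
  fitting phi e -> fitting phi' e' -> g \oc phi = phi' \oc g ->
  p \oc j = idm A -> j \oc p = e -> p' \oc j' = idm B -> j' \oc p' = e' ->
  g \oc j = j' \oc (p' \oc g \oc j) /\ (p' \oc g \oc j) \oc p = p' \oc g.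
Proof.
move=> fe fe' sq pj jp pj' jp'; have H := fitting_nat fe fe' sq; split.
  by rewrite !compA jp' -H -compA -jp -compA pj compm1.
by rewrite -compA jp -compA H -jp' !compA pj' comp1m.
Qed.

(** By naturality the Fitting idempotents of the composites i r commute with c', so their images
    form a chain v. Each idempotent factors through the term of c, which makes every term of v a
    retract of it. *)
Lemma chain_split (P : C -> Prop) m (X X' Z Z' A B : C) (iX : mor X X')
    (rX : mor X' X) (iZ : mor Z Z') (rZ : mor Z' Z) (c : chain m X Z)
    (c' : chain m X' Z') (eX : mor X' X') (eZ : mor Z' Z') (j : mor A X')
    (p : mor X' A) (jz : mor B Z') (pz : mor Z' B) :
  split_idempotents C -> (forall Y Y', retract Y Y' -> P Y' -> P Y) ->
  inhabited (chain_mor iZ iX c c') -> inhabited (chain_mor rZ rX c' c) ->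
  all_inter P c -> fitting (iX \oc rX) eX -> fitting (iZ \oc rZ) eZ ->
  p \oc j = idm A -> j \oc p = eX -> pz \oc jz = idm B -> jz \oc pz = eZ ->
  exists v : chain m A B, chain_retr jz pz j p v c' /\ all_inter P v.
Proof.
move=> split Pr + + + + fZ + + pjz jpz.
elim: m X X' A iX rX c c' eX j p => [|m IH] X X' A iX rX c c' eX j p.
  move=> [sq] [sq'] _ fX pj jp.
  have [|h1 h2] := split_square (g := c' : mor X' Z') fX fZ _ pj jp pjz jpz.
    by rewrite compA sq -!compA; congr (_ \oc _).
  by exists (pz \oc c' \oc j).
move=> /chain_morP[i1 [sq hi]] /chain_morP[r1 [sq' hr]] [Pc Ic] fX pj jp.
have [e1 f1] := fitting_ex (i1 \oc r1).
have [B1 [p1 [j1 [pj1 jp1]]]] := split _ _ (fitting_idem f1).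
have [v [hv Iv]] := IH _ _ _ _ _ _ _ _ _ _ hi hr Ic f1 pj1 jp1.
have [|h1 h2] := split_square (g := (projT2 c').1) fX f1 _ pj jp pj1 jp1.
  by rewrite compA sq -!compA; congr (_ \oc _).
exists (ccons (p1 \oc (projT2 c').1 \oc j) v); split; first by exists j1, p1.
by split=> //; apply: Pr Pc; apply: fitting_retract f1 pj1 jp1.
Qed.

Lemma all_inter_cpost (P : C -> Prop) m (X Z W : C) (g : mor Z W)
    (c : chain m X Z) : all_inter P c -> all_inter P (cpost g c).
Proof. by elim: m X c => [|m IH] X c //= [h1 /IH h2]. Qed.

Lemma all_inter_crcons (P : C -> Prop) m (X Z W : C) (g : mor Z W)
    (c : chain m X Z) : P Z -> all_inter P c -> all_inter P (crcons g c).
Proof. by move=> PZ; elim: m X c => [|m IH] X c //= [h1 /IH h2]. Qed.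

Lemma chain_retr_zero m (X X' Y : C) (gi : mor X Y) (gr : mor Y X)
    (fi : mor ozero X') (fr : mor X' ozero) (c : chain m X' Y) :
  gr \oc projT2 (clast c) = 0 ->
  chain_retr gi gr fi fr (zero_chain m ozero X) c.
Proof.
have z := ozeroP C.
elim: m X' fi fr c => [|m IH] X' fi fr c /= e.
  by rewrite e comp0m (mor_from0 fi z) !compm0.
exists 0, 0; rewrite comp0m z (mor_from0 fi z) (mor_to0 fr z) !compm0 !comp0m.
by split=> //; apply: IH.
Qed.

Lemma all_inter_zero (P : C -> Prop) m (X Z : C) : P ozero ->
  all_inter P (zero_chain m X Z).
Proof. by move=> P0; elim: m X => //= m IH X; split. Qed.

End ChainComparison.

(** * Iterated covers by objects of add T *)

Section CoverSequence.
Variables (k : fieldType) (C : addcat k) (T : C).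
Hypothesis split : split_idempotents C.

Lemma next_cover_ex (x : arrow C) : exists y : {A : C & mor A (asrc x)},
  in_add T (projT1 y) /\ limg (homT_mor T (projT2 y)) = lker
    (homT_mor T (amor x)).
Proof.
have [m [q [qh qU]]] := cover_ex (submod_lker (homT_hom (T := T) (amor x))).
have Ta := in_add_iter split T m; have [_ Tf _] := pobj_add Ta.
have [g gE] := Tf _ _ qh.
by exists (existT (fun A : C => mor A (asrc x) : Type) _ g); rewrite -gE.
Qed.

(** A choice function on arrows, so that the infinite resolution can be defined by iteration. *)
Definition next_cover (x : arrow C) : arrow C :=
  Arrow (projT2 (proj1_sig (constructive_indefinite_description _
    (next_cover_ex x)))).

Lemma next_coverP (x : arrow C) : in_add T (asrc (next_cover x)) /\
  limg (homT_mor T (amor (next_cover x))) = lker (homT_mor T (amor x)).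
Proof.
by rewrite /next_cover; case: (constructive_indefinite_description _ _).
Qed.

Variable X : C.

(** The zero endomorphism of X has everything as its kernel under mor T -, hence [cover 0] covers
    mor T X itself. *)
Definition cover (i : nat) : arrow C := iter i.+1 next_cover
  (Arrow (0 : mor X X)).

Lemma cover_add i : in_add T (asrc (cover i)).
Proof. by have [] := next_coverP (iter i next_cover (Arrow (0 : mor X X))). Qed.

Lemma cover_exact i :
  limg (homT_mor T (amor (cover i.+1))) = lker (homT_mor T (amor (cover i))).
Proof. by have [] := next_coverP (cover i). Qed.

Lemma cover0_surj : limg (homT_mor T (amor (cover 0) : mor _ X)) = fullv.
Proof.
have [_ ->] := next_coverP (Arrow (0 : mor X X)).
by apply/eqP; rewrite eqEsubv subvf; apply/subvP => v _; apply/lkerP;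
  rewrite /= homT_mor0 zero_lfunE.
Qed.

Lemma cover0_lift (w : mor T X) : exists v,
  w = (amor (cover 0) : mor _ X) \oc v.
Proof. by have [v ->] := (limg_fullP _).1 cover0_surj w; exists v;
  rewrite homTE. Qed.

Definition cover_resolution : proj_resolution (homT T X).
Proof.
apply: (@ProjResolution _ _ _ (homT T X) (fun i => homT T (asrc (cover i)))
  (fun i => homT_mor T (amor (cover i.+1)))
    (homT_mor T (amor (cover 0) : mor _ X))).
- by move=> i; apply: proj_lift_projective; have [] := pobj_add (cover_add i).
- by move=> i; apply: homT_hom.
- exact: homT_hom.
- by move=> i; exact (cover_exact i.+1).
- exact (cover_exact 0).
- exact: cover0_surj.
Defined.

Fixpoint cover_chain m : chain m (asrc (cover m)) X :=
  match m return chain m (asrc (cover m)) X with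
  | 0 => amor (cover 0)
  | m'.+1 => ccons (amor (cover m'.+1)) (cover_chain m')
  end.

Lemma cover_comp0 i : (amor (cover i) : mor _ (atgt (cover i))) \oc amor
  (cover i.+1) = 0.
Proof.
have [_ _ Tf] := pobj_add (cover_add i.+1); apply: Tf.
apply/lfunP => w; rewrite zero_lfunE homT_morM comp_lfunE.
by have /limg_lkerP[-> _] := cover_exact i.
Qed.

Hypothesis full : homT_full T.

(** A morphism annihilating the preceding cover map is a cocycle for [cover_resolution], and
    vanishing of Ext makes it a coboundary, which is a factorisation. At the right end fullness
    takes the place of Ext. *)
Lemma cover_chain_wcok m :
  (forall i Y, (0 < i <= m)%N -> ext_zero i (homT T X) (homT T Y)) ->
  cpairs (@wcok k C) (amor (cover m.+1)) (cover_chain m).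
Proof.
have split_ext i Y (w : mor (asrc (cover i)) Y) : w \oc amor (cover i.+1) = 0 ->
    (homT_mor T w \o homT_mor T (amor (cover i.+1)))%VF = 0.
  by move=> e; rewrite -homT_morM e homT_mor0.
elim: m => [|m IH] ez.
  split=> [|W w e]; first exact (cover_comp0 0).
  have [_ _ Tf] := pobj_add (cover_add 0).
  have [|g [gh gE]] := mod_factor (homT_hom _) cover0_surj
    (homT_hom (T := T) w).
    move=> v /lkerP; rewrite -(cover_exact 0) => /limgP[v' ->].
    by rewrite !homTE compA e comp0m.
  have [z zE] := full gh; exists z.
  apply/eqP; rewrite -subr_eq0; apply/eqP/Tf.
  by rewrite homT_morB homT_morM -zE -gE subrr.
split; last by apply: IH => i Y /andP[h1 h2]; apply: ez; rewrite h1 ltnW.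
split=> [|W w e]; first exact (cover_comp0 m.+1).
have [_ _ Tf] := pobj_add (cover_add m.+1).
have [_ Tg _] := pobj_add (cover_add m).
have [|||g [gh gE]] := ez m.+1 W _ cover_resolution (homT_mor T w).
- by rewrite leqnn.
- exact: homT_hom.
- exact: split_ext.
have [z zE] := Tg _ _ gh; exists z.
apply/eqP; rewrite -subr_eq0; apply/eqP/Tf.
by rewrite homT_morB homT_morM -zE -gE subrr.
Qed.

Lemma cover_chain_add m : all_inter (in_add T) (cover_chain m).
Proof. by elim: m => //= m IH; split=> //; apply: cover_add. Qed.

Lemma clast_cover_chain m : clast (cover_chain m) =
  existT (fun Y : C => mor Y X : Type) _ (amor (cover 0)).
Proof. by elim: m. Qed.

End CoverSequence.

(** * Condition (b) from fullness and vanishing of Ext *)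

Section FirstToB.
Variables (k : fieldType) (d : nat) (C : angulated k d.+1) (T : C).
Hypothesis split : split_idempotents C.
Hypothesis full : homT_full T.
Notation Sg := (susp C).

(** The angle sought is the rotated trivial one on X, obtained as a retract of an arbitrary angle
    ending in the zero morphism X -> Sigma 0. *)
Lemma cond_b_add (X : C) : in_add T X ->
  exists (Td : C) (c : chain d.+1 Td X) (h : mor X (Sg Td)),
    [/\ in_add T Td, all_inter (in_add T) c, angle (sseq_of (crcons h c))
      & homT_mor T h = 0].
Proof.
move=> Xa; have [c1 ac] := angle_with_last (0 : mor X (Sg ozero)).
have T0 : in_add T ozero by apply: (in_add_iter split T 0).
have [Y [g [c2 cE]]] := crcons_ex c1; rewrite {}cE in ac.
have pairs := angle_cpairs ac.
have [_ ex _] := cpairs_closed_last pairs.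
(* The morphism after g is zero, so the identity of X factors through g. *)
have [v vE] := ex X (idm X) (comp0m _ _).
have [gl _ _] := cpairs_clast (cpairs_closed_crcons pairs).
exists ozero, (crcons (idm X) (zero_chain d ozero X)), 0; split=> //.
- by apply: all_inter_crcons => //; apply: all_inter_zero.
- apply: (@retract_angle _ _ C ozero ozero (idm _) (idm _)
    (crcons 0 (crcons (idm X) (zero_chain d ozero X)))
    (crcons 0 (crcons g c2)) split _ _ ac); first exact: comp1m.
  rewrite !fmor1; apply: (@chain_retr_crcons _ _ _ _ _ _ _ (idm X) (idm X)).
  + exact: comp1m.
  + by rewrite comp1m compm1.
  + by rewrite comp1m compm1.
  apply: (@chain_retr_crcons _ _ _ _ _ _ _ v g).
  + by rewrite -vE.
  + by rewrite comp1m -vE.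
  + by [].
  exact: chain_retr_zero.
- exact: homT_mor0.
Qed.

(** On mor T X, q acts as 1 + u s. If u s had a right inverse, X would be a summand of T0; so u s is
    nilpotent and q acts injectively, which excludes nilpotency because w is nonzero. *)
Lemma indecomposable_nilpotent (X T0 : C) (u : mor T0 X) (s : mor X T0)
    (q : mor X X) (w : mor T X) :
  indecomposable X -> ~ in_add T X -> in_add T T0 -> w <> 0 ->
  (forall x : mor T X, q \oc x = x + u \oc (s \oc x)) ->
  forall n, cpow q n <> 0.
Proof.
move=> ind Xn T0a w0 qE n qn.
case: (indecomposable_fitting split (u \oc s) ind) => [[m ym] | [psi e]];
  last first.
  apply: Xn; apply: (@in_add_trans _ _ split _ _ T0) => //.
  by exists (s \oc psi), u; rewrite compA.
have inj (x : mor T X) : q \oc x = 0 -> x = 0.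
  rewrite qE => /eqP; rewrite addr_eq0 compA => /eqP e.
  have E j : cpow (u \oc s) j \oc x = (-1) ^+ j *: x.
    elim: j => [|j IH]; first by rewrite comp1m scale1r.
    by rewrite cpowS -compA IH compZr exprSr -scalerA scaleN1r [in RHS]e opprK.
  by have /eqP := E m; rewrite ym comp0m eq_sym scaler_eq0
    (negbTE (sign_neq0 _ _)) => /eqP.
apply: w0; have : cpow q n \oc w = 0 by rewrite qn comp0m.
by elim: n {qn} => [|n IH]; rewrite ?comp1m // cpowS -compA => /inj.
Qed.

Hypothesis ext : forall i Y Z, (0 < i < d.+1)%N ->
  ext_zero i (homT T Y) (homT T Z).

Lemma first_to_b : cond_b T.
Proof.
move=> X ind [w wn0].
case: (classic (in_add T X)) => [| Xn]; first exact: cond_b_add.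
pose cT := cover_chain T split X d.
pose f : mor (asrc (cover T split X d.+1)) (asrc (cover T split X d)) :=
  amor (cover T split X d.+1).
have [cU' aU] := angle_ex (a := C) f.
have [V [l [cU cE]]] := crcons_ex cU'; rewrite {}cE in aU.
have pairsU := angle_cpairs aU.
have wT : cpairs (@wcok k C) f cT.
  by apply: cover_chain_wcok => // i Y le; apply: ext.
have wU : cpairs (@wcok k C) f cU.
  by apply: cpairs_sub (cpairs_crcons pairsU) => A B D a b [h1 _ h2].
have sq1 : idm _ \oc f = f \oc idm _ by rewrite comp1m compm1.
have [iX hi] := chain_map_ex sq1 wT wU.
have [rX hr] := chain_map_ex sq1 wU wT.
have s0 : (idm _ \oc idm _ - idm _ - f \oc 0) \oc f = 0.
  by rewrite comp1m subrr compm0 subr0 comp0m.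
set u : mor _ X := amor (cover T split X 0).
have [s sE] : exists s, (rX \oc iX - idm X - u \oc s) \oc u = 0.
  by have := chain_homotopy hi hr wT s0; rewrite clast_cover_chain.
have [s' sE'] := chain_homotopy hr hi wU s0.
set hU := projT2 (clast cU) in sE'.
have [hl _ lcok] : wexact hU l.
  exact: (@cpairs_clast _ _ _ _ _ _ _ l (ccons f cU) pairsU).
have [t tE] := lcok _ _ sE'.
have us (x : mor T X) : exists v, x = u \oc v by exact: cover0_lift.
(* The homotopy relation holds after composition with u, and every x : T -> X factors through u. *)
have qE (x : mor T X) : (rX \oc iX) \oc x = x + u \oc (s \oc x).
  have [v ->] := us x; have := congr1 (precomp v) sE.
  rewrite /precomp comp0m -compA !compBl comp1m -!compA => /eqP.
  by rewrite -addrA -opprD subr_eq0 => /eqP.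
(* The homotopy at the right end reads iX rX = 1 + hU s' + t l. Composing with l shows that 1 + l t
   is the component to use at Sigma T_d. *)
have lw : l \oc (iX \oc rX) = (idm _ + l \oc t) \oc l.
  have -> : iX \oc rX = t \oc l + hU \oc s' + idm V.
    by rewrite -tE subrK subrK.
  rewrite !compDr (compA l hU) hl comp0m addr0 compm1 compDl comp1m addrC.
  by rewrite (compA l t).
have [om omE] := aut_full (idm _ + l \oc t).
(* Correcting the component at T_d does not disturb the first square, because Sigma f annihilates
   l. *)
have fom : f \oc om = idm _ \oc idm _ \oc f.
  apply: (@aut_inj _ _ Sg); rewrite fmorM omE compDr compm1 compA.
  by rewrite (angle_last0 aU) comp0m addr0 !comp1m.
have [eD fD] := fitting_ex om; have [AD [pD [jD [pjD jpD]]]] := split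
  (fitting_idem fD).
have [eX fX] := fitting_ex (iX \oc rX).
have [AX [pX [jX [pjX jpX]]]] := split (fitting_idem fX).
(* This idempotent belongs to an identity; it is kept in Fitting form to match [chain_split] and
   [split_square]. *)
have [ed fd] := fitting_ex (idm (asrc (cover T split X d)) \oc idm _).
have [Ad [pd [jd [pjd jpd]]]] := split (fitting_idem fd).
have [v [hv Iv]] := chain_split split (@in_add_trans _ _ split T) hi hr
  (cover_chain_add T split X d) fd fX pjd jpd pjX jpX.
have [f1 f2] := split_square fD fd fom pjD jpD pjd jpd.
have fSD : fitting (idm _ + l \oc t) (fmor Sg eD) by rewrite -omE;
  apply: fitting_fmor.
have pjSD : fmor Sg pD \oc fmor Sg jD = idm _ by rewrite -fmorM pjD fmor1.
have jpSD : fmor Sg jD \oc fmor Sg pD = fmor Sg eD by rewrite -fmorM jpD.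
have [l1 l2] := split_square fX fSD lw pjX jpX pjSD jpSD.
pose h := fmor Sg pD \oc l \oc jX.
pose c : chain d.+1 AD AX := ccons (pd \oc f \oc jD) v.
have ac : angle (sseq_of (crcons h c)).
  apply: (@retract_angle _ _ C AD _ jD pD (crcons h c) (ccons f (crcons l cU))
    split pjD _ aU).
  exists jd, pd; split=> //.
  exact: (chain_retr_crcons pjX l1 l2 hv).
have [[w0 w0E] _] := fitting_factor fX.
(* eX factors through iX, and maps T -> X lift along u; as iX u factors through hU, which l
   annihilates, h annihilates x. *)
have h0 (x : mor T AX) : h \oc x = 0.
  have [z zE] := us (w0 \oc (jX \oc x)).
  have [i1 i1E] : exists i1, hU \oc i1 = iX \oc u.
    by have := chain_mor_clast hi; rewrite clast_cover_chain.
  have jxE : jX \oc x = hU \oc (i1 \oc z).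
    rewrite compA i1E -compA -zE compA -w0E -jpX -(compA jX) (compA pX).
    by rewrite pjX comp1m.
  by rewrite /h -compA jxE -(compA _ l) (compA l) hl comp0m compm0.
have iso : is_iso (w0 \oc jX).
  have AXr : (pX \oc iX) \oc (w0 \oc jX) = idm AX.
    by rewrite -compA (compA iX) -w0E -jpX !compA pjX comp1m.
  pose eps := (w0 \oc jX) \oc (pX \oc iX).
  have eps2 : eps \oc eps = eps.
    by rewrite /eps -(compA (w0 \oc jX)) (compA (pX \oc iX)) AXr comp1m.
  case: (indecomposable_idem split ind eps2) => eE; last by exists (pX \oc iX).
  (* If the retract AX of X vanished, iX rX would be nilpotent, hence rX iX as well, contrary to
     [indecomposable_nilpotent]. *)
  have AX0 : idm AX = 0.
    have <- : ((pX \oc iX) \oc (w0 \oc jX)) \oc ((pX \oc iX) \oc (w0 \oc jX))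
      = idm AX.
      by rewrite AXr comp1m.
    by rewrite -(compA (pX \oc iX)) (compA (w0 \oc jX)) -/eps eE comp0m compm0.
  have eX0 : eX = 0 by rewrite -jpX (mor_to0 pX AX0) compm0.
  case: fX => n /(_ n (leqnn n)) [pE _ _ _].
  case: (@indecomposable_nilpotent X _ u s (rX \oc iX) w ind Xn
    (cover_add T split X 0) wn0 qE n.+1).
  have E : iX \oc (rX \oc iX) = (iX \oc rX) \oc iX by rewrite compA.
  by rewrite cpowS -compA (cpow_nat n E) -pE eX0 compm0 comp0m compm0.
pose kap := w0 \oc jX; have [kap' [k'k kk']] := iso.
exists AD, (cpost kap c), (h \oc kap'); split.
- apply: (in_add_trans split _ (cover_add T split X d.+1)).
  by exists jD, pD.
- apply: (@all_inter_cpost _ _ _ d.+1); split=> //.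
  by apply: (in_add_trans split _ (cover_add T split X d)); exists jd, pd.
- apply: (@angle_ciso _ _ C AD AD (idm AD) (crcons h c)
    (crcons (h \oc kap') (cpost kap c))) ac; first exact: is_iso_id.
  apply: ciso_crcons; [exact: iso | | exact: ciso_cpost].
  by rewrite -compA k'k compm1 fmor1 comp1m.
- by apply/homT_eq0P => x; rewrite -compA h0.
Qed.

End FirstToB.

Theorem theorem0p5 (k : closedFieldType) (d : nat) (C : angulated k d)
    (S : serre_functor C) (T : C) :
  (1 <= d)%N -> split_idempotents C ->
  ((cluster_tilting d (ess_image (T := T)) /\ homT_full T) <->
   [/\ cond_a T, cond_a' S T & cond_b T]) /\
  ([/\ cond_a T, cond_a' S T & cond_b T] <->
   [/\ strong_a T, strong_a' S T & cond_b T]).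
Proof.
case: d C S T => [//|d] C S T _ split.
have i_iii : cluster_tilting d.+1 (ess_image (T := T)) /\ homT_full T ->
    [/\ strong_a T, strong_a' S T & cond_b T].
  move=> [[_ ct ct'] full]; split.
  - by apply: first_to_strong_a => // M; apply: (ct' M).2.
  - by apply: first_to_strong_a' => // M; apply: (ct M).2.
  - apply: first_to_b => // i Y Z le.
    exact: (ct _).1 (ess_image_homT T Y) i _ le (ess_image_homT T Z).
have iii_ii : [/\ strong_a T, strong_a' S T & cond_b T] ->
    [/\ cond_a T, cond_a' S T & cond_b T].
  move=> [a a' b]; split=> //.
    move=> M Mext T1 T0 f q T1a T0a mp.
    have [c [ac kc]] := a M Mext T1 T0 f q T1a T0a mp.
    by exists c; split=> //; exists d.+1; rewrite leq_addr.
  move=> N Next T1 T0 g q T1a T0a mp.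
  have [c [ac kc]] := a' N Next T1 T0 g q T1a T0a mp.
  (* The index 2 lies in the range 1, ..., d + 1 because d is at least 1. *)
  by exists c; split=> //; exists 2; rewrite addn1.
have ii_i : [/\ cond_a T, cond_a' S T & cond_b T] ->
    cluster_tilting d.+1 (ess_image (T := T)) /\ homT_full T.
  by move=> [a a' b]; apply: (second_to_first split b a a').
by split; [split=> [/i_iii/iii_ii | /ii_i] | split=> [/ii_i/i_iii | /iii_ii]].
Qed.
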